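(* Let $m\in\mathbb{N}$, $1<p_1,\dots,p_m<\infty$, $\frac1p=\frac1{p_1}+\cdots+\frac1{p_m}$ and $\frac1m<p\le q<\infty$. Let $(X,\rho,\mu)$ be a space of homogeneous type satisfying the reverse doubling property, and let $K$ be a kernel satisfying the growth conditions whose associated functional $\varphi$ satisfies the decay condition (all as defined in the context). Let $u,v_1,\dots,v_m$ be weights on $X$ such that, for some $t>1$: if $q>1$, $$\sup_{B}\ \varphi(B)\,\mu(B)^{\frac1q+\frac1{p_1'}+\cdots+\frac1{p_m'}}\left(\frac1{\mu(B)}\int_B u^{qt}\,d\mu\right)^{\frac1{qt}}\prod_{i=1}^m\left(\frac1{\mu(B)}\int_B v_i^{-tp_i'}\,d\mu\right)^{\frac1{tp_i'}}<\infty,$$ and if $q\le1$, $$\sup_{B}\ \varphi(B)\,\mu(B)^{\frac1q+\frac1{p_1'}+\cdots+\frac1{p_m'}}\left(\frac1{\mu(B)}\int_B u^{q}\,d\mu\right)^{\frac1q}\prod_{i=1}^m\left(\frac1{\mu(B)}\int_B v_i^{-tp_i'}\,d\mu\right)^{\frac1{tp_i'}}<\infty,$$ the suprema being over $\rho$-balls $B$. Then there exists a constant $C$ such that $$\left(\int_X\left(|\mathcal{T}\vec f\,|\,u\right)^q d\mu\right)^{1/q}\le C\prod_{k=1}^m\left(\int_X(|f_k|v_k)^{p_k}\,d\mu\right)^{1/p_k}$$ for all $\vec f=(f_1,\dots,f_m)\in L^{p_1}(X,v_1^{p_1}d\mu)\times\cdots\times L^{p_m}(X,v_m^{p_m}d\mu)$,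 where $\mathcal{T}$ is the multilinear potential operator with kernel $K$. The constant $C$ depends only on the constants appearing in the quasi-triangle inequality, the doubling property, the reverse doubling property, the growth conditions, the decay condition, and the weight condition.
   Context: A weight is a nonnegative measurable function. $p_i'=p_i/(p_i-1)$. Space of homogeneous type: $(X,\rho,\mu)$ with $\rho$ a quasi-metric, $\rho(x,y)\le\kappa(\rho(x,z)+\rho(z,y))$ for some $\kappa\ge1$, and $\mu$ a Borel measure with the doubling property $0<\mu(B_\rho(x,2r))\le L\,\mu(B_\rho(x,r))<\infty$ for all $x\in X$, $r>0$, where $B_\rho(x,r)=\{y:\rho(x,y)<r\}$ (assumed open). $r(B)$ denotes the radius of $B$ and $\operatorname{diam}_\rho(X)=\sup\{\rho(x,y):x,y\in X\}$. Reverse doubling property: for all $\eta>1$ there are $c(\eta)>0$ and $\delta>0$ such that $\frac{\mu(B_\rho(x_1,r_1))}{\mu(B_\rho(x_2,r_2))}\ge c(\eta)\left(\frac{r_1}{r_2}\right)^\delta$ whenever $B_\rho(x_2,r_2)\subset B_\rho(x_1,r_1)$, $x_1,x_2\in X$, $0<r_1,r_2\le\eta\operatorname{diam}_\rho(X)$. Notation: for $x\in X$, $\vec x,\vec y\in X^m$: $\rho(x,\vec y)=\sum_{i=1}^m\rho(x,y_i)$, $\rho(\vec x,\vec y)=\sum_{i=1}^m\rho(x_i,y_i)$, $\vec f(\vec y)=f_1(y_1)\cdots f_m(y_m)$, $d\mu(\vec y)=d\mu(y_1)\cdots d\mu(y_m)$. Operator: $\mathcal{T}(\vec f)(x)=\int_{X^m}\vec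 f(\vec y)K(x,\vec y)\,d\mu(\vec y)$, where $K(x,\vec y)=\tilde K((x,\dots,x),\vec y)$ for a nonnegative kernel $\tilde K(\vec x,\vec y)$ on $X^m\times X^m$, continuous off the diagonal $\vec x=\vec y$ (where it may be singular). Growth conditions: for every $c>1$ there is $C>1$ such that (off the diagonal) $\tilde K(\vec x,\vec y)\le C\tilde K(\vec z,\vec y)$ if $\rho(\vec z,\vec y)\le c\,\rho(\vec x,\vec y)$, and $\tilde K(\vec x,\vec y)\le C\tilde K(\vec y,\vec z)$ if $\rho(\vec y,\vec z)\le c\,\rho(\vec x,\vec y)$. Functional $\varphi$: for a fixed $\eta>1$ and a sufficiently small $c_0>0$ (any $c_0$ with $0<c_0^\delta<c(\eta)$), for $\rho$-balls $B$ with $r(B)\le\eta\operatorname{diam}_\rho(X)$, $$\varphi(B)=\sup\{K(x,\vec y):(x,\vec y)\in B^{m+1},\ \rho(x,\vec y)\ge c_0\,r(B)\}.$$ When $\operatorname{diam}_\rho(X)<\infty$, $\eta$ is a fixed structural constant that may be taken as large as needed; different choices of $\eta,c_0$ give comparable values of $\varphi$. Suprema over $\rho$-balls involving $\varphi$ are over balls for which $\varphi$ is defined. Decay condition: there is $\epsilon>0$ such that for all $C_1>1$ there is $C_2>0$ with $$\varphi(B')\mu(B')^m\le C_2\left(\frac{r(B')}{r(B)}\right)^\epsilon\varphi(B)\mu(B)^m$$ for all balls $B'\subset B$ with $r(B'),r(B)<C_1\operatorname{diam}_\rho(X)$ (with $\varphi$ defined using some $\eta\ge C_1$). *)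

(* Defs.v *)
From HB Require Import structures.
From mathcomp Require Export all_boot all_order all_algebra.
From mathcomp Require Export all_classical all_reals all_analysis.
Export Order.TTheory GRing.Theory Num.Theory.
Export numFieldNormedType.Exports.

Set Implicit Arguments.
Unset Strict Implicit.
Unset Printing Implicit Defensive.

Local Open Scope classical_set_scope.
Local Open Scope ring_scope.

Section QuasiMetric.
Context {R : realType} {X : Type}.
Variable rho : X -> X -> R.

Definition qball (x : X) (r : R) : set X := [set y | rho x y < r].

Definition qopen (U : set X) : Prop :=
  forall x, U x -> exists2 r, 0 < r & qball x r `<=` U.

Definition diam : \bar R := ereal_sup [set (rho p.1 p.2)%:E | p in [set: X * X]].

Definition quasi_metric (kappa : R) : Prop :=
  [/\ 1 <= kappa,
      forall x y, 0 <= rho x y,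
      forall x y, rho x y = 0 <-> x = y,
      forall x y, rho x y = rho y x &
      forall x y z, rho x y <= kappa * (rho x z + rho z y)].

Definition rho_vec (m : nat) (x y : m.-tuple X) : R :=
  \sum_(i < m) rho (tnth x i) (tnth y i).

Definition rho_pt (m : nat) (x : X) (y : m.-tuple X) : R :=
  \sum_(i < m) rho x (tnth y i).

End QuasiMetric.

Section HomogeneousType.
Context {R : realType} {d : measure_display} {X : measurableType d}.
Variables (rho : X -> X -> R) (mu : {measure set X -> \bar R}).
Local Open Scope ereal_scope.

Definition doubling (L : R) : Prop := forall (x : X) (r : R), (0 < r)%R ->
  [/\ 0 < mu (qball rho x (2 * r)),
      mu (qball rho x (2 * r)) <= L%:E * mu (qball rho x r) &
      L%:E * mu (qball rho x r) < +oo].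

Record homogeneous_type (kappa L : R) : Prop := HomogeneousType {
  ht_quasi_metric : quasi_metric rho kappa ;
  ht_ball_open : forall x r, qopen rho (qball rho x r) ;
  ht_borel : @measurable d X = <<s qopen rho >> ;
  ht_doubling : doubling L }.

(* As the quantifiers are ordered, delta may depend on eta as c does. *)
Definition reverse_doubling (c delta : R -> R) : Prop :=
  forall eta : R, (1 < eta)%R ->
  [/\ (0 < c eta)%R, (0 < delta eta)%R &
  forall (x1 x2 : X) (r1 r2 : R), (0 < r1)%R -> (0 < r2)%R ->
    r1%:E <= eta%:E * diam rho -> r2%:E <= eta%:E * diam rho ->
    qball rho x2 r2 `<=` qball rho x1 r1 ->
    (c eta * (r1 / r2) `^ delta eta)%:E <=
      mu (qball rho x1 r1) / mu (qball rho x2 r2)].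

End HomogeneousType.

Section Kernel.
Context {R : realType} {d : measure_display} {X : measurableType d}.
Variables (m : nat) (rho : X -> X -> R) (mu : {measure set X -> \bar R}).
Variable Kt : m.-tuple X -> m.-tuple X -> R.

(* Since balls are open, they form a basis of neighbourhoods, and this is
   continuity for the product topology at every off-diagonal point. *)
Definition continuous_off_diagonal : Prop :=
  forall x y : m.-tuple X, x <> y -> forall e : R, 0 < e ->
  exists2 s : R, 0 < s &
    forall x' y' : m.-tuple X,
      (forall i, rho (tnth x i) (tnth x' i) < s) ->
      (forall i, rho (tnth y i) (tnth y' i) < s) ->
      `|Kt x' y' - Kt x y| < e.

Definition growth (Cg : R -> R) : Prop := forall c : R, 1 < c ->
  [/\ 1 < Cg c,
      forall x y z : m.-tuple X, x <> y -> z <> y ->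
        rho_vec rho z y <= c * rho_vec rho x y -> Kt x y <= Cg c * Kt z y &
      forall x y z : m.-tuple X, x <> y -> y <> z ->
        rho_vec rho y z <= c * rho_vec rho x y -> Kt x y <= Cg c * Kt y z].

(* Values of [Kt] on the diagonal are arbitrary nonnegative reals. *)
Record potential_kernel (Cg : R -> R) : Prop := PotentialKernel {
  pk_ge0 : forall x y, 0 <= Kt x y ;
  pk_continuous : continuous_off_diagonal ;
  pk_growth : growth Cg }.

Definition Kdiag (x : X) (y : m.-tuple X) : R := Kt (nseq_tuple m x) y.

(* [phi c0 x r] is the value of the functional at the ball [qball rho x r].
   The parameter eta only restricts the radii to [r <= eta * diam rho]; every
   use of [phi] below carries such a restriction. *)
Definition phi (c0 : R) (x : X) (r : R) : \bar R :=
  ereal_sup [set (Kdiag p.1 p.2)%:E | p in [set p : X * m.-tuple X |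
    [/\ qball rho x r p.1, forall i, qball rho x r (tnth p.2 i) &
        c0 * r <= rho_pt rho p.1 p.2]]].

(* [c0 eta] is the constant used to define [phi] for the range parameter eta. *)
Definition admissible (c delta c0 : R -> R) : Prop :=
  forall eta : R, 1 < eta -> 0 < c0 eta /\ c0 eta `^ delta eta < c eta.

(* For each [C1], the functional is the one defined with the range parameter
   [H C1 >= C1]. *)
Definition decay (c0 : R -> R) (eps : R) (C2 H : R -> R) : Prop :=
  0 < eps /\ forall C1 : R, 1 < C1 ->
  [/\ 0 < C2 C1, C1 <= H C1 &
  forall (x' x : X) (r' r : R), 0 < r' -> 0 < r ->
    (r'%:E < C1%:E * diam rho)%E -> (r%:E < C1%:E * diam rho)%E ->
    qball rho x' r' `<=` qball rho x r ->
    (phi (c0 (H C1)) x' r' * mu (qball rho x' r') ^+ m <=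
     (C2 C1 * (r' / r) `^ eps)%:E *
       (phi (c0 (H C1)) x r * mu (qball rho x r) ^+ m))%E].

(* Product measure on [n.-tuple X], as in dmu(y_1) ... dmu(y_n); it is the
   iterated product when mu is sigma-finite, as is every doubling measure. *)
Fixpoint prod_measure (n : nat) : set (n.-tuple X) -> \bar R :=
  match n with
  | 0 => dirac [tuple]
  | n'.+1 => pushforward (product_measure1 mu (@prod_measure n'))
               (fun z : X * n'.-tuple X => cons_tuple z.1 z.2)
  end.

Definition potential_op (f : 'I_m -> X -> R) (x : X) : \bar R :=
  (\int[@prod_measure m]_(y in [set: m.-tuple X])
     ((\prod_(i < m) f i (tnth y i)) * Kdiag x y)%:E)%E.

End Kernel.

Section Weights.
Context {R : realType} {d : measure_display} {X : measurableType d}.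
Variables (m : nat) (rho : X -> X -> R) (mu : {measure set X -> \bar R}).

Definition weight (w : X -> R) : Prop :=
  measurable_fun [set: X] w /\ forall x, 0 <= w x.

Definition conj_exp (p : R) : R := p / (p - 1).

Definition average (g : X -> \bar R) (B : set X) : \bar R :=
  ((\int[mu]_(y in B) g y) / mu B)%E.

(* The expression under the supremum, where [s] is the exponent put on [u].
   The inverse [v^(-t p')] is taken in [\bar R], so that it is [+oo] where [v]
   vanishes; it is not [powR v (- (t p'))], which is 0 there. *)
Definition weight_functional (Kt : m.-tuple X -> m.-tuple X -> R)
    (c0 q t s : R) (p : 'I_m -> R) (u : X -> R) (v : 'I_m -> X -> R)
    (x : X) (r : R) : \bar R :=
  let B := qball rho x r in
  (phi rho Kt c0 x r *
   mu B `^ (q^-1 + \sum_(i < m) (conj_exp (p i))^-1) *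
   average (fun y => (u y `^ s)%:E) B `^ s^-1 *
   \prod_(i < m)
     average (fun y => ((v i y `^ (t * conj_exp (p i)))%:E)^-1) B
       `^ (t * conj_exp (p i))^-1)%E.

Definition weight_sup (Kt : m.-tuple X -> m.-tuple X -> R)
    (eta c0 q t s : R) (p : 'I_m -> R) (u : X -> R) (v : 'I_m -> X -> R)
    : \bar R :=
  ereal_sup [set weight_functional Kt c0 q t s p u v b.1 b.2 |
    b in [set b : X * R | 0 < b.2 /\ (b.2%:E <= eta%:E * diam rho)%E]].

(* [(\int (|f| w)^p dmu)^(1/p)], with 0 * oo = 0. *)
Definition weighted_norm (p : R) (w : X -> R) (f : X -> \bar R) : \bar R :=
  ((\int[mu]_x ((`|f x| * (w x)%:E) `^ p)) `^ p^-1)%E.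

Definition weighted_Lp (p : R) (w : X -> R) (f : X -> R) : Prop :=
  measurable_fun [set: X] f /\
  (\int[mu]_x (((`|f x| `^ p) * (w x `^ p))%:E) < +oo)%E.

End Weights.

(* Main.v *)
From HB Require Import structures.
Require Import Defs.
From mathcomp Require Import ring lra zify measurable_realfun lebesgue_integral_fubini.

Set Implicit Arguments.
Unset Strict Implicit.
Unset Printing Implicit Defensive.

Local Open Scope classical_set_scope.
Local Open Scope ring_scope.

(** Write [x] for the point at which the potential is evaluated.  If the largest
    of the distances from [x] to [y_1, ..., y_m] is of order [r], the growth
    conditions bound [K(x, y)] by a multiple of [phi(B(x, r))].  Splitting the
    integral according to this distance bounds the potential by a sum over
    dyadic radii,
      [|T f (x)| <= C \sum_k phi(B_k) \prod_i \int_(B_k) |f_i|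
                  = C \sum_k lam(B_k) \prod_i <|f_i|>_(B_k)],
    where [B_k = B(x, 2^-k R)], [lam(B) = phi(B) mu(B)^m] and [<.>_B] is the
    average over [B].  Reverse doubling excludes atoms, so that the diagonal,
    where the kernel is arbitrary, is negligible ([potential_op_le]).

    The decay condition says that [lam] decreases geometrically with the radius.
    Hence among the scales at which the product of averages exceeds a threshold
    [q^a] only the largest matters.  For each [a], the covering lemma selects
    disjoint balls among those of largest radius on which the product exceeds
    [q^a].  If [q] is large, the weak type inequality shows that the balls of
    the levels above [a] cover at most half of each ball of level [a], and the
    sum over scales is at most a multiple of
      [S(x) = \sum_b lam(D b) \prod_i <|f_i|>_(D b) 1_(D b)(x)],
    the sum running over the sparse family of selected balls [b], and [D b]
    being a dilate of [b] ([sparse_domination]).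

    On one ball, Hoelder's inequality with exponents [t p_i'] and [a_i < p_i]
    turns the weight condition into ([ball_estimate])
      [lam(B) \prod_i <|f_i|>_B <u^s>_B^(1/s) mu(B)^(1/q)
         <= C \prod_i mu(B)^(1/p_i) <(|f_i| v_i)^a_i>_B^(1/a_i)].
    Let [X_i(b)] be the [i]-th factor on the right, for [B = D b].  As
    [p_i / a_i > 1], the Carleson embedding for sparse families bounds
    [\sum_b X_i(b)^p_i] by the integral of [(|f_i| v_i)^p_i] ([carleson]).

    If [q <= 1], then [(S u)^q] is at most the sum of the [q]-th powers of its
    terms, and it remains to sum [\prod_i X_i(b)^q]; Hoelder's inequality for
    sums applies with the exponents [q / p_i], whose sum is at least [1] because
    [p <= q] ([sparse_norm_le1]).  If [q > 1], the integral of [(S u)^q] is that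
    of [S u h] with [h = (S u)^(q - 1)].  The bump [t] on [u] leaves, on each
    ball, an average of a power of [h] with an exponent below [q'], and the
    Carleson embedding for [h] provides one more factor in the sum
    ([sparse_norm_gt1]).

    All this is done for finitely many scales on a ball of radius [2^n], with
    bounds that do not depend on [n]; Fatou's lemma then gives the theorem.  On
    such a ball some [f_i] may fail to be integrable.  Then the average of
    [v_i^(-t p_i')] is infinite, and the weight condition forces another of its
    factors to vanish, which makes the estimate trivial ([degenerate_bound]). *)

(** * Sums of powers *)

Section RealSums.
Context {R : realType}.

Lemma pow1R (r : R) : 1 `^ r = 1 :> R.
Proof. by rewrite powR1. Qed.

Lemma ler_powR_le1 (a r s : R) : 0 <= a -> a <= 1 -> 0 < r -> r <= s ->
  a `^ s <= a `^ r.
Proof.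
move=> a0 a1 r0 rs; have [->|an0] := eqVneq a 0.
  by rewrite !powR0 ?gt_eqF// (lt_le_trans r0).
have ap : 0 < a by rewrite lt_neqAle eq_sym an0.
rewrite /powR (negbTE an0) ler_expR ler_wnM2r// ln_le0//.
Qed.

Lemma powR_prod (I : Type) (s : seq I) (P : pred I) (F : I -> R) (r : R) :
  (forall i, 0 <= F i) ->
  (\prod_(i <- s | P i) F i) `^ r = \prod_(i <- s | P i) F i `^ r.
Proof.
move=> F0; elim: s => [|i s IH]; first by rewrite !big_nil powR1.
by rewrite !big_cons; case: ifP => // _; rewrite powRM ?IH// prodr_ge0.
Qed.

Lemma powR_sum_exp (I : Type) (s : seq I) (P : pred I) (F : I -> R) (a : R) :
  0 < a ->
  a `^ (\sum_(i <- s | P i) F i) = \prod_(i <- s | P i) a `^ F i.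
Proof.
move=> a0; elim: s => [|i s IH]; first by rewrite !big_nil powRr0.
rewrite !big_cons; case: ifP => // _.
rewrite powRD; first by rewrite IH.
by rewrite (gt_eqF a0) implybT.
Qed.

Lemma powR_add_le (a b r : R) : 0 < r -> r <= 1 -> 0 <= a -> 0 <= b ->
  (a + b) `^ r <= a `^ r + b `^ r.
Proof.
move=> r0 r1 a0 b0; have [S0|Sn0] := eqVneq (a + b) 0.
  by rewrite S0 powR0 ?gt_eqF// addr_ge0 ?powR_ge0.
have Sp : 0 < a + b by rewrite lt_neqAle eq_sym Sn0 addr_ge0.
set S := a + b in Sp Sn0 *.
have h c : 0 <= c -> c <= S -> S `^ r * (c / S) <= c `^ r.
  move=> c0 cS; rewrite -{2}(divfK Sn0 c) powRM ?divr_ge0//; last exact: ltW.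
  rewrite mulrC ler_wpM2r ?powR_ge0//.
  rewrite -[leLHS]powRr1 ?divr_ge0//; last exact: ltW.
  - apply: ler_powR_le1 => //; first by rewrite divr_ge0// ltW.
    by rewrite ler_pdivrMr// mul1r.
  exact: ltW.
have <- : S `^ r * (a / S) + S `^ r * (b / S) = S `^ r.
  by rewrite -mulrDr -mulrDl divff// mulr1.
by rewrite lerD// h// /S ?lerDl ?lerDr.
Qed.

Lemma powR_sum_le (I : Type) (s : seq I) (F : I -> R) (r : R) :
  0 < r -> r <= 1 -> (forall i, 0 <= F i) ->
  (\sum_(i <- s) F i) `^ r <= \sum_(i <- s) F i `^ r.
Proof.
move=> r0 r1 F0; elim: s => [|i s IH]; first by rewrite !big_nil powR0 ?gt_eqF.
rewrite !big_cons (le_trans (powR_add_le _ _ _ _))//; first exact: sumr_ge0.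
by rewrite lerD2l.
Qed.

Lemma geometric_tail_le (x : R) (l n : nat) : 0 <= x -> x < 1 ->
  \sum_(k < n | (l <= k)%N) x ^+ (k - l) <= (1 - x)^-1.
Proof.
move=> x0 x1; have h : 0 < 1 - x by rewrite subr_gt0.
rewrite -[leRHS]mul1r ler_pdivlMr//.
suff -> : (\sum_(k < n | (l <= k)%N) x ^+ (k - l)) * (1 - x) = 1 - x ^+ (n - l).
  by rewrite gerBl exprn_ge0.
elim: n => [|n IH]; first by rewrite big_ord0 mul0r sub0n subrr.
rewrite big_mkcond big_ord_recr/= -big_mkcond/= mulrDl IH.
case: ifPn => [ln|]; first by rewrite subSn// exprS; ring.
rewrite -ltnNge mul0r addr0 => nl.
by rewrite (eqP (ltnW nl : (n - l == 0)%N)) (eqP (nl : (n.+1 - l == 0)%N)).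
Qed.

(** The terms below [z] form a geometric sum, dominated by its largest term. *)
Lemma dyadic_powR_sum_le (e th z : R) (N : nat) : 0 < e -> 0 < th -> 0 <= z ->
  \sum_(n < N | th * 2 ^+ n < z) (th * 2 ^+ n) `^ e <=
  (1 - 2 `^ (- e))^-1 * z `^ e.
Proof.
move=> e0 th0 z0; set x := 2 `^ (- e).
have x1 : x < 1.
  rewrite /x powRN invf_lt1 ?powR_gt0// -[ltLHS](pow1R e).
  by rewrite gt0_ltr_powR ?nnegrE// ltr1n.
have x0 : 0 < x by rewrite powR_gt0.
have C0 : 0 < 1 - x by rewrite subr_gt0.
pose a (n : nat) : R := (th * 2 ^+ n) `^ e.
have aS n : a n = x * a n.+1.
  rewrite /a exprS mulrCA [in RHS]powRM ?mulr_ge0 ?exprn_ge0//; last exact: ltW.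
  by rewrite mulrA /x -powRD ?addNr ?powRr0 ?mul1r// pnatr_eq0 implybT.
have full n : \sum_(i < n.+1) a i <= (1 - x)^-1 * a n.
  elim: n => [|n IH].
    rewrite big_ord_recl big_ord0 addr0 ler_peMl ?powR_ge0//.
    by rewrite invf_ge1// gerBl ltW.
  rewrite big_ord_recr/= (le_trans (lerD IH (lexx _)))// aS mulrA.
  rewrite -{2}[a n.+1]mul1r -mulrDl ler_wpM2r ?powR_ge0//.
  rewrite le_eqVlt; apply/orP; left; apply/eqP.
  by field; rewrite gt_eqF.
elim: N => [|N IH].
  by rewrite big_ord0 mulr_ge0 ?powR_ge0// invr_ge0 ltW.
rewrite big_mkcond big_ord_recr/= -big_mkcond/=.
case: ifPn => [Nz|_]; last by rewrite addr0.
apply: (@le_trans _ _ (\sum_(i < N.+1) a i)).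
  rewrite big_ord_recr/= lerD2r big_mkcond; apply: ler_sum => i _.
  by case: ifP => // _; exact: powR_ge0.
rewrite (le_trans (full N))// ler_wpM2l ?invr_ge0//; first exact: ltW.
have p0 : 0 < th * 2 ^+ N by rewrite mulr_gt0// exprn_gt0.
by rewrite ge0_ler_powR ?nnegrE//; exact: ltW.
Qed.

(** If [\sum e_i >= 1], a product of powers [w_i ^ e_i] of numbers of [[0, 1]]
    is at most [(\sum w_i) ^ (\sum e_i) <= \sum w_i]; normalizing each family
    by its sum reduces Hoelder's inequality, up to the constant [#|I|], to
    this. *)
Lemma hoelder_sums (I : finType) (J : eqType) (s : seq J) (e : I -> R)
    (z : I -> J -> R) (Z : I -> R) :
  (forall i, 0 < e i) -> 1 <= \sum_i e i -> (forall i j, 0 <= z i j) ->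
  (forall i, \sum_(j <- s) z i j <= Z i) ->
  \sum_(j <- s) \prod_i z i j `^ e i <= #|I|%:R * \prod_i Z i `^ e i.
Proof.
move=> e0 e1 z0 zZ.
have Z0 i : 0 <= Z i by rewrite (le_trans _ (zZ i))// sumr_ge0.
have [[i Zi0]|Zn0] := pselect (exists i, Z i = 0).
  rewrite big1_seq ?mulr_ge0 ?prodr_ge0// => [i' _|j /andP[_ js]].
    exact: powR_ge0.
  have : z i j <= 0.
    rewrite -Zi0 (le_trans _ (zZ i))// (big_rem j)//= lerDl.
    by rewrite sumr_ge0.
  rewrite le_eqVlt ltNge z0 orbF => /eqP zij.
  by rewrite (bigD1 i)//= zij powR0 ?mul0r// gt_eqF.
have Zp i : 0 < Z i.
  by rewrite lt_neqAle Z0 andbT eq_sym; apply/eqP => Zi; apply: Zn0; exists i.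
pose w i j := z i j / Z i.
have w0 i j : 0 <= w i j by rewrite divr_ge0.
have zE j : \prod_i z i j `^ e i = (\prod_i Z i `^ e i) * \prod_i w i j `^ e i.
  rewrite -big_split/=; apply: eq_bigr => i _.
  by rewrite -powRM// /w mulrC divfK// gt_eqF.
have wle j : j \in s -> \prod_i w i j `^ e i <= \sum_i w i j.
  move=> js; set S := \sum_i w i j.
  have wS i : w i j <= S.
    by rewrite /S (bigD1 i)//= lerDl sumr_ge0.
  have [S1|S1] := leP 1 S.
    have w1 i : w i j <= 1.
      rewrite ler_pdivrMr// mul1r (le_trans _ (zZ i))// (big_rem j)//= lerDl.
      by rewrite sumr_ge0.
    apply: le_trans S1; rewrite -[leRHS](@big1_eq _ 1 *%R I (index_enum I) xpredT).
    apply: ler_prod => i _; rewrite powR_ge0/= -[leRHS](pow1R (e i)).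
    by rewrite ge0_ler_powR ?nnegrE// ltW.
  have [S0|S0] := eqVneq S 0.
    have w00 i : w i j = 0 by apply/eqP; rewrite eq_le w0 andbT -S0.
    have [i _] : exists i : I, true.
      have [//|n] := pselect (exists i : I, true).
      move: e1; rewrite big1 ?ler10// => i _; exfalso; apply: n; by exists i.
    by rewrite (bigD1 i)//= w00 powR0 ?mul0r ?S0// gt_eqF.
  have Sp : 0 < S by rewrite lt_neqAle eq_sym S0 sumr_ge0.
  apply: (@le_trans _ _ (\prod_i S `^ e i)).
    apply: ler_prod => i _; rewrite powR_ge0/= ge0_ler_powR ?nnegrE//.
    - exact: ltW.
    - exact: ltW.
  rewrite -powR_sum_exp// -[leRHS]powRr1; last exact: ltW.
  by apply: ler_powR_le1 => //; exact: ltW.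
rewrite (eq_bigr _ (fun j _ => zE j)).
rewrite -mulr_sumr mulrC ler_wpM2r//.
  by apply: prodr_ge0 => i _; exact: powR_ge0.
apply: (@le_trans _ _ (\sum_(j <- s) \sum_i w i j)).
  by rewrite big_seq [leRHS]big_seq; exact: ler_sum.
rewrite exchange_big/= -sum1_card natr_sum; apply: ler_sum => i _.
by rewrite -mulr_suml ler_pdivrMr// mul1r.
Qed.

End RealSums.

(** * Integrals of nonnegative functions *)

Section Integrals.
Import HBNNSimple.
Context {d : measure_display} {T : measurableType d} {R : realType}.
Variable mu : {measure set T -> \bar R}.
Local Open Scope ereal_scope.

(** No measurability is needed for the next comparisons: the integral of a
    nonnegative function is the supremum of those of the simple functions below
    it.  They apply to integrands built from the kernel. *)
Lemma le_integral_dominated (f g : T -> \bar R) :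
  (forall x, 0 <= f x) -> (forall x, f x <= g x) ->
  \int[mu]_x f x <= \int[mu]_x g x.
Proof.
move=> f0 fg; have g0 x : 0 <= g x by exact: le_trans (fg x).
rewrite !ge0_integralTE//; apply: ereal_sup_le => _ [h hf <-].
by exists h => // x; exact: le_trans (fg x).
Qed.

Lemma le_integral_dominated_in (D : set T) (f g : T -> \bar R) :
  (forall x, D x -> 0 <= f x) -> (forall x, D x -> f x <= g x) ->
  \int[mu]_(x in D) f x <= \int[mu]_(x in D) g x.
Proof.
move=> f0 fg; rewrite [leLHS]integral_mkcond [leRHS]integral_mkcond.
apply: le_integral_dominated => x; first exact: erestrict_ge0.
exact: lee_restrict.
Qed.

(** The positive and negative parts are bounded separately, as the integral of
    a non-measurable function need not be additive; hence the factor [2]. *)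
Lemma abse_integral_dominated (f g : T -> \bar R) :
  (forall x, `|f x| <= g x) -> `|\int[mu]_x f x| <= 2%:E * \int[mu]_x g x.
Proof.
move=> fg; rewrite integralE (le_trans (lee_abs_sub _ _))//.
rewrite !gee0_abs ?integral_ge0//.
have -> : 2%:E = 1 + 1 :> \bar R by rewrite -EFinD.
rewrite ge0_muleDl// mul1e.
rewrite leeD// le_integral_dominated// => x; rewrite (le_trans _ (fg x))//.
- by rewrite funeposE ge_max abse_ge0 lee_abs.
- by rewrite funenegE ge_max abse_ge0 -abseN lee_abs.
Qed.

Lemma le_limn_einf (u : (\bar R)^nat) (a : \bar R) (n0 : nat) :
  (forall n, (n0 <= n)%N -> a <= u n) -> a <= limn_einf u.
Proof.
move=> h; rewrite limn_einf_lim; apply: lime_ge; first exact: is_cvg_einfs.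
exists n0 => // n /= n0n; apply: le_ereal_inf_tmp => _ [k /= nk <-].
by rewrite h// (leq_trans n0n).
Qed.

Lemma limn_einf_le (u : (\bar R)^nat) (a : \bar R) :
  (forall n, u n <= a) -> limn_einf u <= a.
Proof.
move=> h; rewrite limn_einf_lim; apply: lime_le; first exact: is_cvg_einfs.
apply: nearW => n; rewrite (le_trans _ (h n))//.
by apply: ereal_inf_lbound; exists n => /=.
Qed.

Lemma lt_limn_einf (u : (\bar R)^nat) (a : \bar R) : a < limn_einf u ->
  exists n0, forall n, (n0 <= n)%N -> a < u n.
Proof.
rewrite limn_einf_lim (cvg_lim _ (@cvg_einfs_sup _ u))//.
move=> /ereal_sup_gt[_ [n0 _ <-] an]; exists n0 => n nn.
by apply: (lt_le_trans an); apply: ereal_inf_lbound; exists n.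
Qed.

(** A form of Fatou's lemma in which only the approximations [g n] are
    measurable; the condition on the levels [M] says that [f] is at most the
    lower limit of [g], without reference to that limit. *)
Lemma integral_le_of_eventually (f : T -> \bar R) (g : (T -> \bar R)^nat)
    (a : \bar R) :
  (forall x, 0 <= f x) -> (forall n, measurable_fun [set: T] (g n)) ->
  (forall n x, 0 <= g n x) ->
  (forall x (M : R), (0 <= M)%R -> M%:E < f x ->
     exists n0, forall n, (n0 <= n)%N -> M%:E <= g n x) ->
  (forall n, \int[mu]_x g n x <= a) -> \int[mu]_x f x <= a.
Proof.
move=> f0 mg g0 fg ga.
apply: (@le_trans _ _ (\int[mu]_x limn_einf (g^~ x))).
  apply: le_integral_dominated => // x; rewrite leNgt; apply/negP => gf.
  have l0 : 0 <= limn_einf (g^~ x) by apply: (le_limn_einf (n0 := 0%N)) => n _.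
  have lfin : limn_einf (g^~ x) = (fine (limn_einf (g^~ x)))%:E.
    by rewrite fineK// ge0_fin_numE// (lt_le_trans gf)// leey.
  set l := fine _ in lfin.
  have [M lM Mf] : exists2 M : R, (l < M)%R & M%:E < f x.
    move: gf; rewrite lfin; case: (f x) (f0 x) => [y _|_|//].
      rewrite lte_fin => ly; exists ((l + y) / 2)%R; first by rewrite midf_lt.
      by rewrite lte_fin midf_lt.
    by exists (l + 1)%R; [rewrite ltrDl|rewrite ltry].
  have M0 : (0 <= M)%R by rewrite (le_trans _ (ltW lM))// -lee_fin -lfin.
  have [n0 h] := fg x M M0 Mf.
  by have := le_limn_einf h; rewrite lfin lee_fin leNgt lM.
by rewrite (le_trans (fatou _ _ _ _))//; exact: limn_einf_le.
Qed.

End Integrals.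

(** * Balls in a space of homogeneous type *)

(** [2 ^+ dil_exp kappa] is a dilation factor for which a ball is absorbed by
    the dilate of any larger ball which it meets; a power of [2], so that the
    doubling inequality applies to it. *)
Definition dil_exp {R : realType} (kappa : R) : nat := Num.bound (3 * kappa ^+ 2).
Definition dil {R : realType} (kappa : R) : R := 2 ^+ dil_exp kappa.

Definition ball_mass {R : realType} {d : measure_display} {X : measurableType d}
  (rho : X -> X -> R) (mu : {measure set X -> \bar R}) (x : X) (r : R) : R :=
  fine (mu (qball rho x r)).

Section Geometry.
Context {R : realType} {d : measure_display} {X : measurableType d}.
Variables (rho : X -> X -> R) (mu : {measure set X -> \bar R}) (kappa L : R).
Hypothesis hX : homogeneous_type rho mu kappa L.

Lemma kappa_ge1 : 1 <= kappa.
Proof. by case: (ht_quasi_metric hX). Qed.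

Lemma rho_ge0 x y : 0 <= rho x y.
Proof. by case: (ht_quasi_metric hX). Qed.

Lemma rho_eq0 x y : rho x y = 0 <-> x = y.
Proof. by case: (ht_quasi_metric hX). Qed.

Lemma rhoxx x : rho x x = 0.
Proof. exact/rho_eq0. Qed.

Lemma rho_sym x y : rho x y = rho y x.
Proof. by case: (ht_quasi_metric hX). Qed.

Lemma rho_triangle z x y : rho x y <= kappa * (rho x z + rho z y).
Proof. by case: (ht_quasi_metric hX). Qed.

Lemma qball_center x r : 0 < r -> qball rho x r x.
Proof. by move=> r0; rewrite /qball/= rhoxx. Qed.

Lemma subset_qball x r s : r <= s -> qball rho x r `<=` qball rho x s.
Proof. by move=> rs y /= /lt_le_trans; apply. Qed.

Lemma dil_ge : 3 * kappa ^+ 2 <= dil kappa.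
Proof.
have h : 0 <= 3 * kappa ^+ 2 by rewrite mulr_ge0// sqr_ge0.
rewrite (le_trans (ltW (archi_boundP h)))// /dil /dil_exp -natrX ler_nat.
exact/ltnW/ltn_expl.
Qed.

Lemma dil_exp_gt0 : (0 < dil_exp kappa)%N.
Proof.
have h : 0 <= 3 * kappa ^+ 2 by rewrite mulr_ge0// sqr_ge0.
rewrite lt0n; apply/eqP => e0; have := archi_boundP h.
by rewrite -/(dil_exp kappa) e0 ltNge h.
Qed.

Lemma dil_gt0 : 0 < dil kappa.
Proof. exact: exprn_gt0. Qed.

Lemma dil_ge1 : 1 <= dil kappa.
Proof. exact: exprn_ege1 (ler1n _ 2). Qed.

(** Two uses of the quasi-triangle inequality, from [x] to [z] and from [z]
    through [y], cost [kappa + 2 * kappa ^+ 2 <= 3 * kappa ^+ 2]. *)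
Lemma engulf x y z r s : s <= r -> qball rho x r z -> qball rho y s z ->
  qball rho y s `<=` qball rho x (dil kappa * r).
Proof.
rewrite /qball/= => sr xz yz w /= yw.
have k1 := kappa_ge1.
have k0 : 0 <= kappa by rewrite (le_trans _ k1).
have r0 : 0 < r by rewrite (le_lt_trans _ xz)// rho_ge0.
have zw : rho z w <= kappa * (r + r).
  rewrite (le_trans (rho_triangle y z w))// ler_wpM2l// lerD//.
    by rewrite rho_sym (le_trans (ltW yz)).
  by rewrite (le_trans (ltW yw)).
have h : rho x w < kappa * (r + kappa * (r + r)).
  rewrite (le_lt_trans (rho_triangle z x w))// ltr_pM2l ?(lt_le_trans _ k1)//.
  by rewrite ltr_leD.
rewrite (lt_le_trans h)// (le_trans _ (ler_wpM2r (ltW r0) dil_ge))//.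
have kk : kappa * r <= kappa ^+ 2 * r by rewrite ler_pM2r// expr2 ler_peMl.
have -> : kappa * (r + kappa * (r + r)) = kappa * r + 2 * (kappa ^+ 2 * r) by ring.
lra.
Qed.

Lemma measurable_qopen U : qopen rho U -> measurable U.
Proof. by move=> oU; rewrite (ht_borel hX); exact: sub_gen_smallest. Qed.

Lemma measurable_qball x r : measurable (qball rho x r).
Proof. exact/measurable_qopen/(ht_ball_open hX). Qed.

Lemma measurable_point (x : X) : measurable [set x].
Proof.
rewrite (_ : [set x] = \bigcap_n qball rho x n.+1%:R^-1).
  by apply: bigcap_measurable => // n _; exact: measurable_qball.
apply/seteqP; split => y /=; first by move=> -> n _; exact: qball_center.
move=> h; apply/esym/rho_eq0/eqP; rewrite eq_le rho_ge0 andbT.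
apply/ler_addgt0Pl => e e0; rewrite addr0.
have [n ne] := ltr_add_invr e0; rewrite add0r in ne.
by rewrite (le_trans (ltW (h n I)))// ltW.
Qed.

Let dbl x r : 0 < r ->
  [/\ (0 < mu (qball rho x (2 * r)))%E,
      (mu (qball rho x (2 * r)) <= L%:E * mu (qball rho x r))%E &
      (L%:E * mu (qball rho x r) < +oo)%E].
Proof. exact: (ht_doubling hX). Qed.

Lemma mu_qball_gt0 x r : 0 < r -> (0 < mu (qball rho x r))%E.
Proof.
move=> r0; have -> : r = 2 * (r / 2) by field.
by have [] := @dbl x (r / 2); rewrite ?divr_gt0.
Qed.

Lemma mu_qball_lty x r : 0 < r -> (mu (qball rho x r) < +oo)%E.
Proof.
move=> r0; have -> : r = 2 * (r / 2) by field.
by have [] := @dbl x (r / 2); rewrite ?divr_gt0// => _; exact: le_lt_trans.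
Qed.

Lemma mballE x r : 0 < r -> mu (qball rho x r) = (ball_mass rho mu x r)%:E.
Proof.
move=> r0; rewrite /ball_mass fineK// ge0_fin_numE// mu_qball_lty//.
Qed.

Lemma mball_gt0 x r : 0 < r -> 0 < ball_mass rho mu x r.
Proof. by move=> r0; rewrite -lte_fin -mballE// mu_qball_gt0. Qed.

Lemma le_mball x y r s : 0 < r -> 0 < s -> qball rho x r `<=` qball rho y s ->
  ball_mass rho mu x r <= ball_mass rho mu y s.
Proof.
move=> r0 s0 xy; rewrite -lee_fin -!mballE// le_measure// inE;
  exact: measurable_qball.
Qed.

Lemma mball_double x r : 0 < r -> ball_mass rho mu x (2 * r) <= L * ball_mass rho mu x r.
Proof.
move=> r0; rewrite -lee_fin EFinM -!mballE ?mulr_gt0//.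
by have [] := @dbl x r r0.
Qed.

Lemma doubling_ge1 (x : X) : 1 <= L.
Proof.
have r0 : 0 < 1 :> R by [].
rewrite -(ler_pM2r (mball_gt0 x r0)) mul1r (le_trans _ (mball_double x r0))//.
by rewrite le_mball ?mulr1//; apply: subset_qball; rewrite ler1n.
Qed.

Lemma mball_pow2 n x r : 0 < r ->
  ball_mass rho mu x (2 ^+ n * r) <= L ^+ n * ball_mass rho mu x r.
Proof.
move=> r0; elim: n => [|n IH]; first by rewrite !mul1r.
have L0 : 0 <= L by rewrite (le_trans _ (doubling_ge1 x)).
rewrite exprS -mulrA (le_trans (mball_double _ _)) ?mulr_gt0 ?exprn_gt0//.
by rewrite exprS -mulrA ler_wpM2l.
Qed.

End Geometry.

(** * Superadditive set functions and the covering lemma *)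

Section Superadditive.
Context {R : realType} {d : measure_display} {X : measurableType d}.

(** The weak type and packing arguments use of a measure only that it is
    monotone and superadditive on disjoint sets; working with real values avoids infinite
    masses. *)
Definition superadditive (nu : set X -> R) : Prop :=
  [/\ forall A, 0 <= nu A,
      forall A B, measurable A -> measurable B -> A `<=` B -> nu A <= nu B &
      forall A B, measurable A -> measurable B -> [disjoint A & B] ->
        nu A + nu B <= nu (A `|` B)].

Lemma bigsetU_sub (I : choiceType) (s : seq I) (F : I -> set X) (V : set X) :
  {in s, forall i, F i `<=` V} -> \big[setU/set0]_(i <- s) F i `<=` V.
Proof. by move=> h; rewrite -bigcup_seq => x [i /= /h]; apply. Qed.

Lemma sum_superadditive_le nu (I : choiceType) (s : seq I) (F : I -> set X) (V : set X) :
  superadditive nu -> uniq s -> trivIset [set` s] F ->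
  (forall i, measurable (F i)) -> measurable V ->
  {in s, forall i, F i `<=` V} -> \sum_(i <- s) nu (F i) <= nu V.
Proof.
move=> [nu0 numono nuadd] us tF mF mV FV.
have mU s' : measurable (\big[setU/set0]_(i <- s') F i).
  exact: bigsetU_measurable.
apply: (@le_trans _ _ (nu (\big[setU/set0]_(i <- s) F i))); last first.
  by apply: numono => //; exact: bigsetU_sub.
elim: s us tF {FV} => [|i s IH] /=; first by rewrite !big_nil.
move=> /andP[si us] tF; rewrite !big_cons.
apply: (@le_trans _ _ (nu (F i) + nu (\big[setU/set0]_(j <- s) F j))).
  rewrite lerD2l IH//; apply: sub_trivIset tF => j /= js.
  by rewrite inE js orbT.
apply: nuadd => //; apply/disj_setPS => x [Fix].
rewrite -bigcup_seq => -[j /= js Fjx].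
have ij : i = j.
  by apply: tF; rewrite /= ?inE ?eqxx ?js ?orbT//; exists x.
by move: si; rewrite ij js.
Qed.

End Superadditive.

Section DensityMass.
Context {R : realType} {d : measure_display} {X : measurableType d}.
Variable mu : {measure set X -> \bar R}.

(** The window [W], on which [g] will be integrable, is what allows a real
    value for every [A]. *)
Definition mass (g : X -> \bar R) (W A : set X) : R :=
  fine (\int[mu]_(x in A `&` W) g x)%E.

Lemma mass_fin (g : X -> \bar R) W A : measurable W -> measurable A ->
  measurable_fun [set: X] g -> (forall x, 0 <= g x)%E ->
  (\int[mu]_(x in W) g x < +oo)%E ->
  (\int[mu]_(x in A `&` W) g x)%E = (mass g W A)%:E.
Proof.
move=> mW mA mg g0 gW; rewrite /mass fineK// ge0_fin_numE ?integral_ge0//.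
apply: le_lt_trans gW; apply: ge0_subset_integral => //.
- exact: measurableI.
- exact: measurable_funTS.
Qed.

Lemma superadditive_mass (g : X -> \bar R) W : measurable W ->
  measurable_fun [set: X] g -> (forall x, 0 <= g x)%E ->
  (\int[mu]_(x in W) g x < +oo)%E -> superadditive (mass g W).
Proof.
move=> mW mg g0 gW; split.
- by move=> A; rewrite fine_ge0// integral_ge0.
- move=> A B mA mB AB; rewrite -lee_fin -!mass_fin//.
  apply: ge0_subset_integral => //; try exact: measurableI.
    exact: measurable_funTS.
  exact: setSI.
- move=> A B mA mB AB; rewrite -lee_fin EFinD -!mass_fin//; last exact: measurableU.
  rewrite setIUl ge0_integral_setU//; try exact: measurableI.
    exact: measurable_funTS.
  by apply/disj_setPS => x [[Ax _] [Bx _]]; move/disj_setPS: AB; apply.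
Qed.

Lemma mass1E W A : measurable W -> measurable A -> (mu W < +oo)%E -> A `<=` W ->
  (mass (cst 1%E) W A)%:E = mu A.
Proof.
move=> mW mA Wy AW; rewrite -mass_fin//; last by rewrite integral_cst// mul1e.
by rewrite integral_cst ?mul1e ?(setIidl AW)//; exact: measurableI.
Qed.

End DensityMass.

Section Vitali.
Context {R : realType} {d : measure_display} {X : measurableType d}.
Variables (rho : X -> X -> R) (mu : {measure set X -> \bar R}) (kappa L : R).
Hypothesis hX : homogeneous_type rho mu kappa L.
Variables (x0 : X) (Rt : R).
Hypothesis Rt0 : 0 < Rt.

(** Balls are indexed by a centre and a scale, and not treated as sets, since a
    set may be a ball for several centres and radii. *)
Definition dyadic_radius (k : nat) : R := Rt / 2 ^+ k.
Definition scaled_ball (c : R) (b : X * nat) : set X := qball rho b.1 (c * dyadic_radius b.2).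

Lemma radius_gt0 k : 0 < dyadic_radius k.
Proof. by rewrite divr_gt0// exprn_gt0. Qed.

Lemma le_radius k l : (k <= l)%N -> dyadic_radius l <= dyadic_radius k.
Proof.
move=> kl; rewrite /dyadic_radius ler_pM2l// lef_pV2 ?posrE ?exprn_gt0//.
by rewrite ler_weXn2l// ler1n.
Qed.

Lemma radius_le k : dyadic_radius k <= Rt.
Proof. by rewrite -[leRHS]divr1 -[X in _ / X](expr0 2) le_radius. Qed.

Lemma radiusD k n : 2 ^+ n * dyadic_radius (k + n) = dyadic_radius k.
Proof. by rewrite /dyadic_radius exprD; field; rewrite !expf_neq0. Qed.

Lemma measurable_scaled_ball c b : measurable (scaled_ball c b).
Proof. exact: (measurable_qball hX). Qed.

Lemma scaled_ball_center c b : 0 < c -> scaled_ball c b b.1.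
Proof. by move=> c0; apply: (qball_center hX); rewrite mulr_gt0// radius_gt0. Qed.

Definition window_ball (N : nat) (b : X * nat) : Prop :=
  qball rho x0 Rt b.1 /\ (b.2 <= N)%N.

(** A ball containing the [c]-fold dilates of all the balls of the window. *)
Local Notation V c := (qball rho x0 (dil kappa * (c * Rt))).

Lemma scaled_ball_sub_window c N b : 1 <= c -> window_ball N b -> scaled_ball c b `<=` V c.
Proof.
move=> c1 [xb _]; have c0 : 0 < c by exact: lt_le_trans c1.
apply: (engulf hX (z := b.1)).
- by rewrite ler_wpM2l ?radius_le// ltW.
- by apply: subset_qball xb; rewrite ler_peMl// ltW.
- exact: scaled_ball_center.
Qed.

(** Each ball of the window carries a fixed fraction of its mass, which bounds
    the number of disjoint ones in [size_disjoint_le]. *)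
Lemma window_mass_le c N b : 1 <= c -> window_ball N b ->
  ball_mass rho mu x0 (dil kappa * (c * Rt)) <=
  L ^+ (dil_exp kappa + dil_exp kappa + N) * ball_mass rho mu b.1 (c * dyadic_radius b.2).
Proof.
move=> c1 [xb bN]; have c0 : 0 < c by exact: lt_le_trans c1.
have d0 := @dil_gt0 R kappa.
have L1 := doubling_ge1 hX x0.
apply: (@le_trans _ _ (L ^+ (dil_exp kappa + dil_exp kappa + b.2) *
    ball_mass rho mu b.1 (c * dyadic_radius b.2))); last first.
  rewrite ler_wpM2r// ?ler_weXn2l// ?leq_add2l//.
  by apply/ltW/(mball_gt0 hX); rewrite mulr_gt0// radius_gt0.
rewrite (le_trans _ (mball_pow2 hX _ _ _))// ?mulr_gt0 ?radius_gt0//.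
apply: (le_mball hX); rewrite ?mulr_gt0 ?exprn_gt0 ?radius_gt0//.
have -> : 2 ^+ (dil_exp kappa + dil_exp kappa + b.2) * (c * dyadic_radius b.2) =
    dil kappa * (dil kappa * (c * Rt)).
  by rewrite /dil /dyadic_radius !exprD; field; rewrite expf_neq0.
have dd : c * Rt <= dil kappa * (c * Rt).
  by rewrite ler_peMl ?(dil_ge1)// mulr_ge0// ltW.
apply: (engulf hX (z := b.1)) => //.
- by apply: (qball_center hX); rewrite !mulr_gt0.
- apply: subset_qball xb; apply: le_trans dd; rewrite ler_peMl//; exact: ltW.
Qed.

Lemma size_disjoint_le c N s : 1 <= c -> uniq s ->
  trivIset [set` s] (scaled_ball c) -> {in s, forall b, window_ball N b} ->
  (size s)%:R <= L ^+ (dil_exp kappa + dil_exp kappa + N).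
Proof.
move=> c1 us ts sN; have c0 : 0 < c by exact: lt_le_trans c1.
have cR0 : 0 < dil kappa * (c * Rt) by rewrite !mulr_gt0// dil_gt0.
have mV : measurable (V c) by exact: (measurable_qball hX).
have Vy : (mu (V c) < +oo)%E by exact: (mu_qball_lty hX).
have V0 : 0 < ball_mass rho mu x0 (dil kappa * (c * Rt)) by exact: (mball_gt0 hX).
rewrite -(ler_pM2r V0); set M := L ^+ _.
have M0 : 0 <= M by rewrite exprn_ge0// (le_trans ler01)// (doubling_ge1 hX x0).
have sup1 : superadditive (mass mu (cst 1%E) (V c)).
  by apply: superadditive_mass => //; rewrite integral_cst// mul1e.
have h := sum_superadditive_le sup1 us ts (measurable_scaled_ball c) mV.
apply: (@le_trans _ _ (\sum_(b <- s) M * ball_mass rho mu b.1 (c * dyadic_radius b.2))).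
  rewrite -sum1_size natr_sum mulr_suml big_seq [leRHS]big_seq.
  apply: ler_sum => b bs; rewrite mul1r; apply: window_mass_le => //; exact: sN.
rewrite -mulr_sumr ler_wpM2l//.
apply: le_trans (le_trans (h _) _).
- rewrite big_seq [leRHS]big_seq; apply: ler_sum => b bs.
  rewrite -lee_fin mass1E//; last by apply: scaled_ball_sub_window => //; exact: sN.
    by rewrite -(mballE hX)// mulr_gt0// radius_gt0.
  exact: measurable_scaled_ball.
- by move=> b bs; apply: scaled_ball_sub_window => //; exact: sN.
- by rewrite -lee_fin mass1E// -(mballE hX).
Qed.

(** Greedy selection, from the largest scale down: at each scale, a disjoint
    family is extended to a maximal one, which exists since the number of
    disjoint balls is bounded.  A ball outside it then meets a selected ball of
    its own or a larger scale. *)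
Lemma vitali c N (P : X * nat -> Prop) : 1 <= c ->
  (forall b, P b -> window_ball N b) ->
  exists s : seq (X * nat), [/\ uniq s, trivIset [set` s] (scaled_ball c),
    {in s, forall b, P b} &
    forall b, P b -> exists2 b', b' \in s &
      (b'.2 <= b.2)%N /\ scaled_ball c b `&` scaled_ball c b' !=set0].
Proof.
move=> c1 PN; have c0 : 0 < c by exact: lt_le_trans c1.
pose good (s : seq (X * nat)) := [/\ uniq s, trivIset [set` s] (scaled_ball c) & {in s, forall b, P b}].
pose covers n (s : seq (X * nat)) := forall b, P b -> (b.2 < n)%N -> exists2 b', b' \in s &
      (b'.2 <= b.2)%N /\ scaled_ball c b `&` scaled_ball c b' !=set0.
suff [s [[us ts sP] sN _]] : exists s, [/\ good s, covers N.+1 s & {in s, forall b, (b.2 <= N.+1)%N}].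
  by exists s; split => // b Pb; apply: sN => //; have [] := PN _ Pb.
have [M sM] : exists M, forall s, good s -> (size s <= M)%N.
  exists (Num.bound (L ^+ (dil_exp kappa + dil_exp kappa + N))) => s [us ts sP].
  rewrite -(ler_nat R); apply: le_trans (size_disjoint_le (N := N) c1 us ts _) _.
    by move=> b /sP/PN.
  by rewrite ltW// archi_boundP// exprn_ge0// (le_trans ler01)// (doubling_ge1 hX x0).
(* the scales are processed in turn; within one scale, by induction on the room left *)
elim: N.+1 => [|n [s [gs cs sn]]].
  by exists [::]; split => //; split => //; exact: trivIset_set0.
have [k] := ubnP (M - size s); elim: k s gs cs sn => [//|k IH] s gs cs sn sk.
have [us ts sP] := gs.
have [h|] := pselect (forall b, P b -> b.2 = n -> exists2 b', b' \in s &
      scaled_ball c b `&` scaled_ball c b' !=set0).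
  exists s; split => // [b Pb|b /sn]; last exact: leqW.
  rewrite ltnS leq_eqVlt => /orP[/eqP bn|]; last exact: cs.
  by have [b' b's mt] := h b Pb bn; exists b' => //; rewrite bn sn.
move=> /existsNP[b /not_implyP[Pb /not_implyP[bn nob]]].
have nob' b' : b' \in s -> scaled_ball c b `&` scaled_ball c b' = set0.
  move=> b's; apply/eqP/negPn/negP => /set0P mt; apply: nob; by exists b'.
have gbs : good (b :: s).
  split.
  - rewrite /= us andbT; apply/negP => /nob'; rewrite setIid => bb.
    by have := scaled_ball_center b c0; rewrite bb.
  - move=> b1 b2 /=; rewrite !inE => /orP[/eqP->|b1s] /orP[/eqP->|b2s]//.
    + by rewrite nob'// => -[].
    + by rewrite setIC nob'// => -[].
    + exact: ts.
  - by move=> b'; rewrite inE => /orP[/eqP->//|/sP].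
apply: IH (gbs) _ _ _.
- move=> b' Pb' b'n; have [b2 b2s h] := cs b' Pb' b'n.
  by exists b2 => //; rewrite inE b2s orbT.
- by move=> b'; rewrite inE => /orP[/eqP->|/sn//]; rewrite bn.
- have := sM _ gbs; have := sk; rewrite /=; lia.
Qed.

End Vitali.

(** * Weak type bounds and sparse families *)

Section Covering.
Context {R : realType} {d : measure_display} {X : measurableType d}.
Variables (rho : X -> X -> R) (mu : {measure set X -> \bar R}) (kappa L : R).
Hypothesis hX : homogeneous_type rho mu kappa L.
Variables (x0 : X) (Rt : R).
Hypothesis Rt0 : 0 < Rt.

Local Notation radius := (dyadic_radius Rt).
Local Notation dball := (scaled_ball rho Rt).
Local Notation admissible_ball := (window_ball rho x0 Rt).
Local Notation mball := (ball_mass rho mu).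
Local Notation e := (dil_exp kappa).

Definition ball_union (c : R) (s : seq (X * nat)) : set X :=
  \big[setU/set0]_(b <- s) dball c b.

Lemma measurable_ball_union c s : measurable (ball_union c s).
Proof. by apply: bigsetU_measurable => b _; exact: (measurable_scaled_ball hX). Qed.

Lemma in_ball_union c s x :
  ball_union c s x <-> exists2 b, b \in s & dball c b x.
Proof. by rewrite /ball_union -bigcup_seq; split => -[b]; exists b. Qed.

Lemma mu_ball_union_le c s : 0 < c ->
  (mu (ball_union c s) <= (\sum_(b <- s) mball b.1 (c * radius b.2))%:E)%E.
Proof.
move=> c0; rewrite /ball_union; elim: s => [|b s IH].
  by rewrite !big_nil measure0.
rewrite !big_cons EFinD (le_trans (measureU2 _ _ _))//.
- exact: (measurable_scaled_ball hX).
- exact: measurable_ball_union.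
- rewrite leeD// -[leRHS](mballE hX)//.
  by rewrite mulr_gt0// radius_gt0.
Qed.

(** Dilating the balls selected by the covering lemma recovers the union. *)
Lemma disjoint_subfamily c N s : 1 <= c -> {in s, forall b, admissible_ball N b} ->
  exists s', [/\ uniq s', trivIset [set` s'] (dball c), {subset s' <= s} &
    (mu (ball_union c s) <=
       (L ^+ e * \sum_(b <- s') mball b.1 (c * radius b.2))%:E)%E].
Proof.
move=> c1 sN; have c0 : 0 < c by exact: lt_le_trans c1.
have [s' [us ts ss' cov]] := vitali hX Rt0 (P := fun b => b \in s) c1 sN.
exists s'; split => //.
apply: (@le_trans _ _ (mu (ball_union (dil kappa * c) s'))).
  apply: le_measure; rewrite ?inE; try exact: measurable_ball_union.
  move=> x /in_ball_union[b bs bx]; have [b' b's [kk [z [bz b'z]]]] := cov b bs.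
  apply/in_ball_union; exists b' => //; rewrite /scaled_ball -mulrA.
  apply: (engulf hX _ b'z bz) => //.
  by rewrite ler_wpM2l ?le_radius// ltW.
rewrite (le_trans (mu_ball_union_le _ _))// ?mulr_gt0 ?dil_gt0// lee_fin.
rewrite mulr_sumr; apply: ler_sum => b _.
by rewrite -mulrA (mball_pow2 hX)// mulr_gt0// radius_gt0.
Qed.

(** A disjoint subfamily that recovers a fraction of the union has total mass
    at most [nu V / T], since [nu] is superadditive. *)
Lemma weak_type nu V (T : R) c N s : superadditive nu -> 0 < T -> 1 <= c ->
  measurable V -> {in s, forall b, [/\ admissible_ball N b, dball c b `<=` V &
    T * mball b.1 (c * radius b.2) <= nu (dball c b)]} ->
  (mu (ball_union c s) <= (L ^+ e * (nu V / T))%:E)%E.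
Proof.
move=> snu T0 c1 mV sP; have sN : {in s, forall b, admissible_ball N b}.
  by move=> b /sP[].
have [s' [us ts ss' h]] := disjoint_subfamily c1 sN.
apply: (le_trans h); rewrite lee_fin ler_wpM2l//.
  by rewrite exprn_ge0// (le_trans ler01)// (doubling_ge1 hX x0).
rewrite ler_pdivlMr// mulr_suml.
apply: le_trans (sum_superadditive_le snu us ts (measurable_scaled_ball hX _ _) mV _).
  rewrite big_seq [leRHS]big_seq; apply: ler_sum => b /ss' /sP[_ _].
  by rewrite mulrC.
by move=> b /ss' /sP[].
Qed.

(** The levels will come from increasing thresholds.  Balls of different levels
    may overlap, but the halves left uncovered by the later levels do not. *)
Fixpoint sparse (nu : set X -> R) (ss : seq (seq (X * nat))) : Prop :=
  if ss is s :: ss' then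
    [/\ uniq s, trivIset [set` s] (dball 1),
        {in s, forall b, nu (dball 1 b) <=
          2 * nu (dball 1 b `\` ball_union 1 (flatten ss'))} &
        sparse nu ss']
  else True.

(** The uncovered halves of the balls of one level are disjoint from each other
    and from the balls of the later levels, so that the masses add up. *)
Lemma sparse_packing nu ss (p : pred (X * nat)) : superadditive nu ->
  sparse nu ss ->
  \sum_(b <- flatten ss | p b) nu (dball 1 b) <=
  2 * nu (ball_union 1 [seq b <- flatten ss | p b]).
Proof.
move=> snu; have [nu0 numono nuadd] := snu.
have mU := measurable_ball_union 1; have mB := measurable_scaled_ball hX Rt 1.
elim: ss => [_|s ss IH [us ts hs /IH{}IH]] /=; first by rewrite big_nil mulr_ge0.
rewrite big_cat/= filter_cat.
set Ur := ball_union 1 [seq b <- flatten ss | p b] in IH *.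
have mUr : measurable Ur by exact: mU.
set sp := [seq b <- s | p b].
have mUs : measurable (ball_union 1 sp) by exact: mU.
have h : \sum_(b <- s | p b) nu (dball 1 b) <= 2 * nu (ball_union 1 sp `\` Ur).
  rewrite -big_filter -/sp; apply: (@le_trans _ _
      (2 * \sum_(b <- sp) nu (dball 1 b `\` Ur))).
    rewrite mulr_sumr big_seq [leRHS]big_seq; apply: ler_sum => b.
    rewrite mem_filter => /andP[_ bs]; rewrite (le_trans (hs b bs))// ler_pM2l//.
    apply: numono; [exact: measurableD|exact: measurableD|].
    apply: setDS => x /in_ball_union[b']; rewrite mem_filter => /andP[_ b's] b'x.
    by apply/in_ball_union; exists b'.
  rewrite ler_pM2l//; apply: (sum_superadditive_le snu).
  - exact: filter_uniq.
  - move=> i j /=; rewrite !mem_filter => /andP[_ si] /andP[_ sj] [x [[xi _] [xj _]]].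
    by apply: ts => //; exists x.
  - by move=> b; exact: measurableD.
  - exact: measurableD.
  - move=> b bs x [bx nx]; split => //; apply/in_ball_union; exists b => //.
have -> : ball_union 1 (sp ++ [seq b <- flatten ss | p b]) = (ball_union 1 sp `\` Ur) `|` Ur.
  by rewrite setUDl setDv setD0 /ball_union big_cat.
apply: le_trans (lerD h IH) _; rewrite -mulrDr ler_pM2l//.
apply: nuadd; [exact: measurableD|exact: mU|].
by apply/disj_setPS => x [[_ nx] /nx].
Qed.

End Covering.

(** * The Carleson embedding *)

Definition carleson_const {R : realType} (kappa L s : R) : R :=
  2 `^ s * (4 * L ^+ dil_exp kappa ^+ 2) *
  ((1 - 2 `^ (- (s - 1)))^-1 * 2 `^ (s - 1)).

Lemma carleson_const_ge0 {R : realType} (kappa L s : R) : 0 <= L -> 1 < s ->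
  0 <= carleson_const kappa L s.
Proof.
move=> L0 s1; have x1 : 2 `^ (- (s - 1)) < 1 :> R.
  rewrite powRN invf_lt1 ?powR_gt0// -[ltLHS](pow1R (s - 1)).
  by rewrite gt0_ltr_powR ?nnegrE ?subr_gt0// ltr1n.
by rewrite !mulr_ge0 ?powR_ge0 ?exprn_ge0 ?invr_ge0 ?subr_ge0// ltW.
Qed.

Section Carleson.
Context {R : realType} {d : measure_display} {X : measurableType d}.
Variables (rho : X -> X -> R) (mu : {measure set X -> \bar R}) (kappa L : R).
Hypothesis hX : homogeneous_type rho mu kappa L.
Variables (x0 : X) (Rt : R).
Hypothesis Rt0 : 0 < Rt.

Local Notation radius := (dyadic_radius Rt).
Local Notation dball := (scaled_ball rho Rt).
Local Notation admissible_ball := (window_ball rho x0 Rt).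
Local Notation mball := (ball_mass rho mu).
Local Notation e := (dil_exp kappa).
Local Notation D := (dil kappa).

(** The letter [d] stands for the dilate: the balls of a level are disjoint,
    but the averages are taken over their dilates by [D]. *)
Definition dmass (b : X * nat) : R := mball b.1 (D * radius b.2).
Definition davg (G : X -> R) (b : X * nat) : R :=
  fine (\int[mu]_(x in dball D b) (G x)%:E)%E / dmass b.

Lemma dmass_gt0 b : 0 < dmass b.
Proof. by apply: (mball_gt0 hX); rewrite mulr_gt0 ?radius_gt0 ?dil_gt0. Qed.

Lemma mu_scaled_ball b : mu (dball D b) = (dmass b)%:E.
Proof. by rewrite /scaled_ball (mballE hX)// mulr_gt0 ?radius_gt0 ?dil_gt0. Qed.

Variables (W : set X) (ss : seq (seq (X * nat))) (N : nat).
Hypothesis mW : measurable W.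
Hypothesis Wy : (mu W < +oo)%E.
Hypothesis ssN : {in flatten ss, forall b, admissible_ball N b /\ dball D b `<=` W}.
Hypothesis sparse_ss : sparse rho Rt (mass mu (cst 1%E) W) ss.

Let dball1D b : dball 1 b `<=` dball D b.
Proof.
by apply: subset_qball; rewrite ler_wpM2r ?dil_ge1// ltW// radius_gt0.
Qed.

Let mD b : measurable (dball D b). Proof. exact: (measurable_scaled_ball hX). Qed.
Let m1 b : measurable (dball 1 b). Proof. exact: (measurable_scaled_ball hX). Qed.

Let sup1 : superadditive (mass mu (cst 1%E) W).
Proof. by apply: superadditive_mass => //; rewrite integral_cst// mul1e. Qed.

Let L1 : 1 <= L. Proof. exact: (doubling_ge1 hX x0). Qed.
Let L0 : 0 <= L. Proof. exact: le_trans L1. Qed.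

(** The packing condition in terms of the dilates. *)
Lemma dmass_packing (p : pred (X * nat)) :
  ((\sum_(b <- flatten ss | p b) dmass b)%:E <=
   (2 * L ^+ e)%:E * mu (ball_union rho Rt D [seq b <- flatten ss | p b]))%E.
Proof.
set U := ball_union _ _ _ _.
have mU1 s : measurable (ball_union rho Rt 1 s) by exact: (measurable_ball_union hX).
have mU : measurable U by exact: (measurable_ball_union hX).
have UW : U `<=` W.
  by move=> x /in_ball_union[b]; rewrite mem_filter => /andP[_ /ssN[_ bW]] /bW.
rewrite -(mass1E mW)// -EFinM lee_fin.
apply: (@le_trans _ _ (\sum_(b <- flatten ss | p b)
    L ^+ e * mass mu (cst 1%E) W (dball 1 b))).
  rewrite big_seq_cond [leRHS]big_seq_cond; apply: ler_sum => b /andP[bs _].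
  rewrite /dmass (le_trans (mball_pow2 hX _ _ _)) ?radius_gt0//.
  rewrite ler_wpM2l ?exprn_ge0// -lee_fin mass1E//.
    by rewrite /scaled_ball mul1r (mballE hX)// radius_gt0.
  by move=> x /dball1D; apply: (ssN bs).2.
rewrite -mulr_sumr [2 * _]mulrC -mulrA ler_wpM2l ?exprn_ge0//.
rewrite (le_trans (sparse_packing hX p sup1 sparse_ss))// ler_wpM2l//.
have [_ h _] := sup1; apply: h => // x /in_ball_union[b bs bx].
by apply/in_ball_union; exists b => //; exact: dball1D.
Qed.

Variable G : X -> R.
Hypothesis mG : measurable_fun [set: X] G.
Hypothesis G0 : forall x, 0 <= G x.
Hypothesis GW : (\int[mu]_(x in W) (G x)%:E < +oo)%E.

Let big (T : R) : set X := [set x | T < 2 * G x].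
Let mbig T : measurable (big T).
Proof.
rewrite -[X in measurable X]setTI; apply: measurable_fun_ltr => //.
exact: measurable_funM.
Qed.

Let GT T x := G x * \1_(big T) x.
Let GT0 T x : 0 <= GT T x.
Proof. by rewrite mulr_ge0. Qed.
Let mGT T : measurable_fun [set: X] (EFin \o GT T).
Proof.
apply/measurable_EFinP/measurable_funM => //; exact: measurable_indic.
Qed.
Let GTW T : (\int[mu]_(x in W) (GT T x)%:E < +oo)%E.
Proof.
apply: le_lt_trans GW; apply: ge0_le_integral => //.
- by move=> x _; rewrite lee_fin.
- exact: (measurable_funTS (@mGT T)).
- by apply/measurable_EFinP; exact: measurable_funTS.
- move=> x _; rewrite lee_fin /GT indicE.
  by case: (_ \in _); rewrite ?mulr1// mulr0.
Qed.

(** The points where [2 * G] is at most [T] contribute at most [T / 2] to an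
    average, so that the weak type inequality can be applied, with threshold
    [T / 2], to the restriction of [G] to the other points. *)
Lemma davg_level (T : R) : 0 < T ->
  ((\sum_(b <- flatten ss | T < davg G b) dmass b)%:E <=
   (4 * L ^+ e ^+ 2 / T)%:E * \int[mu]_(x in W) (GT T x)%:E)%E.
Proof.
move=> T0; apply: (le_trans (dmass_packing _)).
have wt : superadditive (mass mu (EFin \o GT T) W).
  by apply: superadditive_mass => //; [move=> x; rewrite lee_fin|exact: GTW].
have h := weak_type hX Rt0 (N := N) (nu := mass mu (EFin \o GT T) W)
  (V := W) (T := T / 2) (c := D) (s := [seq b <- flatten ss | T < davg G b]) wt.
apply: (@le_trans _ _ ((2 * L ^+ e)%:E *
   (L ^+ e * (mass mu (EFin \o GT T) W W / (T / 2)))%:E)%E).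
  rewrite lee_wpmul2l ?lee_fin ?mulr_ge0 ?exprn_ge0//.
  apply: h => //; [by rewrite divr_gt0|exact: dil_ge1|].
  move=> b; rewrite mem_filter => /andP[Tb bs]; split; try exact: (ssN bs).1.
    exact: (ssN bs).2.
  have bW := (ssN bs).2; have mb0 := dmass_gt0 b.
  move: Tb; rewrite ltr_pdivlMr// => Tb.
  have Gb : (\int[mu]_(x in dball D b) (G x)%:E = (mass mu (EFin \o G) W (dball D b))%:E)%E.
    rewrite -mass_fin//; last exact/measurable_EFinP.
    by rewrite (setIidl bW).
  move: Tb; rewrite Gb/= => Tb.
  have : mass mu (EFin \o G) W (dball D b) <=
      mass mu (EFin \o GT T) W (dball D b) + T / 2 * dmass b.
    rewrite -lee_fin -Gb EFinD -mass_fin//; last exact: GTW.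
    rewrite (setIidl bW) EFinM -mu_scaled_ball -integral_cst// -ge0_integralD//=.
    - apply: ge0_le_integral => //=.
      + by move=> x _; rewrite lee_fin.
      + by apply/measurable_EFinP; exact: measurable_funTS.
      + apply: emeasurable_funD => //.
        exact: (measurable_funTS (@mGT T)).
      + move=> x _; rewrite -EFinD lee_fin /GT indicE.
        have [|] := boolP (x \in big T); first by rewrite mulr1 lerDl divr_ge0// ltW.
        rewrite notin_setE /big/= => /negP; rewrite -leNgt => h2.
        by rewrite mulr0 add0r ler_pdivlMr// mulrC.
    - by move=> x _; rewrite lee_fin.
    - exact: (measurable_funTS (@mGT T)).
    - by move=> x _; rewrite lee_fin divr_ge0// ltW.
    by move=> x; rewrite lee_fin.
  move=> h2; rewrite -/(dmass b); lra.
rewrite -EFinM -[W in leRHS]setIid mass_fin//; last 2 first.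
- exact: mGT.
- by move=> x; rewrite lee_fin.
rewrite -EFinM lee_fin le_eqVlt; apply/orP; left; apply/eqP.
by field; rewrite gt_eqF.
Qed.

(** The [s]-th power of an average is comparable to the sum of the [s]-th powers
    of the dyadic thresholds below it.  For each threshold, [davg_level] bounds
    the mass of the balls above it; summing first over the thresholds below
    [2 * G x] gives a geometric series, which converges as [s > 1]. *)
Lemma carleson_fin (s : R) : 1 < s ->
  ((\sum_(b <- flatten ss) dmass b * davg G b `^ s)%:E <=
   (carleson_const kappa L s)%:E * \int[mu]_x (G x `^ s)%:E)%E.
Proof.
move=> s1; have s0 : 0 < s by exact: lt_trans s1.
have z0 b : 0 <= davg G b.
  rewrite divr_ge0//; last exact/ltW/dmass_gt0.
  by rewrite fine_ge0// integral_ge0// => x _; rewrite lee_fin.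
(* a scale below all the nonzero averages, and its multiple above all of them *)
have [th th0 thz] : exists2 th : R, 0 < th &
    {in flatten ss, forall b, 0 < davg G b -> th < davg G b}.
  elim: (flatten ss) => [|b l [th th0 h]]; first by exists 1.
  have [zb|zb] := ltP 0 (davg G b).
    exists (Num.min th (davg G b / 2)).
      by rewrite lt_min th0 divr_gt0.
    move=> b'; rewrite inE => /orP[/eqP->|/h h'] zb'.
      by rewrite gt_min ltr_pdivrMr// ltr_pMr// ltr1n orbT.
    by rewrite gt_min h'.
  exists th => // b'; rewrite inE => /orP[/eqP->|/h//].
  by rewrite ltNge zb.
have [M zM] : exists M, {in flatten ss, forall b, davg G b <= th * 2 ^+ M}.
  elim: (flatten ss) => [|b l [M h]]; first by exists 0%N.
  exists (maxn M (Num.bound (davg G b / th))) => b'; rewrite inE => /orP[/eqP->|/h h'].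
    rewrite mulrC -ler_pdivrMr//; apply: le_trans (_ : (Num.bound (davg G b / th))%:R <= _).
      by rewrite ltW// archi_boundP// divr_ge0// ltW.
    rewrite -natrX ler_nat (leq_trans (ltnW (ltn_expl _ (ltnSn 1))))//.
    by rewrite leq_exp2l// leq_maxr.
  by rewrite (le_trans h')// ler_pM2l// ler_weXn2l ?leq_maxl// ler1n.
have zS : {in flatten ss, forall b, davg G b `^ s <=
    2 `^ s * \sum_(n < M.+1 | th * 2 ^+ n < davg G b) (th * 2 ^+ n) `^ s}.
  move=> b bs; have [zb|zb] := ltP 0 (davg G b); last first.
    have -> : davg G b = 0 by apply/eqP; rewrite eq_le zb z0.
    by rewrite powR0 ?gt_eqF// mulr_ge0 ?powR_ge0// sumr_ge0// => n _; rewrite powR_ge0.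
  have ex : exists n, davg G b <= th * 2 ^+ n by exists M; exact: zM.
  have [nM lenM] : exists2 n, davg G b <= th * 2 ^+ n.+1 & th * 2 ^+ n < davg G b /\ (n <= M)%N.
    case: (ex_minnP ex) => -[|n] zn nmin.
      by move: zn; rewrite mulr1 leNgt thz.
    exists n => //; split; last by rewrite ltnW// nmin// zM.
    by rewrite ltNge; apply/negP => /nmin; rewrite ltnn.
  move=> [ltn nleM].
  rewrite (bigD1 (Ordinal (nleM : (nM < M.+1)%N)))//= mulrDr.
  apply: (@le_trans _ _ (2 `^ s * (th * 2 ^+ nM) `^ s)).
    rewrite -powRM ?mulr_ge0 ?exprn_ge0// ?(ltW th0)//.
    rewrite ge0_ler_powR ?nnegrE//; [exact: ltW| |by rewrite mulrCA -exprS].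
    by rewrite !mulr_ge0 ?exprn_ge0// ltW.
  by rewrite lerDl mulr_ge0 ?powR_ge0// sumr_ge0// => n _; rewrite powR_ge0.
have pn n : 0 < th * 2 ^+ n by rewrite mulr_gt0// exprn_gt0.
apply: (@le_trans _ _ ((\sum_(n < M.+1) 2 `^ s * ((th * 2 ^+ n) `^ s *
    \sum_(b <- flatten ss | (th * 2 ^+ n < davg G b)%R) dmass b))%:E)%E).
  rewrite lee_fin -mulr_sumr.
  under [X in _ <= 2 `^ s * X]eq_bigr do rewrite mulr_sumr big_mkcond.
  rewrite exchange_big/= mulr_sumr big_seq [leRHS]big_seq.
  apply: ler_sum => b bs.
  rewrite -big_mkcond/= -mulr_suml mulrA [leRHS]mulrC ler_pM2l ?dmass_gt0//.
  exact: zS.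
rewrite -sumEFin.
pose K := 2 `^ s * (4 * L ^+ e ^+ 2).
have K0 : 0 <= K by rewrite !mulr_ge0 ?powR_ge0// exprn_ge0// exprn_ge0.
apply: (@le_trans _ _ (\sum_(n < M.+1) (K * (th * 2 ^+ n) `^ (s - 1))%:E *
    \int[mu]_(x in W) (GT (th * 2 ^+ n) x)%:E)%E).
  apply: lee_sum => n _; have {}pn := pn n.
  rewrite mulrA EFinM (le_trans (lee_wpmul2l _ (davg_level pn)))//.
    by rewrite lee_fin mulr_ge0 ?powR_ge0.
  rewrite muleA -EFinM lee_wpmul2r ?lee_fin//.
    by apply: integral_ge0 => x _; rewrite lee_fin.
  rewrite /K powRB ?gt_eqF ?implybT// powRr1; last exact: ltW.
  rewrite le_eqVlt; apply/orP; left; apply/eqP; field.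
  by rewrite expf_neq0// gt_eqF.
apply: (@le_trans _ _ (\sum_(n < M.+1)
    \int[mu]_(x in W) ((K * (th * 2 ^+ n) `^ (s - 1)) * GT (th * 2 ^+ n) x)%:E)%E).
  apply: lee_sum => n _.
  under [X in (_ <= X)%E]eq_integral do rewrite EFinM.
  rewrite ge0_integralZl//.
  - exact: (measurable_funTS (@mGT _)).
  - by move=> x _; rewrite lee_fin.
  - by rewrite lee_fin mulr_ge0 ?powR_ge0.
have KG0 n x : 0 <= K * (th * 2 ^+ n) `^ (s - 1) * GT (th * 2 ^+ n) x.
  by rewrite mulr_ge0// mulr_ge0// powR_ge0.
have mK n : measurable_fun W (fun x : X => ((K * (th * 2 ^+ n) `^ (s - 1)) * GT (th * 2 ^+ n) x)%:E).
  apply/measurable_EFinP; apply: measurable_funM => //.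
  by apply/measurable_EFinP; exact: (measurable_funTS (@mGT _)).
rewrite -ge0_integral_sum//; last first.
  by move=> n x _; rewrite lee_fin KG0.
have mGs : measurable_fun [set: X] (fun x => (G x `^ s)%:E).
  by apply/measurable_EFinP; exact: (measurableT_comp (measurable_powR s)).

rewrite -ge0_integralZl//; last 2 first.
- by move=> x _; rewrite lee_fin powR_ge0.
- by rewrite lee_fin carleson_const_ge0.
apply: (@le_trans _ _ (\int[mu]_(x in W) ((carleson_const kappa L s)%:E * (G x `^ s)%:E))%E); last first.
  apply: ge0_subset_integral => //.
  - exact: measurable_funeM.
  - by move=> x _; rewrite -EFinM lee_fin mulr_ge0 ?powR_ge0// carleson_const_ge0.
apply: ge0_le_integral => //.
- by move=> x _; apply: sume_ge0 => n _; rewrite lee_fin KG0.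
- exact: emeasurable_sum.
- by apply: measurable_funeM; exact: measurable_funTS.
move=> x _; rewrite sumEFin -EFinM lee_fin.
have -> : \sum_(n < M.+1) K * (th * 2 ^+ n) `^ (s - 1) * GT (th * 2 ^+ n) x =
    K * G x * \sum_(n < M.+1 | th * 2 ^+ n < 2 * G x) (th * 2 ^+ n) `^ (s - 1).
  rewrite [in RHS]big_mkcond mulr_sumr; apply: eq_bigr => n _; rewrite /GT indicE.
  have [|] := boolP (x \in big _).
    by rewrite inE /big/= => ->; rewrite mulr1 mulrAC.
  by rewrite notin_setE /big/= => /negP/negbTE ->; rewrite !mulr0.
have sp : 0 < s - 1 by rewrite subr_gt0.
apply: (@le_trans _ _ (K * G x * ((1 - 2 `^ (- (s - 1)))^-1 * (2 * G x) `^ (s - 1)))).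
  apply: ler_wpM2l; first by rewrite mulr_ge0.
  by apply: dyadic_powR_sum_le => //; rewrite mulr_ge0.
rewrite /carleson_const -/K powRM// -(mulr_powRB1 (G0 x) s0).
by rewrite le_eqVlt; apply/orP; left; apply/eqP; ring.
Qed.

End Carleson.

Section CarlesonEmbedding.
Context {R : realType} {d : measure_display} {X : measurableType d}.
Variables (rho : X -> X -> R) (mu : {measure set X -> \bar R}) (kappa L : R).

(** If the right-hand side is finite, then [G] is integrable on the window, as
    [G <= 1 + G ^ s], and [carleson_fin] applies. *)
Lemma carleson (x0 : X) (Rt : R) (W : set X) (ss : seq (seq (X * nat))) (N : nat)
    (G : X -> R) (s : R) :
  homogeneous_type rho mu kappa L -> 0 < Rt -> measurable W -> (mu W < +oo)%E ->
  {in flatten ss, forall b, window_ball rho x0 Rt N b /\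
    scaled_ball rho Rt (dil kappa) b `<=` W} ->
  sparse rho Rt (mass mu (cst 1%E) W) ss ->
  measurable_fun [set: X] G -> (forall x, 0 <= G x) -> 1 < s ->
  ((\sum_(b <- flatten ss) dmass rho mu kappa Rt b * davg rho mu kappa Rt G b `^ s)%:E <=
   (carleson_const kappa L s)%:E * \int[mu]_x (G x `^ s)%:E)%E.
Proof.
move=> hX Rt0 mW Wy ssN sp mG G0 s1.
have L1 : 1 <= L := doubling_ge1 hX x0.
have mGs : measurable_fun [set: X] (fun x => (G x `^ s)%:E).
  by apply/measurable_EFinP; exact: (measurableT_comp (measurable_powR s)).
have [Gy|] := ltP (\int[mu]_x (G x `^ s)%:E)%E (+oo)%E; last first.
  rewrite leye_eq => /eqP ->; rewrite gt0_muley ?leey// lte_fin.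
  have x1 : 2 `^ (- (s - 1)) < 1 :> R.
    rewrite powRN invf_lt1 ?powR_gt0// -[ltLHS](pow1R (s - 1)).
    by rewrite gt0_ltr_powR ?nnegrE ?subr_gt0// ltr1n.
  have LL : 0 < L ^+ dil_exp kappa ^+ 2 by rewrite !exprn_gt0// (lt_le_trans ltr01).
  rewrite /carleson_const mulr_gt0//.
    by rewrite mulr_gt0 ?powR_gt0// mulr_gt0.
  by rewrite mulr_gt0 ?powR_gt0// invr_gt0 subr_gt0.
apply: (carleson_fin hX Rt0 mW Wy ssN sp) => //.
apply: (@le_lt_trans _ _ (mu W + \int[mu]_x (G x `^ s)%:E)%E); last first.
  exact: lte_add_pinfty.
apply: (@le_trans _ _ (\int[mu]_(x in W) (1 + (G x `^ s)%:E))%E).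
  apply: ge0_le_integral => //.
  - by move=> x _; rewrite lee_fin.
  - by apply/measurable_EFinP; exact: measurable_funTS.
  - by apply: emeasurable_funD => //; exact: measurable_funTS.
  - move=> x _; rewrite -EFinD lee_fin.
    have [G1|G1] := leP (G x) 1; first by rewrite (le_trans G1)// lerDl powR_ge0.
    by rewrite (le_trans (le1r_powR (ltW G1) (ltW s1)))// lerDr.
rewrite ge0_integralD//; last 2 first.
- by move=> x _; rewrite lee_fin powR_ge0.
- exact: measurable_funTS.
rewrite integral_cst// mul1e leeD2l// ge0_subset_integral// => x _.
by rewrite lee_fin powR_ge0.
Qed.

End CarlesonEmbedding.

(** * Sparse domination of a sum over scales *)

Section StoppingConstants.
Context {R : realType}.
Variables (m : nat) (kappa L : R).

(** [compar_const] compares products of averages over two balls of comparable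
    size, [weak_factor] makes the weak type estimate lose at most one half of
    each ball, and [level_ratio] is the ratio of two consecutive thresholds. *)
Definition compar_const : R := (L ^+ (dil_exp kappa + dil_exp kappa)) ^+ m.
Definition weak_factor : R := 2 * m%:R * L ^+ (dil_exp kappa + dil_exp kappa).
Definition level_ratio : R := compar_const ^+ 2 * weak_factor ^+ m.

Definition domination_const (Cd theta : R) : R :=
  level_ratio * (Cd / (1 - theta)) * Cd * (L ^+ dil_exp kappa) ^+ m.

End StoppingConstants.

Section SparseDomination.
Context {R : realType} {d : measure_display} {X : measurableType d}.
Variables (rho : X -> X -> R) (mu : {measure set X -> \bar R}) (kappa L : R).
Hypothesis hX : homogeneous_type rho mu kappa L.
Variables (x0 : X) (Rt : R).
Hypothesis Rt0 : 0 < Rt.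

Local Notation radius := (dyadic_radius Rt).
Local Notation dball := (scaled_ball rho Rt).
Local Notation admissible_ball := (window_ball rho x0 Rt).
Local Notation mball := (ball_mass rho mu).
Local Notation e := (dil_exp kappa).
Local Notation D := (dil kappa).
Local Notation window := (qball rho x0 (D * (D * Rt))).

Variables (m : nat) (nu : 'I_m -> set X -> R).
Hypothesis m0 : (0 < m)%N.
Hypothesis snu : forall i, superadditive (nu i).
Hypothesis nu_top : forall i A, measurable A -> nu i A <= nu i (dball D (x0, 0%N)).

Definition avg_prod (c : R) (b : X * nat) : R :=
  \prod_(i < m) (nu i (dball c b) / mball b.1 (c * radius b.2)).

Local Notation C1 := (compar_const m kappa L).
Local Notation T := (weak_factor m kappa L).
Local Notation q := (level_ratio m kappa L).
Local Notation top := (x0, 0%N).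

Let L1 : 1 <= L. Proof. exact: (doubling_ge1 hX x0). Qed.
Let L0 : 0 <= L. Proof. exact: le_trans L1. Qed.
Let C1_ge1 : 1 <= C1. Proof. by rewrite !exprn_ege1. Qed.
Let T_ge1 : 1 <= T.
Proof.
rewrite /weak_factor -[leLHS]mulr1 ler_pM ?exprn_ege1//.
by rewrite -natrM ler1n muln_gt0.
Qed.
Let q_ge1 : 1 <= q.
Proof. by rewrite /level_ratio -[leLHS]mulr1 ler_pM ?exprn_ege1. Qed.

Let mD c b : measurable (dball c b). Proof. exact: (measurable_scaled_ball hX). Qed.
Let nu0 i A : 0 <= nu i A. Proof. by have [] := snu i. Qed.

Let mb0 c b : 0 < c -> 0 < mball b.1 (c * radius b.2).
Proof. by move=> c0; apply: (mball_gt0 hX); rewrite mulr_gt0// radius_gt0. Qed.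
Let D0 : 0 < D. Proof. exact: dil_gt0. Qed.

Let avg_ge0 c b i : 0 < c -> 0 <= nu i (dball c b) / mball b.1 (c * radius b.2).
Proof. by move=> c0; rewrite divr_ge0//; exact/ltW/mb0. Qed.

Lemma avg_prod_ge0 c b : 0 < c -> 0 <= avg_prod c b.
Proof. by move=> c0; apply: prodr_ge0 => i _; exact: avg_ge0. Qed.

(** In the comparison of averages over two balls, each of the [m] denominators
    costs a factor [K], and the numerators nothing. *)
Lemma le_avg_prod (K c c' : R) b b' : 0 <= K -> 0 < c -> 0 < c' ->
  (forall i, nu i (dball c b) <= nu i (dball c' b')) ->
  mball b'.1 (c' * radius b'.2) <= K * mball b.1 (c * radius b.2) ->
  avg_prod c b <= K ^+ m * avg_prod c' b'.
Proof.
move=> K0 c0 c'0 nn mm; rewrite /avg_prod.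
have -> : K ^+ m = \prod_(i < m) K by rewrite prodr_const card_ord.
rewrite -big_split/=; apply: ler_prod => i _; rewrite avg_ge0//=.
rewrite ler_pdivrMr ?mb0//.
rewrite (le_trans (nn i))// [K * _]mulrC -mulrA.
by rewrite -[leLHS](divfK (lt0r_neq0 (mb0 b' c'0))) ler_wpM2l// avg_ge0.
Qed.

Let sub_top c b i : nu i (dball c b) <= nu i (dball D top).
Proof. exact: nu_top. Qed.

Lemma avg_prod_dilate b : avg_prod 1 b <= (L ^+ e) ^+ m * avg_prod D b.
Proof.
apply: le_avg_prod => //; first by rewrite exprn_ge0.
  move=> i; have [_ h _] := snu i; apply: h => //; apply: subset_qball.
  by rewrite ler_wpM2r ?dil_ge1// ltW// radius_gt0.
by rewrite mul1r; apply: (mball_pow2 hX); exact: radius_gt0.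
Qed.

Lemma avg_prod_top N b : admissible_ball N b ->
  avg_prod 1 b <= (L ^+ (e + e + b.2)) ^+ m * avg_prod D top.
Proof.
move=> [bx bN]; apply: le_avg_prod => //; first by rewrite exprn_ge0.
rewrite /= /dyadic_radius expr0 divr1 -{1}[Rt]mul1r.
exact: (window_mass_le hX Rt0 (c := 1) (N := b.2)).
Qed.

(** Balls of radius at least [Rt] see an average at most comparable to that of
    the top ball. *)
Lemma avg_prod_large N x k : admissible_ball N (x, k) -> Rt <= D * radius k ->
  avg_prod D (x, k) <= C1 * avg_prod D top.
Proof.
move=> [bx bN] Dk; apply: le_avg_prod => //=; first by rewrite exprn_ge0.
rewrite /dyadic_radius expr0 divr1.
apply: (@le_trans _ _ (L ^+ (e + e) * mball x Rt)).
  have := window_mass_le hX Rt0 (c := 1) (N := 0) (b := (x, 0%N)) (lexx 1).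
  by rewrite /dyadic_radius expr0 divr1 !mul1r addn0; apply; split.
rewrite ler_wpM2l ?exprn_ge0//.
apply: (le_mball hX) => //; last exact: subset_qball.
by rewrite mulr_gt0// radius_gt0.
Qed.

(** The thresholds start at the product of averages over the top ball: the
    products over the balls of scale up to [N] are at most a multiple of it,
    so that finitely many levels suffice. *)
Definition level (a : nat) : R := q ^+ a * avg_prod D top.

(** For [a > 0], the scale of [b] is the first one at which the product of
    averages at its centre exceeds the threshold.  The top ball alone forms
    level [0], so that points with small averages are covered too. *)
Definition stopping (N a : nat) (b : X * nat) : Prop :=
  if a is 0 then b = top else
  [/\ admissible_ball N b, level a < avg_prod 1 b &
      forall j, (j < b.2)%N -> avg_prod 1 (b.1, j) <= level a].

Lemma stopping_admissible N a b : stopping N a b -> admissible_ball N b.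
Proof.
case: a => [->|a []//]; split => //; exact: (qball_center hX).
Qed.

Lemma level_ge0 a : 0 <= level a.
Proof.
by rewrite mulr_ge0 ?avg_prod_ge0// exprn_ge0// (le_trans ler01).
Qed.

Lemma le_level a a' : (a <= a')%N -> level a <= level a'.
Proof. by move=> aa; rewrite ler_wpM2r ?avg_prod_ge0// ler_weXn2l. Qed.

Lemma levelS a : level a.+1 = q * level a.
Proof. by rewrite /level exprS mulrA. Qed.

(** At and above the stopping scale the averages do not exceed the threshold,
    up to a constant. *)
Lemma stopping_above N a b k : stopping N a b -> (k <= b.2)%N ->
  avg_prod D (b.1, k) <= C1 * level a.
Proof.
move=> sb kb; have [bx bN] := stopping_admissible sb.
have topl : avg_prod D top <= level a.
  by rewrite -[leLHS]mul1r -[1](expr0 q); exact: le_level.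
have C10 : 0 <= C1 by rewrite (le_trans ler01).
have [ek|ke] := leqP e k; last first.
  apply: (@le_trans _ _ (C1 * avg_prod D top)); last by rewrite ler_wpM2l.
  apply: (@avg_prod_large N) => //; first by split => //=; exact: leq_trans bN.
  rewrite -[leLHS](mulfVK (lt0r_neq0 D0)) mulrC ler_pM2l// mulrC.
  rewrite -[D^-1 * Rt]mulrC; exact: (le_radius Rt0 (ltnW ke)).
have e0 : (0 < e)%N by exact: dil_exp_gt0.
case: a sb {topl} => [sb|a [_ _ h]].
  by move: kb ek; rewrite sb/= leqn0 => /eqP->; rewrite leqNgt e0.
rewrite (le_trans _ (ler_peMl (level_ge0 _) C1_ge1))//.
rewrite (le_trans _ (h (k - e)%N _))//; last lia.
rewrite /avg_prod /scaled_ball /= mul1r.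
by rewrite -(radiusD Rt (k - e) e) subnK.
Qed.

(** A ball of a later level meeting [b] has a smaller radius: otherwise its
    average would be comparable to one which the choice of [b] keeps low. *)
Lemma stopping_meet N a a' b b' : stopping N a b -> (a < a')%N ->
  stopping N a' b' -> dball 1 b `&` dball 1 b' !=set0 -> (b.2 < b'.2)%N.
Proof.
move=> sb aa sb' [z [bz b'z]]; rewrite ltnNge; apply/negP => kk.
case: a' aa sb' => // a' aa [_ Fb' _].
move: Fb'; apply/negP; rewrite -leNgt.
have lz : qball rho b.1 (radius b'.2) z.
  by apply: subset_qball bz; rewrite mul1r le_radius.
rewrite /scaled_ball mul1r in b'z.
have h : avg_prod 1 b' <= C1 * avg_prod D (b.1, b'.2).
  apply: le_avg_prod => //=; first by rewrite exprn_ge0.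
    move=> i; have [_ h _] := snu i; apply: h => //.
    by rewrite /scaled_ball mul1r; apply: (engulf hX _ lz b'z).
  apply: (le_trans _ (mball_pow2 hX _ _ _)); last by rewrite mul1r radius_gt0.
  have r'0 := radius_gt0 Rt0 b'.2.
  apply: (le_mball hX); rewrite ?mulr_gt0 ?exprn_gt0//.
  rewrite exprD mul1r -mulrA; have rr : radius b'.2 <= D * radius b'.2.
    by rewrite ler_peMl ?dil_ge1// ltW.
  by apply: (engulf hX (z := z)) => //; apply: subset_qball rr _ _.
apply: (le_trans h); apply: (@le_trans _ _ (C1 * (C1 * level a))).
  by rewrite ler_wpM2l ?(le_trans ler01)// (@stopping_above N).
apply: (@le_trans _ _ (level a.+1)); last by apply: le_level; exact: aa.
rewrite levelS mulrA ler_wpM2r ?level_ge0// /level_ratio -expr2 ler_peMr ?exprn_ege1//.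
by rewrite exprn_ge0// (le_trans ler01).
Qed.

Let mW : measurable window. Proof. exact: (measurable_qball hX). Qed.
Let Wy : (mu window < +oo)%E.
Proof. by apply: (mu_qball_lty hX); rewrite !mulr_gt0. Qed.

Lemma mu_bigsetU_le (I : Type) (s : seq I) (F : I -> set X) :
  (forall i, measurable (F i)) ->
  (mu (\big[setU/set0]_(i <- s) F i) <= \sum_(i <- s) mu (F i))%E.
Proof.
move=> mF; elim: s => [|i s IH]; first by rewrite !big_nil measure0.
rewrite !big_cons (le_trans (measureU2 _ _ _))//; first exact: bigsetU_measurable.
by rewrite leeD.
Qed.

(** The balls of the later levels occupy at most half of [b]: they are contained
    in the dilate of [b] and, for one of the [m] functionals, their average
    exceeds [weak_factor] times that of the dilate. *)
Lemma stopping_half N a b l : stopping N a b ->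
  {in l, forall b', exists2 a', (a < a')%N & stopping N a' b'} ->
  mass mu (cst 1%E) window (dball 1 b) <=
  2 * mass mu (cst 1%E) window (dball 1 b `\` ball_union rho Rt 1 l).
Proof.
move=> sb lP; set U := ball_union _ _ _ _.
have mU s : measurable (ball_union rho Rt 1 s) by exact: (measurable_ball_union hX).
have mUl : measurable U by exact: mU.
have bN := stopping_admissible sb.
have DW : dball D b `<=` window by apply: (scaled_ball_sub_window hX Rt0 _ bN); exact: dil_ge1.
have BD : dball 1 b `<=` dball D b.
  by apply: subset_qball; rewrite ler_wpM2r ?dil_ge1// ltW// radius_gt0.
have BW : dball 1 b `<=` window by apply: subset_trans DW.
pose meets := [seq b' <- l | `[< dball 1 b `&` dball 1 b' !=set0 >]].
pose si i := [seq b' <- meets |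
  T * (nu i (dball D b) / mball b.1 (D * radius b.2)) <
  nu i (dball 1 b') / mball b'.1 (1 * radius b'.2)].
have sub b' : b' \in meets -> dball 1 b' `<=` dball D b.
  rewrite mem_filter => /andP[/asboolP meet /lP[a' aa sb']].
  have kk := stopping_meet sb aa sb' meet.
  move: meet; rewrite /scaled_ball !mul1r => -[z [bz b'z]].
  by apply: (engulf hX _ bz b'z); exact: le_radius (ltnW kk).
have mbD := mb0 b D0.
have UI : dball 1 b `&` U `<=` \big[setU/set0]_(i < m) ball_union rho Rt 1 (si i).
  move=> x [bx /in_ball_union[b' b'l b'x]].
  have b'm : b' \in meets.
    by rewrite mem_filter b'l andbT; apply/asboolP; exists x.
  have [i isi] : exists i, b' \in si i.
    apply/not_existsP => none.
    have [[|a'] // aa [_ + _]] := lP _ b'l; apply/negP; rewrite -leNgt.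
    apply: (@le_trans _ _ (T ^+ m * avg_prod D b)).
      have -> : T ^+ m = \prod_(i < m) T by rewrite prodr_const card_ord.
      rewrite -big_split/=; apply: ler_prod => i _; rewrite avg_ge0//=.
      rewrite leNgt; apply/negP => h; apply: (none i).
      by rewrite mem_filter h.
    have Tm : 0 <= T ^+ m by rewrite exprn_ge0// (le_trans ler01).
    apply: (@le_trans _ _ (T ^+ m * (C1 * level a))).
      rewrite ler_wpM2l//; case: (b) sb => y k sb; exact: (stopping_above sb).
    apply: (@le_trans _ _ (level a.+1)); last by apply: le_level; exact: aa.
    rewrite levelS mulrA ler_wpM2r ?level_ge0// mulrC /level_ratio.
    by rewrite ler_wpM2r// expr2 ler_peMl// (le_trans ler01).
  rewrite -bigcup_seq; exists i; first by rewrite /= mem_index_enum.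
  by apply/in_ball_union; exists b'.
have sm i : (mu (ball_union rho Rt 1 (si i)) <=
    (L ^+ e * (mball b.1 (D * radius b.2) / T))%:E)%E.
  have [nu00|nun0] := eqVneq (nu i (dball D b)) 0.
    have -> : si i = [::].
      apply/eqP; rewrite -[_ == _]negbK -has_filter; apply/hasPn => b' b'm.
      rewrite nu00 mul0r mulr0 -leNgt; have [_ h _] := snu i.
      have : nu i (dball 1 b') <= 0 by rewrite -nu00; apply: h => //; exact: sub.
      rewrite le_eqVlt ltNge nu0 orbF => /eqP ->; by rewrite mul0r.
    rewrite /ball_union big_nil measure0 lee_fin mulr_ge0 ?exprn_ge0//.
    by apply: divr_ge0; [exact: ltW|exact: le_trans ler01 T_ge1].
  have nup : 0 < nu i (dball D b) by rewrite lt_neqAle eq_sym nun0 nu0.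
  have T0 : 0 < T by rewrite (lt_le_trans ltr01).
  have := weak_type hX Rt0 (N := N) (nu := nu i) (V := dball D b)
    (T := T * (nu i (dball D b) / mball b.1 (D * radius b.2)))
    (c := 1) (s := si i) (snu i).
  move=> /(_ x0 _ (lexx 1) (mD D b)); rewrite mulr_gt0 ?divr_gt0// => /(_ isT).
  have -> : nu i (dball D b) / (T * (nu i (dball D b) / mball b.1 (D * radius b.2))) =
     mball b.1 (D * radius b.2) / T by field; rewrite !gt_eqF.
  apply => b'; rewrite mem_filter => /andP[h b'm]; split.
  - move: b'm; rewrite mem_filter => /andP[_ /lP[a' _]]; exact: stopping_admissible.
  - exact: sub.
  - by rewrite -ler_pdivlMr ?mb0// ltW.
have h : mass mu (cst 1%E) window (dball 1 b `&` U) <=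
    2^-1 * mass mu (cst 1%E) window (dball 1 b).
  rewrite -lee_fin EFinM !mass1E//; last 2 first.
  - by apply: measurableI.
  - by apply: subset_trans BW; exact: subIsetl.
  apply: (@le_trans _ _ (mu (\big[setU/set0]_(i < m) ball_union rho Rt 1 (si i)))).
    apply: le_measure => //; rewrite inE; first exact: measurableI.
    by apply: bigsetU_measurable.
  rewrite (le_trans (mu_bigsetU_le _ _))//.
  apply: (@le_trans _ _ (\sum_(i < m) (L ^+ e * (mball b.1 (D * radius b.2) / T))%:E)%E).
    exact: lee_sum.
  rewrite sumEFin {1}/scaled_ball mul1r (mballE hX) ?radius_gt0// -EFinM lee_fin.
  rewrite sumr_const card_ord -[leLHS]mulr_natl.
  have := mball_pow2 hX e b.1 (radius_gt0 Rt0 b.2).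
  move=> h; rewrite mulrA -mulrA [_ / T]mulrC mulrA mulrA.
  apply: (le_trans (ler_wpM2l _ h)).
    by rewrite !mulr_ge0 ?exprn_ge0 ?invr_ge0// (le_trans ler01).
  rewrite mulrA; apply: ler_wpM2r; first exact/ltW/(mball_gt0 hX)/radius_gt0.
  have Ln0 : L != 0 by rewrite gt_eqF// (lt_le_trans ltr01).
  rewrite le_eqVlt; apply/orP; left; apply/eqP; rewrite /weak_factor exprD.
  by field; rewrite expf_neq0// pnatr_eq0 -lt0n m0.
have : mass mu (cst 1%E) window (dball 1 b) =
    mass mu (cst 1%E) window (dball 1 b `\` U) + mass mu (cst 1%E) window (dball 1 b `&` U).
  apply: EFin_inj; rewrite EFinD !mass1E//; last 4 first.
  - exact: measurableI.
  - by apply: subset_trans BW; exact: subIsetl.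
  - exact: measurableD.
  - by apply: subset_trans BW; exact: subDsetl.
  by rewrite (measureDI _ (mD 1 b) (mU l)).
lra.
Qed.

Lemma level_ratio_ge2 : 2 <= q.
Proof.
apply: (@le_trans _ _ (T ^+ m)); last first.
  by rewrite /level_ratio ler_peMl ?exprn_ege1// exprn_ge0// (le_trans ler01).
apply: (@le_trans _ _ T).
  rewrite /weak_factor -mulrA ler_peMr// -[leLHS]mulr1.
  by rewrite ler_pM ?exprn_ege1// ler1n.
by rewrite -[leLHS]expr1 ler_weXn2l.
Qed.

Lemma sparse_levels N (sg : nat -> seq (X * nat)) a n :
  (forall a, [/\ uniq (sg a), trivIset [set` sg a] (dball 1) &
    {in sg a, forall b, stopping N a b}]) ->
  sparse rho Rt (mass mu (cst 1%E) window) [seq sg a' | a' <- iota a n].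
Proof.
move=> sgP; elim: n a => [//|n IH] a /=; have [us ts sP] := sgP a.
split => // b /sP sb; apply: (stopping_half sb) => b' /flattenP[_ /mapP[a' + ->]].
rewrite mem_iota => /andP[aa' _] b's; exists a' => //.
by have [_ _] := sgP a'; apply.
Qed.

Variables (lam : X -> R -> R) (Cd theta : R).
Hypothesis lam0 : forall x r, 0 <= lam x r.
Hypothesis Cd0 : 0 <= Cd.
Hypothesis theta0 : 0 <= theta.
Hypothesis theta1 : theta < 1.
Hypothesis lam_mono : forall x' r' x r, 0 < r' -> r' <= r ->
  qball rho x' r' `<=` qball rho x r -> lam x' r' <= Cd * lam x r.
Hypothesis lam_decay : forall x k j,
  lam x (radius (k + j)) <= Cd * theta ^+ j * lam x (radius k).

(** Along the scales at which the average exceeds a threshold, [lam] decays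
    geometrically, so that only the largest such scale matters; the covering
    lemma replaces the ball of that scale by a selected one. *)
Lemma sparse_domination N :
  exists ss : seq (seq (X * nat)),
  [/\ sparse rho Rt (mass mu (cst 1%E) window) ss,
      {in flatten ss, forall b, admissible_ball N b /\ dball D b `<=` window} &
      forall x, qball rho x0 Rt x ->
        \sum_(k < N.+1) lam x (radius k) * avg_prod 1 (x, k : nat) <=
        domination_const m kappa L Cd theta *
        \sum_(b <- flatten ss)
          lam b.1 (D * radius b.2) * avg_prod D b * \1_(dball D b) x].
Proof.
have admb x k : qball rho x0 Rt x -> (k < N.+1)%N -> admissible_ball N (x, k).
  by move=> xx kN; split.
have [t0|tn0] := eqVneq (avg_prod D top) 0.
  exists [::]; split => // x xx; rewrite big_nil mulr0 big1// => k _.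
  have := avg_prod_top (admb x k xx (ltn_ord k)).
  by rewrite t0 mulr0 le_eqVlt ltNge avg_prod_ge0// orbF => /eqP ->; rewrite mulr0.
have tp : 0 < avg_prod D top by rewrite lt_neqAle eq_sym tn0 avg_prod_ge0.
have /choice[sg sgP] : forall a, exists s : seq (X * nat), [/\ uniq s,
    trivIset [set` s] (dball 1), {in s, forall b, stopping N a b} &
    forall b, stopping N a b -> exists2 b', b' \in s &
      (b'.2 <= b.2)%N /\ dball 1 b `&` dball 1 b' !=set0].
  move=> a; apply: (vitali hX Rt0 (x0 := x0) (N := N)) => //.
  by move=> b; exact: stopping_admissible.
pose A := Num.bound ((L ^+ (e + e + N)) ^+ m).
have FA x k : qball rho x0 Rt x -> (k < N.+1)%N -> avg_prod 1 (x, k) <= level A.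
  move=> xx kN; have /avg_prod_top/le_trans := admb x k xx kN; apply.
  rewrite /level ler_wpM2r//; first exact: ltW.
  apply: (@le_trans _ _ ((L ^+ (e + e + N)) ^+ m)).
    by rewrite lerXn2r ?nnegrE ?exprn_ge0//= ler_weXn2l// leq_add2l.
  rewrite (le_trans (ltW (archi_boundP _)))// ?exprn_ge0 ?exprn_ge0//.
  rewrite -/A (@le_trans _ _ (2 ^+ A))//; first by rewrite -natrX ler_nat ltnW// ltn_expl.
  apply: lerXn2r; rewrite ?nnegrE ?ler0n ?(le_trans ler01 q_ge1)//.
  exact: level_ratio_ge2.
exists [seq sg a | a <- iota 0 A.+1]; split.
- by apply: (sparse_levels (N := N)) => a; have [] := sgP a.
- move=> b /flattenP[_ /mapP[a _ ->]] bs; have [_ _ sP _] := sgP a.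
  have bN := stopping_admissible (sP _ bs); split => //.
  by apply: (scaled_ball_sub_window hX Rt0 _ bN); exact: dil_ge1.
move=> x xx.
(* the scales [k] at which the product of averages at [x] exceeds the threshold, or all of them at level [0] *)
pose act a k := (a == 0%N) || (level a < avg_prod 1 (x, k)).
(* the largest threshold exceeded is comparable to the product of averages *)
have Fk k : (k < N.+1)%N ->
    avg_prod 1 (x, k) <= q * \sum_(a < A.+1 | act a k) level a.
  move=> kN; have ex : exists n, avg_prod 1 (x, k) <= level n by exists A; exact: FA.
  have [a [aA ak aq]] : exists a, [/\ (a < A.+1)%N, act a k & avg_prod 1 (x, k) <= q * level a].
    case: (ex_minnP ex) => -[|n] hn nmin.
      by exists 0%N; split => //; rewrite (le_trans hn)// ler_peMl// level_ge0.
    exists n; split; rewrite -?levelS//; first by rewrite (leq_trans (nmin A (FA _ _ xx kN))).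
    by rewrite /act ltNge; apply/orP; right; apply/negP => /nmin; rewrite ltnn.
  rewrite (le_trans aq)// ler_wpM2l ?(le_trans ler01)//.
  by rewrite (bigD1 (Ordinal aA))//= lerDl sumr_ge0// => i _; exact: level_ge0.
apply: (@le_trans _ _ (q * \sum_(a < A.+1) level a *
    \sum_(k < N.+1 | act a k) lam x (radius k))).
  under [X in _ <= q * X]eq_bigr do rewrite mulr_sumr big_mkcond.
  rewrite exchange_big/= mulr_sumr; apply: ler_sum => k _.
  rewrite -big_mkcond/= -mulr_suml mulrA [leRHS]mulrC ler_wpM2l//.
  exact: Fk.
have -> : domination_const m kappa L Cd theta =
    q * (Cd / (1 - theta) * Cd * (L ^+ e) ^+ m) by rewrite /domination_const; ring.
rewrite -[leRHS]mulrA; apply: ler_wpM2l; first exact: le_trans ler01 q_ge1.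
have i1 : 0 <= (1 - theta)^-1 by rewrite invr_ge0 subr_ge0 ltW.
pose S a := \sum_(b <- sg a) lam b.1 (D * radius b.2) * avg_prod D b * \1_(dball D b) x.
have S0 b : 0 <= lam b.1 (D * radius b.2) * avg_prod D b * \1_(dball D b) x.
  by rewrite !mulr_ge0 ?avg_prod_ge0.
have -> : \sum_(b <- flatten [seq sg a | a <- iota 0 A.+1])
    lam b.1 (D * radius b.2) * avg_prod D b * \1_(dball D b) x = \sum_(a < A.+1) S a.
  by rewrite big_flatten big_map -[iota 0 _]/(index_iota 0 A.+1) big_mkord.
rewrite [leRHS]mulr_sumr; apply: ler_sum => a _.
have [none|] := pselect (forall k : 'I_N.+1, ~~ act a k).
  rewrite big1 => [|k]; last by rewrite (negbTE (none k)).
  rewrite mulr0 !mulr_ge0 ?exprn_ge0 ?exprn_ge0//.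
  exact: sumr_ge0.
move=> /existsNP[k1 /negP]; rewrite negbK => ak1.
have ex : exists k, act a k by exists k1.
case: (ex_minnP ex) => k ak kmin.
have kN : (k < N.+1)%N by rewrite (leq_ltn_trans (kmin _ ak1)).
(* [k] being the first active scale, [(x, k)] is a stopping ball if [a > 0], and meets a selected one *)
have [b [bs xb lamk lb]] : exists b, [/\ b \in sg a, dball D b x,
    lam x (radius k) <= Cd * lam b.1 (D * radius b.2) &
    level a <= (L ^+ e) ^+ m * avg_prod D b].
  have [us ts sP cov] := sgP a.
  move: ak; rewrite /act; case: (nat_of_ord a) us ts sP cov kmin => [|a'] us ts sP cov kmin.
    move=> _; have [b bs _] := cov top erefl.
    have bt : b = top by exact: sP.
    have k0 : k = 0%N by apply/eqP; rewrite -leqn0; exact: kmin.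
    have xD : qball rho x0 (D * Rt) x.
      by apply: subset_qball xx; rewrite ler_peMl ?dil_ge1// ltW.
    exists b; rewrite bs bt k0 /scaled_ball/= /dyadic_radius expr0 divr1; split => //.
      apply: lam_mono => //; first by rewrite ler_peMl ?dil_ge1// ltW.
      apply: (engulf hX _ xx) => //; exact: (qball_center hX).
    by rewrite /level expr0 mul1r ler_peMl ?avg_prod_ge0// !exprn_ege1.
  move=> /= ak; have sxk : stopping N a'.+1 (x, k).
    split => // j jk.
    by rewrite leNgt; apply/negP => h; have := kmin j h; rewrite /= leqNgt jk.
  have [b bs [bk [z [xz bz]]]] := cov _ sxk.
  rewrite /scaled_ball !mul1r /= in xz bz.
  have kb : radius k <= radius b.2 by exact: le_radius.
  have subk : qball rho x (radius k) `<=` qball rho b.1 (D * radius b.2).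
    exact: (engulf hX kb bz xz).
  exists b; split => //.
  - by apply: subk; apply: (qball_center hX); exact: radius_gt0.
  - apply: lam_mono => //; first exact: radius_gt0.
    by rewrite (le_trans kb)// ler_peMl ?dil_ge1// ltW// radius_gt0.
  - have [_ lb _] := sP _ bs.
    by rewrite (le_trans (ltW lb))// avg_prod_dilate.
have sumk : \sum_(k' < N.+1 | act a k') lam x (radius k') <=
    Cd / (1 - theta) * lam x (radius k).
  apply: (@le_trans _ _ (\sum_(k' < N.+1 | (k <= k')%N) Cd * theta ^+ (k' - k) * lam x (radius k))).
    rewrite big_mkcond [leRHS]big_mkcond; apply: ler_sum => k' _; case: ifPn => [ak'|_].
      have kk' := kmin _ ak'; rewrite kk' -{1}(subnKC kk'); exact: lam_decay.
    by case: ifP => // _; rewrite !mulr_ge0// exprn_ge0.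
  rewrite -mulr_suml -mulr_sumr ler_wpM2r// ler_wpM2l//.
  exact: geometric_tail_le.
apply: (le_trans (ler_pM (level_ge0 a) _ lb sumk)); first by apply: sumr_ge0.
apply: (@le_trans _ _ (Cd / (1 - theta) * Cd * (L ^+ e) ^+ m *
   (lam b.1 (D * radius b.2) * avg_prod D b * \1_(dball D b) x))).
  rewrite indicE mem_set// mulr1.
  apply: (@le_trans _ _ ((L ^+ e) ^+ m * avg_prod D b *
    (Cd / (1 - theta) * (Cd * lam b.1 (D * radius b.2))))).
    apply: ler_wpM2l; first by rewrite mulr_ge0 ?exprn_ge0 ?exprn_ge0 ?avg_prod_ge0.
    by apply: ler_wpM2l => //; rewrite mulr_ge0.
  by rewrite le_eqVlt; apply/orP; left; apply/eqP; ring.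
apply: ler_wpM2l; first by rewrite !mulr_ge0 ?exprn_ge0 ?exprn_ge0.
by rewrite /S (big_rem b)//= lerDl sumr_ge0.
Qed.

End SparseDomination.

(** * The kernel and the functional phi *)

(** Two points of [X^m] in a ball of radius [r] are at distance at most
    [2 * kappa * m%:R * r], and the pairs met in [kernel_compar] are separated
    by [a / (2 * kappa) * r]; the growth condition is used for the quotient,
    plus [1] to exceed [1], up to three times in a row: hence the cube. *)
Definition growth_dilation {R : realType} (m : nat) (kappa a : R) : R :=
  2 * kappa * m%:R / (a / (2 * kappa)) + 1.
Definition kernel_const {R : realType} (m : nat) (kappa : R) (Cg : R -> R) (a : R) : R :=
  Cg (growth_dilation m kappa a) ^+ 3.

Section Kernel.
Context {R : realType} {d : measure_display} {X : measurableType d}.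
Variables (rho : X -> X -> R) (mu : {measure set X -> \bar R}) (kappa L : R).
Hypothesis hX : homogeneous_type rho mu kappa L.
Variables (m : nat) (Kt : m.-tuple X -> m.-tuple X -> R) (Cg : R -> R).
Hypothesis m0 : (0 < m)%N.
Hypothesis pK : potential_kernel rho Kt Cg.

Let k1 : 1 <= kappa. Proof. exact: (kappa_ge1 hX). Qed.
Let k0 : 0 < kappa. Proof. exact: lt_le_trans k1. Qed.

Lemma rho_vec_triangle (z x y : m.-tuple X) :
  rho_vec rho x y <= kappa * (rho_vec rho x z + rho_vec rho z y).
Proof.
rewrite /rho_vec -big_split/= mulr_sumr; apply: ler_sum => i _.
exact: (rho_triangle hX).
Qed.

Lemma rho_vec_sym (x y : m.-tuple X) : rho_vec rho x y = rho_vec rho y x.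
Proof. by apply: eq_bigr => i _; exact: (rho_sym hX). Qed.

Lemma rho_vec_neq (x y : m.-tuple X) : 0 < rho_vec rho x y -> x <> y.
Proof.
move=> + xy; rewrite xy /rho_vec big1 ?ltxx// => i _; exact: (rhoxx hX).
Qed.

Definition in_ball (x0 : X) (r : R) (y : m.-tuple X) : Prop :=
  forall i, qball rho x0 r (tnth y i).

Lemma rho_vec_in_ball x0 r y z : in_ball x0 r y -> in_ball x0 r z ->
  rho_vec rho y z <= 2 * kappa * m%:R * r.
Proof.
move=> yb zb; apply: (@le_trans _ _ (\sum_(i < m) (2 * kappa * r))).
  apply: ler_sum => i _; rewrite (le_trans (rho_triangle hX x0 _ _))//.
  rewrite [2 * _]mulrC -mulrA ler_wpM2l ?(ltW k0)//.
  have := yb i; have := zb i; rewrite /qball/= (rho_sym hX x0 (tnth y i)); lra.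
by rewrite sumr_const card_ord -mulr_natl; lra.
Qed.

(** On a ball, the kernel is essentially constant at pairs of points which are
    separated at the scale of the ball.  The growth condition moves [(x, y)] to
    [(y, z)] when the latter pair is separated; two or three such moves lead
    from [(x, y)] to [(z, w)], through [y] or through [y] and [w], according to
    which of [z] and [w] is far from [y]. *)
Lemma kernel_compar a x0 r x y z w : 0 < a -> 0 < r ->
  in_ball x0 r x -> in_ball x0 r y -> in_ball x0 r z -> in_ball x0 r w ->
  a * r <= rho_vec rho x y -> a * r <= rho_vec rho z w ->
  Kt x y <= kernel_const m kappa Cg a * Kt z w.
Proof.
move=> a0 r0 xb yb zb wb xy zw.
set c := growth_dilation m kappa a.
have a'0 : 0 < a / (2 * kappa) by rewrite divr_gt0// mulr_gt0.
have m0R : 0 < m%:R :> R by rewrite ltr0n.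
have c1 : 1 < c by rewrite ltrDr divr_gt0// !mulr_gt0.
have [Cg1 _ g] := pk_growth pK c1.
have a'r0 : 0 < a / (2 * kappa) * r by rewrite mulr_gt0.
have aa' : a / (2 * kappa) * r <= a * r.
  by rewrite ler_wpM2r ?(ltW r0)// ler_pdivrMr ?mulr_gt0// ler_peMr ?(ltW a0)//; have := k1; lra.
have step s1 s2 s3 : in_ball x0 r s2 -> in_ball x0 r s3 ->
    a / (2 * kappa) * r <= rho_vec rho s1 s2 ->
    a / (2 * kappa) * r <= rho_vec rho s2 s3 -> Kt s1 s2 <= Cg c * Kt s2 s3.
  move=> s2b s3b h12 h23; apply: g.
  - by apply: rho_vec_neq; exact: lt_le_trans h12.
  - by apply: rho_vec_neq; exact: lt_le_trans h23.
  - rewrite (le_trans (rho_vec_in_ball s2b s3b))//.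
    have c0 : 0 <= c by rewrite ltW// (lt_trans _ c1).
    apply: (le_trans _ (ler_wpM2l c0 h12)).
    rewrite mulrA ler_wpM2r ?(ltW r0)//.
    have -> : c * (a / (2 * kappa)) = 2 * kappa * m%:R + a / (2 * kappa).
      by rewrite /c /growth_dilation; field; rewrite !gt_eqF.
    by rewrite lerDl ltW.
have Cg0 : 0 <= Cg c by rewrite ltW// (lt_trans _ Cg1).
have K0 := pk_ge0 pK.
have xy' := le_trans aa' xy; have zw' := le_trans aa' zw.
rewrite /kernel_const -/c.
have [yz|yz] := leP (a / (2 * kappa) * r) (rho_vec rho y z).
  apply: (le_trans (step _ _ _ yb zb xy' yz)).
  apply: (le_trans (ler_wpM2l Cg0 (step _ _ _ zb wb yz zw'))).
  rewrite mulrA ler_wpM2r// !exprS expr0 mulr1 mulrA ler_peMr ?mulr_ge0//.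
  exact: ltW.
have yw : a / (2 * kappa) * r <= rho_vec rho y w.
  have := le_trans zw (rho_vec_triangle y z w).
  rewrite -ler_pdivrMl// rho_vec_sym => h.
  have : kappa^-1 * (a * r) = a / (2 * kappa) * r + a / (2 * kappa) * r.
    by field; rewrite gt_eqF.
  lra.
have wz : a / (2 * kappa) * r <= rho_vec rho w z by rewrite rho_vec_sym.
apply: (le_trans (step _ _ _ yb wb xy' yw)).
rewrite exprSr expr2 -!mulrA ler_wpM2l//.
apply: (le_trans (step _ _ _ wb zb yw wz)); rewrite ler_wpM2l//.
exact: step.
Qed.

Lemma kernel_const_ge0 a : 0 < a -> 0 <= kernel_const m kappa Cg a.
Proof.
move=> a0; have c1 : 1 < growth_dilation m kappa a.
  rewrite ltrDr; apply: divr_gt0; first by rewrite !mulr_gt0 ?ltr0n.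
  by rewrite divr_gt0 // mulr_gt0.
by have [h _ _] := pk_growth pK c1; rewrite exprn_ge0// ltW// (lt_trans _ h).
Qed.

Lemma rho_ptE x (y : m.-tuple X) : rho_pt rho x y = rho_vec rho (nseq_tuple m x) y.
Proof.
apply: eq_bigr => i _; congr rho; rewrite (tnth_nth x)/= nth_nseq.
by rewrite ltn_ord.
Qed.

Lemma in_ball_nseq x0 r x : qball rho x0 r x -> in_ball x0 r (nseq_tuple m x).
Proof. by move=> xb i; rewrite (tnth_nth x)/= nth_nseq ltn_ord. Qed.

Lemma le_rho_pt x (y : m.-tuple X) i : rho x (tnth y i) <= rho_pt rho x y.
Proof.
rewrite /rho_pt (bigD1 i)//= lerDl sumr_ge0// => j _; exact: (rho_ge0 hX).
Qed.

Section Phi.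
Variables (c delta c0 : R -> R) (eta : R).
Hypothesis rd : reverse_doubling rho mu c delta.
Hypothesis adm : admissible c delta c0.
Hypothesis eta1 : 1 < eta.

(** As [c0 eta ^ delta < c], reverse doubling makes the mass of the ball of
    radius [c0 eta * r] smaller than that of the ball of radius [r]; a point in
    between gives an admissible pair. *)
Lemma phi_support x r : 0 < r -> (r%:E <= eta%:E * diam rho)%E ->
  exists z w, [/\ qball rho x r z, in_ball x r w & c0 eta * r <= rho_pt rho z w].
Proof.
move=> r0 rD; have [ce de h] := rd eta1; have [c00 c0c] := adm eta1.
set g := c0 eta in c00 c0c *.
have g1 : g < 1.
  have := h x x r r r0 r0 rD rD (fun _ => id).
  rewrite divff ?gt_eqF// powR1 mulr1 (mballE hX)// inver gt_eqF ?(mball_gt0 hX)//.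
  rewrite -EFinM lee_fin divff ?gt_eqF ?(mball_gt0 hX)// => c1.
  rewrite ltNge; apply/negP => g1; have := lt_le_trans c0c c1.
  rewrite -(pow1R (delta eta)) ltNge ge0_ler_powR ?nnegrE//; exact: ltW.
have gr0 : 0 < g * r by rewrite mulr_gt0.
have grr : g * r <= r by rewrite ler_piMl// ltW.
have grD : ((g * r)%:E <= eta%:E * diam rho)%E by rewrite (le_trans _ rD)// lee_fin.
have := h x x r (g * r) r0 gr0 rD grD (subset_qball grr).
rewrite !(mballE hX)// inver gt_eqF ?(mball_gt0 hX)// -EFinM lee_fin.
have -> : r / (g * r) = g^-1 by field; rewrite !gt_eqF.
rewrite -powR_inv1; last exact: ltW.
rewrite -powRrM mulN1r powRN => h2.
have [none|] := pselect (qball rho x r `<=` qball rho x (g * r)).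
  have mg := mball_gt0 hX x gr0.
  have := le_mball hX r0 gr0 none; rewrite -[leRHS]mul1r -ler_pdivrMr// => h3.
  have := le_trans h2 h3; rewrite leNgt ltr_pdivlMr ?powR_gt0//.
  by rewrite mul1r c0c.
move=> /existsNP[z /not_implyP[zr /negP]]; rewrite -leNgt => gz.
exists x, (nseq_tuple m z); split.
- exact: (qball_center hX).
- exact: in_ball_nseq.
- apply: (le_trans gz); have := le_rho_pt x (nseq_tuple m z) (Ordinal m0).
  by rewrite (tnth_nth x)/= nth_nseq m0.
Qed.

Lemma phi_ub a x r y z : 0 < a -> a <= c0 eta -> 0 < r ->
  (r%:E <= eta%:E * diam rho)%E -> qball rho x r y -> in_ball x r z ->
  a * r <= rho_pt rho y z ->
  ((Kdiag Kt y z)%:E <= (kernel_const m kappa Cg a)%:E * phi rho Kt (c0 eta) x r)%E.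
Proof.
move=> a0 ac r0 rD yr zr yz; have [z' [w [z'r wr z'w]]] := phi_support x r0 rD.
have h : Kdiag Kt y z <= kernel_const m kappa Cg a * Kdiag Kt z' w.
  apply: (kernel_compar (x0 := x) (r := r)) => //; rewrite -?rho_ptE//.
  - exact: in_ball_nseq.
  - exact: in_ball_nseq.
  - by rewrite (le_trans _ z'w)// ler_wpM2r// ltW.
have C0 : 0 <= kernel_const m kappa Cg a by rewrite kernel_const_ge0.
apply: (@le_trans _ _ (kernel_const m kappa Cg a * Kdiag Kt z' w)%:E).
  by rewrite lee_fin.
rewrite EFinM lee_wpmul2l ?lee_fin//.
by apply: ereal_sup_ubound; exists (z', w).
Qed.

Lemma phi_le a (c' : R) x r z w : 0 < a -> a <= c' -> 0 < r ->
  qball rho x r z -> in_ball x r w -> a * r <= rho_pt rho z w ->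
  (phi rho Kt c' x r <= (kernel_const m kappa Cg a * Kdiag Kt z w)%:E)%E.
Proof.
move=> a0 ac r0 zr wr zw; apply: ge_ereal_sup => _ [[y y'] /= [yr y'r yy'] <-].
rewrite lee_fin; apply: (kernel_compar (x0 := x) (r := r)) => //; rewrite -?rho_ptE//.
- exact: in_ball_nseq.
- exact: in_ball_nseq.
- by rewrite (le_trans _ yy')// ler_wpM2r// ltW.
Qed.

Lemma phi_ge0 x r : 0 < r -> (r%:E <= eta%:E * diam rho)%E ->
  (0 <= phi rho Kt (c0 eta) x r)%E.
Proof.
move=> r0 rD; have [z [w [zr wr zw]]] := phi_support x r0 rD.
apply: (@le_trans _ _ (Kdiag Kt z w)%:E); first by rewrite lee_fin (pk_ge0 pK).
by apply: ereal_sup_ubound; exists (z, w).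
Qed.

Lemma phi_lty x r : 0 < r -> (r%:E <= eta%:E * diam rho)%E ->
  (phi rho Kt (c0 eta) x r < +oo)%E.
Proof.
move=> r0 rD; have [z [w [zr wr zw]]] := phi_support x r0 rD.
have [c00 _] := adm eta1.
by apply: le_lt_trans (phi_le c00 (lexx _) r0 zr wr zw) (ltry _).
Qed.

(** The weight condition and the decay condition use [phi] with two different
    constants; this relates them. *)
Lemma phi_compar a (c' : R) x r : 0 < a -> a <= c' -> a <= c0 eta -> 0 < r ->
  (r%:E <= eta%:E * diam rho)%E ->
  (phi rho Kt c' x r <= (kernel_const m kappa Cg a)%:E * phi rho Kt (c0 eta) x r)%E.
Proof.
move=> a0 ac' ac r0 rD; apply: ge_ereal_sup => _ [[y y'] /= [yr y'r yy'] <-].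
apply: phi_ub => //; by rewrite (le_trans _ yy')// ler_wpM2r// ltW.
Qed.

End Phi.
End Kernel.

(** * The product measure *)

Section ProductMeasure.
Context {R : realType} {d : measure_display} {X : measurableType d}.

(** The three lemmas below equip a function already known to be a measure with
    the bundled structure that integration theorems expect; the last one also
    records Tonelli's theorem for it. *)
Lemma sigma_finite_pack {d'} {T : measurableType d'} (nu : {measure set T -> \bar R}) :
  sigma_finite setT nu ->
  exists nu' : {sigma_finite_measure set T -> \bar R},
    (nu' : set T -> \bar R) = (nu : set T -> \bar R).
Proof.
move=> sf.
pose H1 := @isSFinite.Build d' T R (Measure.sort nu) (sfinite_measure_sigma_finite sf).
pose H2 := @isSigmaFinite.Build d' T R (Measure.sort nu) sf.
pose nu' := HB.pack_for (SigmaFiniteMeasure.type T R) (Measure.sort nu) H1 H2.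
by exists nu'.
Qed.

Lemma pushforward_pack {d1 d2} {T1 : measurableType d1} {T2 : measurableType d2}
  (nu : {measure set T1 -> \bar R}) (f : T1 -> T2) : measurable_fun [set: T1] f ->
  exists nu' : {measure set T2 -> \bar R},
    (nu' : set T2 -> \bar R) = pushforward nu f.
Proof.
move=> mf; eexists (Measure.clone _ _ _ (pushforward nu f) _).
by [].
Unshelve. exact: mf.
Qed.

Lemma product_pack {d1 d2} {T1 : measurableType d1} {T2 : measurableType d2}
    (m1 : {sigma_finite_measure set T1 -> \bar R})
    (m2 : {sigma_finite_measure set T2 -> \bar R}) :
  exists PM : {sigma_finite_measure set (T1 * T2)%type -> \bar R},
    (PM : set (T1 * T2)%type -> \bar R) = product_measure1 m1 m2 /\
    forall f : T1 * T2 -> \bar R, measurable_fun [set: (T1 * T2)%type] f ->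
      (forall x, 0 <= f x)%E ->
      (\int[PM]_z f z = \int[m1]_x \int[m2]_y f (x, y))%E.
Proof.
pose PM : {measure set (T1 * T2)%type -> \bar R} :=
  Measure.clone _ _ _ (product_measure1 m1 m2) _.
have sf : sigma_finite setT PM.
  have /sigma_finiteP[F [TF ndF Foo]] := sigma_finiteT m1.
  have /sigma_finiteP[G [TG ndG Goo]] := sigma_finiteT m2.
  exists (fun n => F n `*` G n).
    apply/esym/seteqP; split => // -[x y] _.
    have [n _ Fx] : (\bigcup_i F i) x by rewrite -TF.
    have [k _ Gy] : (\bigcup_i G i) y by rewrite -TG.
    exists (maxn n k) => //; split => /=.
      by move: Fx; apply/subsetPset/ndF/leq_maxl.
    by move: Gy; apply/subsetPset/ndG/leq_maxr.
  move=> k; have [mF Fy] := Foo k; have [mG Gy] := Goo k.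
  split; first exact: measurableX.
  by rewrite [PM _]product_measure1E// lte_mul_pinfty// ge0_fin_numE.
have [PM' PM'E] := sigma_finite_pack sf.
exists PM'; split; first by rewrite PM'E.
by move=> f mf f0; rewrite PM'E; exact: fubini_tonelli1.
Qed.

Lemma emeasurable_prod_seq {d'} {T : measurableType d'} (I : Type) (s : seq I)
    (g : I -> T -> \bar R) : (forall i, measurable_fun [set: T] (g i)) ->
  measurable_fun [set: T] (fun x => \prod_(i <- s) g i x)%E.
Proof.
move=> mg; elim: s => [|i s IH].
  by under eq_fun do rewrite big_nil; exact: measurable_cst.
by under eq_fun do rewrite big_cons; exact: emeasurable_funM.
Qed.

Lemma measurable_prod_tnth n (g : 'I_n -> X -> \bar R) :
  (forall i, measurable_fun [set: X] (g i)) ->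
  measurable_fun [set: n.-tuple X] (fun y : n.-tuple X => \prod_(i < n) g i (tnth y i))%E.
Proof.
move=> mg; apply: (@emeasurable_prod_seq _ _ _ _ (fun i (y : n.-tuple X) => g i (tnth y i))) => i.
by apply: (measurableT_comp (mg i)); exact: measurable_tnth.
Qed.

(** By induction on [n], through Tonelli's theorem; sigma-finiteness is carried
    along, since the construction of the next product requires it. *)
Lemma prod_measureP (mu : {measure set X -> \bar R}) n : sigma_finite setT mu ->
  exists pm : {sigma_finite_measure set (n.-tuple X) -> \bar R},
    (pm : set (n.-tuple X) -> \bar R) = @prod_measure R d X mu n /\
    forall g : 'I_n -> X -> \bar R, (forall i, measurable_fun [set: X] (g i)) ->
      (forall i x, 0 <= g i x)%E ->
      (\int[pm]_y (\prod_(i < n) g i (tnth y i)) = \prod_(i < n) \int[mu]_x g i x)%E.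
Proof.
move=> sf; elim: n => [|n [pm [pmE pmI]]].
  have [pm pmE] : exists pm : {sigma_finite_measure set (0.-tuple X) -> \bar R},
      (pm : set (0.-tuple X) -> \bar R) = dirac [tuple].
    apply: (sigma_finite_pack (nu := dirac [tuple])).
    apply: fin_num_fun_sigma_finite; first by rewrite measure0.
    by move=> A mA; rewrite /= /dirac.
  exists pm; split => // g mg g0; rewrite pmE.
  rewrite integral_dirac//; last exact: measurable_prod_tnth.
  by rewrite !big_ord0 diracT mul1e.
have [mus musE] := sigma_finite_pack sf.
have [PM [PME fub]] := product_pack mus pm.
pose f := fun z : (X * n.-tuple X)%type => cons_tuple z.1 z.2.
have mf : measurable_fun [set: (X * n.-tuple X)%type] f by exact: measurable_cons.
have [nu nuE] := pushforward_pack PM mf.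
pose G := fun y : n.+1.-tuple X => (thead y, [tuple of behead y] : n.-tuple X).
have mG : measurable_fun [set: n.+1.-tuple X] G.
  by apply/measurable_fun_pair; [exact: measurable_tnth|exact: measurable_behead].
have fG : cancel f G.
  by move=> [x y]; rewrite /f /G/= theadE; congr pair; exact: val_inj.
have sfnu : sigma_finite setT nu.
  have [F FT Fm] := sigma_finiteT PM.
  exists (fun i => G @^-1` F i).
    by rewrite -preimage_bigcup -FT preimage_setT.
  move=> i; have [mFi Fiy] := Fm i; split.
    by rewrite -[X in measurable X]setTI; exact: mG.
  rewrite nuE /pushforward -comp_preimage (_ : G \o f = id) ?preimage_id//.
  by apply/funext => z; exact: fG.
have [nu' nu'E] := sigma_finite_pack sfnu.
exists nu'; split.
  transitivity (pushforward (product_measure1 mus pm) f); last by rewrite pmE musE.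
  by rewrite nu'E nuE -PME.
move=> g mg g0.
have -> : (\int[nu']_y (\prod_(i < n.+1) g i (tnth y i)) =
    \int[PM]_z ((\prod_(i < n.+1) g i (tnth (f z) i))))%E.
  rewrite nu'E nuE (ge0_integral_pushforward mf)//.
  - exact: measurable_prod_tnth.
  - by move=> y _; apply: prode_ge0.
rewrite fub; last 2 first.
- exact: (measurableT_comp (measurable_prod_tnth mg) mf).
- by move=> z; exact: prode_ge0.
rewrite big_ord_recl -(pmI (fun i => g (lift ord0 i)))// -musE.
have i0 : (0 <= \int[pm]_y \prod_(i < n) g (lift ord0 i) (tnth y i))%E.
  by apply: integral_ge0 => y _; apply: prode_ge0.
rewrite -ge0_integralZr//.
apply: eq_integral => x _.
rewrite -ge0_integralZl//; last 2 first.
- exact: (measurable_prod_tnth (fun i => mg (lift ord0 i))).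
- by move=> y _; apply: prode_ge0.
apply: eq_integral => y _; rewrite big_ord_recl; congr (_ * _)%E.
by apply: eq_bigr => i _; rewrite /f tnthS.
Qed.

End ProductMeasure.

(** * Hoelder's inequality on a set, with a weight *)

Section HoelderOnSets.
Context {d : measure_display} {T : measurableType d} {R : realType}.
Variable mu : {measure set T -> \bar R}.

Lemma measurable_powR_fun (f : T -> R) (r : R) : measurable_fun [set: T] f ->
  measurable_fun [set: T] (fun x => f x `^ r).
Proof. by move=> mf; exact: (measurableT_comp (measurable_powR r)). Qed.

Lemma integral_indicM (B : set T) (f : T -> R) :
  (\int[mu]_(x in B) (f x)%:E = \int[mu]_x (f x * \1_B x)%:E)%E.
Proof.
rewrite integral_mkcond; apply: eq_integral => x _.
by rewrite patchE indicE; case: (x \in B); rewrite ?mulr1 ?mulr0.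
Qed.

Lemma hoelder_set (B : set T) (f g : T -> R) (p q : R) :
  measurable B -> measurable_fun [set: T] f -> measurable_fun [set: T] g ->
  (forall x, 0 <= f x) -> (forall x, 0 <= g x) ->
  0 < p -> 0 < q -> p^-1 + q^-1 = 1 ->
  (\int[mu]_(x in B) (f x * g x)%:E <=
   (\int[mu]_(x in B) (f x `^ p)%:E) `^ p^-1 *
   (\int[mu]_(x in B) (g x `^ q)%:E) `^ q^-1)%E.
Proof.
move=> mB mf mg f0 g0 p0 q0 pq.
have mI (h : T -> R) : measurable_fun [set: T] h ->
    measurable_fun [set: T] (fun x => h x * \1_B x).
  by move=> mh; apply: measurable_funM => //; exact: measurable_indic.
have := hoelder mu (mI _ mf) (mI _ mg) p0 q0 pq.
rewrite Lnorm1 unlock (integral_indicM B (fun x => f x * g x)).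
rewrite (integral_indicM B (fun x => f x `^ p)) (integral_indicM B (fun x => g x `^ q)).
congr (_ <= _ `^ _ * _ `^ _)%E; apply: eq_integral => x _ /=.
- rewrite mulrACA -expr2 ger0_norm; last by rewrite !mulr_ge0// sqr_ge0.
  by rewrite indicE; case: (x \in B); rewrite ?expr1n ?expr0n.
- rewrite ger0_norm ?mulr_ge0//; rewrite indicE.
  by case: (x \in B); rewrite ?mulr1// ?mulr0 powR0// gt_eqF.
- rewrite ger0_norm ?mulr_ge0//; rewrite indicE.
  by case: (x \in B); rewrite ?mulr1// ?mulr0 powR0// gt_eqF.
Qed.

(** Hoelder's inequality with the weight [v]: where [v] vanishes, the inverse
    power of [v] is infinite, so that its integrability makes this set
    negligible. *)
Lemma hoelder_weight (B : set T) (f v : T -> R) (P a : R) :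
  measurable B -> measurable_fun [set: T] f -> measurable_fun [set: T] v ->
  (forall x, 0 <= v x) -> 0 < P -> 0 < a -> P^-1 + a^-1 = 1 ->
  (\int[mu]_(x in B) ((v x `^ P)%:E)^-1 < +oo)%E ->
  (\int[mu]_(x in B) (`|f x|)%:E <=
   (\int[mu]_(x in B) ((v x `^ P)%:E)^-1) `^ P^-1 *
   (\int[mu]_(x in B) ((`|f x| * v x) `^ a)%:E) `^ a^-1)%E.
Proof.
move=> mB mf mv v0 P0 a0 Pa Voo.
pose Z := B `&` [set x | v x <= 0].
have mZ : measurable Z.
  apply: measurableI => //; rewrite -[X in measurable X]setTI.
  exact: measurable_fun_ler.
have Z0 : mu Z = 0%E.
  apply/eqP/negPn/negP => Zn0; move: Voo; rewrite ltNge => /negP; apply.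
  have e : (\int[mu]_(x in Z) cst +oo x = +oo)%E.
    by rewrite integral_cst// gt0_mulye// lt0e Zn0 measure_ge0.
  rewrite -e [leLHS]integral_mkcond [leRHS]integral_mkcond.
  apply: le_integral_dominated => x; rewrite !patchE.
    by case: ifP => _ //=; rewrite leey.
  have [|_] := boolP (x \in Z).
    rewrite inE => -[xB /= vx]; rewrite mem_set//.
    have -> : v x = 0 by apply/eqP; rewrite eq_le vx v0.
    by rewrite powR0 ?gt_eqF// inve0.
  by case: ifP => // _; rewrite inve_ge0 lee_fin powR_ge0.
have mw : measurable_fun [set: T] (fun x => v x `^ (-1)) by exact: measurable_powR_fun.
have mn : measurable_fun [set: T] (fun x => `|f x|) by exact: measurableT_comp.
have mg : measurable_fun [set: T] (fun x => `|f x| * v x) by exact: measurable_funM.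
apply: (@le_trans _ _ (\int[mu]_(x in B) (v x `^ (-1) * (`|f x| * v x))%:E)%E).
  rewrite (ge0_negligible_integral mZ mB _ _ Z0); last 2 first.
  - by apply/measurable_EFinP; exact: measurable_funTS.
  - by move=> x _; rewrite lee_fin.
  rewrite [leLHS]integral_mkcond [leRHS]integral_mkcond.
  apply: le_integral_dominated => x; rewrite !patchE.
    by case: ifP => _ //; rewrite lee_fin.
  have [|_] := boolP (x \in B `\` Z).
    rewrite inE => -[xB xZ]; rewrite mem_set//.
    have vx : 0 < v x by rewrite ltNge; apply/negP => vx; apply: xZ.
    by rewrite powR_inv1 ?v0// lee_fin mulrCA mulVf ?mulr1// gt_eqF.
  by case: ifP => // _; rewrite lee_fin !mulr_ge0 ?powR_ge0.
apply: (le_trans (hoelder_set mB mw mg _ _ P0 a0 Pa)).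
- by move=> x; rewrite powR_ge0.
- by move=> x; rewrite mulr_ge0.
rewrite lee_wpmul2r ?poweR_ge0//.
have le : (\int[mu]_(x in B) ((v x `^ (-1)) `^ P)%:E <=
    \int[mu]_(x in B) ((v x `^ P)%:E)^-1)%E.
  apply: le_integral_dominated_in => x _; first by rewrite lee_fin powR_ge0.
  have := v0 x; rewrite le_eqVlt => /orP[/eqP<-|vx].
    by rewrite [0 `^ P]powR0 ?gt_eqF// inve0 leey.
  by rewrite inver gt_eqF ?powR_gt0// lee_fin -powRrM mulN1r powRN.
have i0 : (0 <= \int[mu]_(x in B) ((v x `^ (-1)) `^ P)%:E)%E.
  by apply: integral_ge0 => x _; rewrite lee_fin powR_ge0.
apply: gt0_ler_poweR => //; rewrite ?in_itv/= ?leey ?andbT//; last exact: le_trans le.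
by rewrite invr_ge0 ltW.
Qed.

End HoelderOnSets.

(** * The norm of a sparse sum *)

(** A crude bound, valid for every exponent; it is only used to see that an
    integral is finite. *)
Lemma powR_sum_le_size {R : realType} (I : eqType) (s : seq I) (F : I -> R) (r : R) :
  0 < r -> (forall i, 0 <= F i) ->
  (\sum_(i <- s) F i) `^ r <= (size s)%:R `^ r * \sum_(i <- s) F i `^ r.
Proof.
move=> r0 F0; set S := \sum_(i <- s) F i `^ r.
have S0 : 0 <= S by apply: sumr_ge0 => i _; exact: powR_ge0.
have h : \sum_(i <- s) F i <= (size s)%:R * S `^ r^-1.
  rewrite -sum1_size natr_sum mulr_suml big_seq [leRHS]big_seq.
  apply: ler_sum => i si; rewrite mul1r.
  have -> : F i = (F i `^ r) `^ r^-1 by rewrite -powRrM divff ?gt_eqF// powRr1.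
  rewrite ge0_ler_powR ?nnegrE ?powR_ge0 ?invr_ge0 ?(ltW r0)//.
  by rewrite /S (big_rem i)//= lerDl sumr_ge0// => j _; rewrite powR_ge0.
have -> : S = (S `^ r^-1) `^ r by rewrite -powRrM mulVf ?gt_eqF// powRr1.
rewrite -powRM ?powR_ge0//.
by rewrite ge0_ler_powR ?nnegrE ?(ltW r0) ?sumr_ge0// mulr_ge0 ?powR_ge0.
Qed.

Section SparseNorm.
Context {R : realType} {d : measure_display} {X : measurableType d}.
Variables (rho : X -> X -> R) (mu : {measure set X -> \bar R}) (kappa L : R).
Hypothesis hX : homogeneous_type rho mu kappa L.
Variables (x0 : X) (Rt : R).
Hypothesis Rt0 : 0 < Rt.

Local Notation dball := (scaled_ball rho Rt).
Local Notation D := (dil kappa).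
Local Notation dm := (dmass rho mu kappa Rt).
Local Notation dav := (davg rho mu kappa Rt).

Variables (W : set X) (ss : seq (seq (X * nat))) (N : nat).
Hypothesis mW : measurable W.
Hypothesis Wy : (mu W < +oo)%E.
Hypothesis ssN : {in flatten ss, forall b, window_ball rho x0 Rt N b /\ dball D b `<=` W}.
Hypothesis sparse_ss : sparse rho Rt (mass mu (cst 1%E) W) ss.

Variables (m : nat) (p_ : 'I_m -> R) (q : R) (u : X -> R).
Variables (c : X * nat -> R) (Xi : 'I_m -> X * nat -> R) (M : 'I_m -> R) (A : R).
Hypothesis p0 : forall i, 0 < p_ i.
Hypothesis q0 : 0 < q.
Hypothesis sum_p : q^-1 <= \sum_(i < m) (p_ i)^-1.
Hypothesis mu_ : measurable_fun [set: X] u.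
Hypothesis u0 : forall x, 0 <= u x.
Hypothesis c0 : forall b, 0 <= c b.
Hypothesis X0 : forall i b, 0 <= Xi i b.
Hypothesis M0 : forall i, 0 <= M i.
Hypothesis A0 : 0 <= A.
Hypothesis XM : forall i, \sum_(b <- flatten ss) Xi i b `^ p_ i <= M i `^ p_ i.

Definition sparse_sum (x : X) : R := \sum_(b <- flatten ss) c b * \1_(dball D b) x.
Local Notation H := sparse_sum.

Let mD b : measurable (dball D b). Proof. exact: (measurable_scaled_ball hX). Qed.

Lemma sparse_sum_ge0 x : 0 <= H x.
Proof. by apply: sumr_ge0 => b _; rewrite mulr_ge0. Qed.

Lemma measurable_sparse_sum : measurable_fun [set: X] H.
Proof.
apply: measurable_sum => b; apply: measurable_funM => //; exact: measurable_indic.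
Qed.

Let mHu : measurable_fun [set: X] (fun x => H x * u x).
Proof. by apply: measurable_funM => //; exact: measurable_sparse_sum. Qed.
Let Hu0 x : 0 <= H x * u x. Proof. by rewrite mulr_ge0// sparse_sum_ge0. Qed.

(** The [q]-th power is subadditive, so that the local estimates can be summed.
    The exponents [q / p_ i] of the factors have a sum of at least [1], which
    is what Hoelder's inequality for sums needs. *)
Lemma sparse_norm_le1 : q <= 1 ->
  {in flatten ss, forall b, ((c b `^ q)%:E * \int[mu]_(x in dball D b) (u x `^ q)%:E <=
     ((A * \prod_(i < m) Xi i b) `^ q)%:E)%E} ->
  (\int[mu]_x ((H x * u x) `^ q)%:E <=
   (A `^ q * (m%:R * (\prod_(i < m) M i) `^ q))%:E)%E.
Proof.
move=> q1 cT.
apply: (@le_trans _ _ (\int[mu]_x \sum_(b <- flatten ss)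
    (c b `^ q * (u x `^ q * \1_(dball D b) x))%:E)%E).
  apply: le_integral_dominated => x; first by rewrite lee_fin powR_ge0.
  rewrite sumEFin lee_fin powRM ?sparse_sum_ge0//.
  apply: (le_trans (ler_wpM2r (powR_ge0 _ _) (powR_sum_le _ q0 q1 _))).
    by move=> b; rewrite mulr_ge0.
  rewrite mulr_suml; apply: ler_sum => b _; rewrite powRM// -mulrA.
  rewrite ler_wpM2l ?powR_ge0// mulrC ler_wpM2l ?powR_ge0// indicE.
  by case: (x \in _); rewrite ?pow1R// powR0 ?gt_eqF.
have muq b : measurable_fun [set: X] (fun x => u x `^ q * \1_(dball D b) x).
  apply: measurable_funM; [exact: measurable_powR_fun|exact: measurable_indic].
rewrite ge0_integral_sum//; last 2 first.
- move=> b; apply/measurable_EFinP; exact: measurable_funM.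
- by move=> b x _; rewrite lee_fin !mulr_ge0 ?powR_ge0.
apply: (@le_trans _ _ (\sum_(b <- flatten ss) ((A * \prod_(i < m) Xi i b) `^ q)%:E)%E).
  rewrite big_seq [leRHS]big_seq; apply: lee_sum => b bs.
  apply: le_trans (cT b bs); rewrite (integral_indicM mu _ (fun x => u x `^ q)).
  rewrite -ge0_integralZl ?lee_fin ?powR_ge0//.
  - exact/measurable_EFinP.
  - by move=> x _; rewrite lee_fin mulr_ge0 ?powR_ge0.
rewrite sumEFin lee_fin.
under eq_bigr do rewrite powRM ?prodr_ge0//.
rewrite -mulr_sumr ler_wpM2l ?powR_ge0//.
have := @hoelder_sums R 'I_m _ (flatten ss) (fun i => q / p_ i)
  (fun i b => Xi i b `^ p_ i) (fun i => M i `^ p_ i).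
rewrite card_ord => hs.
have pq i (y : R) : 0 <= y -> (y `^ p_ i) `^ (q / p_ i) = y `^ q.
  by move=> y0; rewrite -powRrM mulrCA divff ?mulr1// gt_eqF.
have pE (F : 'I_m -> R) : (forall i, 0 <= F i) ->
    (\prod_(i < m) F i) `^ q = \prod_(i < m) (F i `^ p_ i) `^ (q / p_ i).
  by move=> F0; rewrite powR_prod//; apply: eq_bigr => i _; rewrite pq.
rewrite (eq_bigr _ (fun b _ => pE (Xi^~ b) (X0^~ b))) pE//.
apply: hs => //.
- by move=> i; rewrite divr_gt0.
- by rewrite -mulr_sumr -ler_pdivrMl// mulr1.
- by move=> i b; rewrite powR_ge0.
Qed.

Lemma conj_expV (r : R) : 1 < r -> (conj_exp r)^-1 = 1 - r^-1.
Proof.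
move=> r1; rewrite /conj_exp; field.
by rewrite !gt_eqF ?subr_gt0// (lt_trans _ r1).
Qed.

Lemma conj_exp_gt1 (r : R) : 1 < r -> 1 < conj_exp r.
Proof.
by move=> r1; rewrite /conj_exp ltr_pdivlMr ?subr_gt0// mul1r gtrBl.
Qed.

Let b0 b : 0 < dm b. Proof. exact: (dmass_gt0 hX). Qed.

(** The test function is averaged with the exponent dual to [q * t], which is
    smaller than the one dual to [q]; the Carleson embedding is used with their
    quotient. *)
Definition dual_const (t : R) : R :=
  carleson_const kappa L (conj_exp q / conj_exp (q * t)).

(** For [q > 1], the integral of [(H * u) ^ q] is tested against
    [h = (H * u) ^ (q - 1)], whose norm is a power of the same integral; that
    integral is finite since the sum is, and can be divided out. *)
Lemma sparse_norm_gt1 (t : R) : 1 < q -> 1 < t ->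
  {in flatten ss, forall b,
    ((c b)%:E * (\int[mu]_(x in dball D b) (u x `^ (q * t))%:E) `^ (q * t)^-1 <=
     (A * \prod_(i < m) Xi i b * dm b `^ ((q * t)^-1 - q^-1))%:E)%E} ->
  (\int[mu]_x ((H x * u x) `^ q)%:E <=
   ((A * m.+1%:R * dual_const t `^ (conj_exp q)^-1 * \prod_(i < m) M i) `^ q)%:E)%E.
Proof.
move=> q1 t1 cT.
have qt1 : 1 < q * t by rewrite (lt_trans q1)// ltr_pMr.
have qt0 : 0 < q * t by rewrite (lt_trans ltr01).
set q' := conj_exp q; set be := conj_exp (q * t).
have q'1 : 1 < q' by exact: conj_exp_gt1.
have q'0 : 0 < q' by rewrite (lt_trans ltr01).
have be1 : 1 < be by exact: conj_exp_gt1.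
have be0 : 0 < be by rewrite (lt_trans ltr01).
have s1 : 1 < q' / be.
  rewrite -[be]invrK ltr_pdivlMr ?invr_gt0// mul1r /be conj_expV//.
  rewrite -[q']invrK ltf_pV2 ?posrE ?invr_gt0//; last first.
    by rewrite subr_gt0 invf_lt1.
  by rewrite /q' conj_expV// ltrD2l ltrN2 ltf_pV2 ?posrE// ltr_pMr.
have pr0 b : 0 <= \prod_(i < m) Xi i b by rewrite prodr_ge0.
have prM : 0 <= \prod_(i < m) M i by rewrite prodr_ge0.
have mI b (f : X -> R) : measurable_fun [set: X] f ->
    measurable_fun [set: X] (fun x => f x * \1_(dball D b) x).
  by move=> mf; apply: measurable_funM => //; exact: measurable_indic.
(* a finite sum of functions with finite integral: on a ball, [u ^ q <= 1 + u ^ (q * t)] *)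
have Iy : (\int[mu]_x ((H x * u x) `^ q)%:E < +oo)%E.
  apply: (@le_lt_trans _ _ (\int[mu]_x \sum_(b <- flatten ss)
    ((size (flatten ss))%:R `^ q * c b `^ q * (u x `^ q * \1_(dball D b) x))%:E)%E).
    apply: le_integral_dominated => x; first by rewrite lee_fin powR_ge0.
    rewrite sumEFin lee_fin powRM ?sparse_sum_ge0//.
    apply: (le_trans (ler_wpM2r (powR_ge0 _ _) (powR_sum_le_size _ q0 _))).
      by move=> b; rewrite mulr_ge0.
    rewrite -mulrA mulr_suml mulr_sumr; apply: ler_sum => b _.
    rewrite -mulrA ler_wpM2l ?powR_ge0// powRM// -mulrA.
    rewrite ler_wpM2l ?powR_ge0// mulrC ler_wpM2l ?powR_ge0// indicE.
    by case: (x \in _); rewrite ?pow1R// powR0 ?gt_eqF.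
  rewrite ge0_integral_sum//; last 2 first.
  - by move=> b; apply/measurable_EFinP; apply: measurable_funM => //;
      apply: mI; exact: measurable_powR_fun.
  - by move=> b x _; rewrite lee_fin !mulr_ge0 ?powR_ge0.
  rewrite big_seq; apply: lte_sum_pinfty => b bs.
  under eq_integral do rewrite EFinM.
  rewrite ge0_integralZl ?lee_fin ?mulr_ge0 ?powR_ge0//; last 2 first.
  - by apply/measurable_EFinP; apply: mI; exact: measurable_powR_fun.
  - by move=> x _; rewrite lee_fin mulr_ge0 ?powR_ge0.
  have [cb0|cbn0] := eqVneq (c b) 0.
    by rewrite cb0 powR0 ?gt_eqF// mulr0 mul0e ltry.
  have cb : 0 < c b by rewrite lt_neqAle eq_sym cbn0 c0.
  have Uy : (\int[mu]_(x in dball D b) (u x `^ (q * t))%:E < +oo)%E.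
    rewrite ltNge leye_eq; apply/negP => /eqP Uy.
    have := cT b bs; rewrite Uy poweRyr ?invr_neq0 ?gt_eqF// gt0_muley ?lte_fin//.
  rewrite lte_mul_pinfty ?lee_fin ?mulr_ge0 ?powR_ge0//.
  rewrite -integral_indicM.
  apply: (@le_lt_trans _ _ (\int[mu]_(x in dball D b) (1 + (u x `^ (q * t))%:E))%E).
    apply: le_integral_dominated_in => x _; first by rewrite lee_fin powR_ge0.
    rewrite -EFinD lee_fin.
    have [ux|ux] := leP (u x) 1.
      rewrite (@le_trans _ _ 1) ?lerDl ?powR_ge0//.
      by rewrite -(pow1R q) ge0_ler_powR ?nnegrE// ltW.
    rewrite (@le_trans _ _ (u x `^ (q * t))) ?lerDr//.
    by apply: ler_powR; rewrite ?ltW// ltr_pMr.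
  rewrite ge0_integralD//; last 2 first.
  - by move=> x _; rewrite lee_fin powR_ge0.
  - by apply/measurable_EFinP/measurable_funTS; exact: measurable_powR_fun.
  rewrite integral_cst// mul1e (mu_scaled_ball hX)//.
  by rewrite lte_add_pinfty// ltry.
set I := (\int[mu]_x ((H x * u x) `^ q)%:E)%E in Iy *.
have I0 : (0 <= I)%E by apply: integral_ge0 => x _; rewrite lee_fin powR_ge0.
have IE : I = (fine I)%:E by rewrite fineK// ge0_fin_numE.
pose h x := (H x * u x) `^ (q - 1).
have mh : measurable_fun [set: X] h by exact: measurable_powR_fun.
have h0 x : 0 <= h x by rewrite powR_ge0.
have hq' x : (h x `^ be) `^ (q' / be) = (H x * u x) `^ q.
  rewrite /h -!powRrM; congr powR; rewrite /q' /conj_exp; field.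
  by rewrite !gt_eqF// subr_gt0.
(* [Y] plays for [h] the role of [Xi i] for the [i]-th function *)
pose Y b := dm b `^ q'^-1 * dav (fun x => h x `^ be) b `^ be^-1.
have dav0 b : 0 <= dav (fun x => h x `^ be) b.
  by rewrite divr_ge0 ?(ltW (b0 b))// fine_ge0// integral_ge0// => x _; rewrite lee_fin powR_ge0.
have YC : \sum_(b <- flatten ss) Y b `^ q' <= dual_const t * fine I.
  have := carleson hX Rt0 mW Wy ssN sparse_ss (measurable_powR_fun be mh)
    (fun x => powR_ge0 _ _) s1.
  under eq_integral do rewrite hq'.
  rewrite -/I IE -EFinM lee_fin; apply: le_trans.
  rewrite le_eqVlt; apply/orP; left; apply/eqP; apply: eq_bigr => b _.
  rewrite /Y powRM ?powR_ge0// -!powRrM mulVf ?gt_eqF// powRr1 ?(ltW (b0 b))//.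
  by rewrite [be^-1 * _]mulrC.
have muh : measurable_fun [set: X] (fun x => u x * h x) by exact: measurable_funM.
have IS : I = (\sum_(b <- flatten ss) (c b)%:E * \int[mu]_(x in dball D b) (u x * h x)%:E)%E.
  transitivity (\int[mu]_x \sum_(b <- flatten ss) (c b * (u x * h x * \1_(dball D b) x))%:E)%E.
    apply: eq_integral => x _; rewrite sumEFin; congr EFin.
    rewrite -(mulr_powRB1 (Hu0 x) q0) -/(h x) /sparse_sum -mulrA mulr_suml.
    by apply: eq_bigr => b _; rewrite -mulrA [\1_ _ _ * _]mulrC.
  rewrite ge0_integral_sum//; last 2 first.
  - by move=> b; apply/measurable_EFinP; apply: measurable_funM => //; exact: mI.
  - by move=> b x _; rewrite lee_fin !mulr_ge0.
  apply: eq_bigr => b _; rewrite (integral_indicM mu _ (fun x => u x * h x)).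
  rewrite -ge0_integralZl ?lee_fin//.
  - by apply/measurable_EFinP; exact: mI.
  - by move=> x _; rewrite lee_fin !mulr_ge0.
have hb b : (\int[mu]_(x in dball D b) (h x `^ be)%:E =
    (dm b * dav (fun x => h x `^ be) b)%:E)%E.
  rewrite /davg mulrCA divff ?gt_eqF// mulr1 fineK// ge0_fin_numE; last first.
    by apply: integral_ge0 => x _; rewrite lee_fin powR_ge0.
  apply: (@le_lt_trans _ _ (\int[mu]_(x in dball D b) (1 + ((H x * u x) `^ q)%:E))%E).
    apply: le_integral_dominated_in => x _; first by rewrite lee_fin powR_ge0.
    rewrite -EFinD lee_fin -hq'.
    have [hx|hx] := leP (h x `^ be) 1; first by rewrite (le_trans hx)// lerDl powR_ge0.
    by rewrite (le_trans (le1r_powR (ltW hx) (ltW s1)))// lerDr.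
  rewrite ge0_integralD//; last 2 first.
  - by move=> x _; rewrite lee_fin powR_ge0.
  - by apply/measurable_EFinP/measurable_funTS; exact: measurable_powR_fun.
  rewrite integral_cst// mul1e (mu_scaled_ball hX)//.
  rewrite lte_add_pinfty// ?ltry//; apply: le_lt_trans Iy.
  apply: ge0_subset_integral => //.
  - by apply/measurable_EFinP; exact: measurable_powR_fun.
  - by move=> x _; rewrite lee_fin powR_ge0.
have cY : {in flatten ss, forall b,
    ((c b)%:E * \int[mu]_(x in dball D b) (u x * h x)%:E <=
     (A * \prod_(i < m) Xi i b * Y b)%:E)%E}.
  move=> b bs; have qtbe : (q * t)^-1 + be^-1 = 1 by rewrite /be conj_expV//; ring.
  have := hoelder_set mu (mD b) mu_ mh u0 h0 qt0 be0 qtbe.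
  have cb : (0 <= (c b)%:E)%E by rewrite lee_fin.
  move=> /(lee_wpmul2l cb)/le_trans; apply.
  rewrite muleA hb poweR_EFin; apply: le_trans (lee_wpmul2r _ (cT b bs)) _.
    by rewrite lee_fin powR_ge0.
  rewrite -EFinM lee_fin le_eqVlt; apply/orP; left; apply/eqP.
  rewrite powRM ?(ltW (b0 b))// /Y -!mulrA; congr (_ * (_ * _)).
  rewrite mulrA; congr (_ * _).
  rewrite -powRD; last by rewrite (gt_eqF (b0 b)) implybT.
  by congr powR; rewrite /be /q' !conj_expV//; ring.
have Ile : fine I <= A * (m.+1%:R * ((dual_const t * fine I) `^ q'^-1 * \prod_(i < m) M i)).
  apply: (@le_trans _ _ (\sum_(b <- flatten ss) (A * \prod_(i < m) Xi i b * Y b))).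
    rewrite -lee_fin -IE IS -sumEFin big_seq [leRHS]big_seq.
    by apply: lee_sum => b bs; exact: cY.
  under eq_bigr do rewrite -mulrA.
  rewrite -mulr_sumr ler_wpM2l//.
  (* index [0] stands for [Y], the others for the [Xi] *)
  pose z (i : 'I_m.+1) b := if unlift ord0 i is Some j then Xi j b `^ p_ j else Y b `^ q'.
  pose Z (i : 'I_m.+1) := if unlift ord0 i is Some j then M j `^ p_ j else dual_const t * fine I.
  pose ex (i : 'I_m.+1) := if unlift ord0 i is Some j then (p_ j)^-1 else q'^-1.
  have pK (i : 'I_m) (y : R) : 0 <= y -> (y `^ p_ i) `^ (p_ i)^-1 = y.
    by move=> y0; rewrite -powRrM divff ?powRr1// gt_eqF.
  have Y0 b : 0 <= Y b by rewrite mulr_ge0 ?powR_ge0.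
  have hs : \sum_(b <- flatten ss) \prod_i z i b `^ ex i <= m.+1%:R * \prod_i Z i `^ ex i.
    rewrite -[X in X%:R * _](card_ord m.+1); apply: hoelder_sums.
    - by move=> i; rewrite /ex; case: (unlift _ _) => [j|]; rewrite invr_gt0.
    - rewrite big_ord_recl /ex unlift_none; under eq_bigr do rewrite liftK.
      rewrite /q' conj_expV//; have := sum_p; lra.
    - by move=> i b; rewrite /z; case: (unlift _ _) => [j|]; rewrite powR_ge0.
    - by move=> i; rewrite /z /Z; case: (unlift _ _) => [j|].
  have zE b : \prod_i z i b `^ ex i = \prod_(i < m) Xi i b * Y b.
    rewrite big_ord_recl /z /ex unlift_none mulrC -powRrM divff ?powRr1 ?gt_eqF//.
    by congr (_ * _); apply: eq_bigr => i _; rewrite liftK pK.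
  have ZE : \prod_i Z i `^ ex i = (dual_const t * fine I) `^ q'^-1 * \prod_(i < m) M i.
    rewrite big_ord_recl /Z /ex unlift_none.
    by congr (_ * _); apply: eq_bigr => i _; rewrite liftK pK.
  by move: hs; rewrite ZE (eq_bigr _ (fun b _ => zE b)).
have dc0 : 0 <= dual_const t.
  by apply: carleson_const_ge0 => //; rewrite (le_trans ler01)// (doubling_ge1 hX x0).
rewrite IE lee_fin; have [If0|Ifn0] := eqVneq (fine I) 0; first by rewrite If0 powR_ge0.
have Ip : 0 < fine I by rewrite lt_neqAle eq_sym Ifn0 fine_ge0.
set K := A * m.+1%:R * dual_const t `^ q'^-1 * \prod_(i < m) M i.
have K0 : 0 <= K by rewrite !mulr_ge0 ?powR_ge0.
have IK : fine I `^ q^-1 <= K.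
  have I'0 : 0 < fine I `^ q'^-1 by rewrite powR_gt0.
  rewrite -(ler_pM2r I'0) -powRD; last by rewrite Ifn0 implybT.
  have -> : q^-1 + q'^-1 = 1 by rewrite /q' conj_expV//; ring.
  rewrite powRr1 ?(ltW Ip)// (le_trans Ile)//.
  rewrite powRM ?(ltW Ip)// le_eqVlt; apply/orP; left; apply/eqP.
  by rewrite /K; ring.
have -> : fine I = (fine I `^ q^-1) `^ q by rewrite -powRrM mulVf ?powRr1 ?(ltW Ip)// gt_eqF.
by rewrite ge0_ler_powR ?nnegrE ?powR_ge0// ltW.
Qed.

End SparseNorm.

(** * Capped radii and the decay of phi *)

Lemma prode_gt0 {R : realType} (I : Type) (s : seq I) (P : pred I) (V : I -> \bar R) :
  (forall i, 0 < V i)%E -> (0 < \prod_(i <- s | P i) V i)%E.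
Proof.
by move=> V0; apply: (big_ind (fun x => 0 < x)%E) => // x y; exact: mule_gt0.
Qed.

Lemma prode_lty_factor {R : realType} (I : finType) (V : I -> \bar R) :
  (forall i, 0 < V i)%E -> (\prod_i V i < +oo)%E -> forall i, (V i < +oo)%E.
Proof.
move=> V0 Vy i; rewrite ltNge leye_eq; apply/negP => /eqP Vi; move: Vy.
rewrite (bigD1 i)//= Vi gt0_mulye ?ltxx//; exact: prode_gt0.
Qed.

Lemma EFin_prod {R : realType} (I : Type) (s : seq I) (P : pred I) (F : I -> R) :
  ((\prod_(i <- s | P i) F i)%:E = \prod_(i <- s | P i) (F i)%:E)%E.
Proof. by rewrite (big_morph EFin (@EFinM R) erefl). Qed.

Section Scales.
Context {R : realType} {d : measure_display} {X : measurableType d}.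
Variables (rho : X -> X -> R) (mu : {measure set X -> \bar R}) (kappa L : R).
Hypothesis hX : homogeneous_type rho mu kappa L.
Variable eta : R.
Hypothesis eta1 : 1 < eta.
Hypothesis X2 : exists x y : X, x <> y.

Local Notation maxr := (eta%:E * diam rho)%E.

(** Radii are capped at the largest one for which [phi] is considered; this
    does not change the ball, since larger balls are the whole space. *)
Definition cap (r : R) : R := if (r%:E <= maxr)%E then r else fine maxr.

Lemma diam_gt0 : (0 < diam rho)%E.
Proof.
have [x [y xy]] := X2; apply: (@lt_le_trans _ _ (rho x y)%:E).
  rewrite lte_fin lt_neqAle (rho_ge0 hX) andbT eq_sym; apply/eqP.
  by move=> /(rho_eq0 hX).
by apply: ereal_sup_ubound; exists (x, y).
Qed.

Let eta0 : 0 < eta. Proof. exact: lt_trans eta1. Qed.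

Lemma maxr_gt0 : (0 < maxr)%E.
Proof. by rewrite mule_gt0 ?diam_gt0. Qed.

Let maxr_fin r : (maxr < r%:E)%E -> maxr = (fine maxr)%:E.
Proof.
move=> h; rewrite fineK// ge0_fin_numE ?(ltW maxr_gt0)//.
by rewrite (lt_trans h)// ltry.
Qed.

Lemma cap_id r : (r%:E <= maxr)%E -> cap r = r.
Proof. by rewrite /cap => ->. Qed.

Lemma cap_gt0 r : 0 < r -> 0 < cap r.
Proof.
rewrite /cap; have [h|h] := leP r%:E maxr => // _; rewrite -lte_fin -(maxr_fin h).
exact: maxr_gt0.
Qed.

Lemma cap_le_maxr r : ((cap r)%:E <= maxr)%E.
Proof. by rewrite /cap; have [h|h] := leP r%:E maxr => //; rewrite -(maxr_fin h). Qed.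

Lemma cap_le r : cap r <= r.
Proof. by rewrite /cap; have [h|h] := leP r%:E maxr => //; rewrite -lee_fin -(maxr_fin h) ltW. Qed.

Lemma le_cap r s : r <= s -> cap r <= cap s.
Proof.
move=> rs; rewrite {2}/cap; have [h|h] := leP s%:E maxr; first by rewrite (le_trans (cap_le _)).
by rewrite -lee_fin -(maxr_fin h) cap_le_maxr.
Qed.

Lemma qball_cap x r : qball rho x (cap r) = qball rho x r.
Proof.
rewrite /cap; have [h|h] := leP r%:E maxr => //; have mE := maxr_fin h.
have all_lt y : rho x y < fine maxr.
  rewrite -lte_fin -mE; apply: (@le_lt_trans _ _ (diam rho)).
    by apply: ereal_sup_ubound; exists (x, y).
  have dfin : diam rho \is a fin_num.
    rewrite ge0_fin_numE ?(ltW diam_gt0)//.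
    rewrite ltNge leye_eq; apply/negP => /eqP dE; move: mE.
    by rewrite dE gt0_muley.
  rewrite -(fineK dfin) -EFinM lte_fin ltr_pMl// fine_gt0// diam_gt0/=.
  by rewrite -ge0_fin_numE ?(ltW diam_gt0).
apply/seteqP; split => y _ /=; rewrite /qball/=; last exact: all_lt.
by rewrite (lt_trans (all_lt y))// -lte_fin -mE.
Qed.

Lemma cap_lt2 r : 0 < r -> ((cap r)%:E < (2 * eta)%:E * diam rho)%E.
Proof.
move=> r0; have c0 := cap_gt0 r0; have h := cap_le_maxr r.
apply: (@lt_le_trans _ _ (2%:E * (cap r)%:E)%E).
  by rewrite -EFinM lte_fin ltr_pMl// ltr1n.
by rewrite EFinM -muleA lee_wpmul2l ?lee_fin.
Qed.

Section Decay.
Variables (m : nat) (Kt : m.-tuple X -> m.-tuple X -> R) (Cg : R -> R).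
Hypothesis m0 : (0 < m)%N.
Hypothesis pK : potential_kernel rho Kt Cg.
Variables (c delta c0 : R -> R) (eps : R) (C2 H : R -> R).
Hypothesis rd : reverse_doubling rho mu c delta.
Hypothesis adm : admissible c delta c0.
Hypothesis dec : decay rho mu Kt c0 eps C2 H.

Local Notation eta' := (H (2 * eta)).
Local Notation mball := (ball_mass rho mu).

(** At capped radii [phi] is finite.  Since [cap r < 2 * eta * diam rho] holds
    strictly, the decay condition can be used with the parameter [2 * eta],
    whose associated range parameter is [H (2 * eta)]. *)
Definition phi_val (x : X) (r : R) : R := fine (phi rho Kt (c0 eta') x (cap r)).
Definition phi_mass (x : X) (r : R) : R := phi_val x r * mball x r ^+ m.

Let two_eta1 : 1 < 2 * eta. Proof. by move: eta1; lra. Qed.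
Let eta'_ge : 2 * eta <= eta'. Proof. by have [_ /(_ _ two_eta1)[]] := dec. Qed.
Let eta'1 : 1 < eta'. Proof. exact: lt_le_trans eta'_ge. Qed.

Let cap_le' r : ((cap r)%:E <= eta'%:E * diam rho)%E.
Proof.
apply: (le_trans (cap_le_maxr r)); rewrite lee_wpmul2r ?(ltW diam_gt0)// lee_fin.
by apply: le_trans eta'_ge; move: eta0; lra.
Qed.

Lemma phi_valE x r : 0 < r -> phi rho Kt (c0 eta') x (cap r) = (phi_val x r)%:E.
Proof.
move=> r0; rewrite /phi_val fineK// ge0_fin_numE.
  exact: (phi_lty hX m0 pK rd adm eta'1 _ (cap_gt0 r0) (cap_le' r)).
exact: (phi_ge0 hX m0 pK rd adm eta'1 _ (cap_gt0 r0) (cap_le' r)).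
Qed.

Lemma phi_val_ge0 x r : 0 <= phi_val x r.
Proof.
rewrite /phi_val; have [p|none] := pselect (exists p : X * m.-tuple X,
  [/\ qball rho x (cap r) p.1, forall i, qball rho x (cap r) (tnth p.2 i) &
        c0 eta' * cap r <= rho_pt rho p.1 p.2]).
  case: p => p ph; rewrite fine_ge0//.
  apply: (@le_trans _ _ (Kdiag Kt p.1 p.2)%:E); first by rewrite lee_fin (pk_ge0 pK).
  by apply: ereal_sup_ubound; exists p.
rewrite /phi (_ : [set _ | _ in _] = set0) ?ereal_sup0//.
apply/seteqP; split => // z [p ph _]; apply: none; by exists p.
Qed.

Lemma phi_mass_ge0 x r : 0 <= phi_mass x r.
Proof. by rewrite mulr_ge0 ?phi_val_ge0// exprn_ge0// fine_ge0. Qed.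

Lemma phi_mass_decay x' r' x r : 0 < r' -> 0 < r ->
  qball rho x' r' `<=` qball rho x r ->
  phi_mass x' r' <= C2 (2 * eta) * (cap r' / cap r) `^ eps * phi_mass x r.
Proof.
move=> r'0 r0 sub; have [eps0 /(_ _ two_eta1)[C20 _ h]] := dec.
have := h x' x _ _ (cap_gt0 r'0) (cap_gt0 r0) (cap_lt2 r'0) (cap_lt2 r0).
rewrite !qball_cap !phi_valE// !(mballE hX)// -!EFin_expe -!EFinM lee_fin.
by apply.
Qed.

Lemma C2_gt0 : 0 < C2 (2 * eta).
Proof. by have [_ /(_ _ two_eta1)[]] := dec. Qed.

Lemma phi_mass_monotone x' r' x r : 0 < r' -> r' <= r ->
  qball rho x' r' `<=` qball rho x r -> phi_mass x' r' <= C2 (2 * eta) * phi_mass x r.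
Proof.
move=> r'0 rr sub; have r0 := lt_le_trans r'0 rr.
apply: (le_trans (phi_mass_decay r'0 r0 sub)); rewrite ler_wpM2r ?phi_mass_ge0//.
rewrite ler_piMr ?(ltW C2_gt0)// -(pow1R eps) ge0_ler_powR ?nnegrE//.
- by have [/ltW] := dec.
- by rewrite divr_ge0// ltW// cap_gt0.
- by rewrite ler_pdivrMr ?cap_gt0// mul1r le_cap.
Qed.

Lemma phi_mass_geometric x r j : 0 < r -> (r%:E <= maxr)%E ->
  phi_mass x (r / 2 ^+ j) <= C2 (2 * eta) * (2 `^ (- eps)) ^+ j * phi_mass x r.
Proof.
move=> r0 rm; have rj0 : 0 < r / 2 ^+ j by rewrite divr_gt0// exprn_gt0.
have rjr : r / 2 ^+ j <= r by rewrite ler_pdivrMr ?exprn_gt0// ler_peMr ?(ltW r0)// exprn_ege1// ler1n.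
have rjm : ((r / 2 ^+ j)%:E <= maxr)%E by rewrite (le_trans _ rm)// lee_fin.
have := phi_mass_decay rj0 r0 (subset_qball (x := x) rjr).
rewrite !cap_id//.
have -> : r / 2 ^+ j / r = 2 ^- j by field; rewrite expf_neq0 ?gt_eqF.
have -> // : (2 ^- j) `^ eps = (2 `^ (- eps)) ^+ j :> R.
rewrite -exprVn -powR_mulrn ?invr_ge0// -powR_mulrn ?powR_ge0//.
by rewrite -powRrM mulrC powRrM; congr (_ `^ _); rewrite -powR_inv1// -powRrM mulN1r.
Qed.

End Decay.
End Scales.

(** * The weight condition on one ball *)

Section BallEstimate.
Context {R : realType} {d : measure_display} {X : measurableType d}.
Variables (rho : X -> X -> R) (mu : {measure set X -> \bar R}) (kappa L : R).
Hypothesis hX : homogeneous_type rho mu kappa L.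
Variable eta : R.
Hypothesis eta1 : 1 < eta.
Hypothesis X2 : exists x y : X, x <> y.
Variables (m : nat) (Kt : m.-tuple X -> m.-tuple X -> R) (Cg : R -> R).
Hypothesis m0 : (0 < m)%N.
Hypothesis pK : potential_kernel rho Kt Cg.
Variables (c delta c0 : R -> R) (eps : R) (C2 H : R -> R).
Hypothesis rd : reverse_doubling rho mu c delta.
Hypothesis adm : admissible c delta c0.
Hypothesis dec : decay rho mu Kt c0 eps C2 H.
Variables (p_ : 'I_m -> R) (q t s A : R) (u : X -> R) (v f : 'I_m -> X -> R).
Hypothesis p1 : forall i, 1 < p_ i.
Hypothesis t1 : 1 < t.
Hypothesis wv : forall i, weight (v i).
Hypothesis mf : forall i, measurable_fun [set: X] (f i).
Hypothesis wA : (weight_sup rho mu Kt eta (c0 eta) q t s p_ u v <= A%:E)%E.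

Local Notation eta' := (H (2 * eta)).
Local Notation mball := (ball_mass rho mu).
Local Notation lam := (phi_mass rho mu eta Kt c0 H).
Local Notation phid := (phi_val rho eta Kt c0 H).

(** The exponent dual to [t * p_i']; as [t > 1], it is smaller than [p_i]. *)
Definition aexp (i : 'I_m) : R := conj_exp (t * conj_exp (p_ i)).
Definition compar_kernel : R := kernel_const m kappa Cg (Num.min (c0 eta) (c0 eta')).

Let P i : R := t * conj_exp (p_ i).
Let P1 i : 1 < P i.
Proof. by have h := conj_exp_gt1 (p1 i); rewrite /P (lt_trans h)// ltr_pMl// (lt_trans ltr01). Qed.
Let P0 i : 0 < P i. Proof. exact: lt_trans (P1 i). Qed.

Lemma aexp_gt0 i : 0 < aexp i.
Proof. by rewrite (lt_trans ltr01)// conj_exp_gt1//; exact: P1. Qed.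

Lemma aexp_conj i : (P i)^-1 + (aexp i)^-1 = 1.
Proof. by rewrite /aexp conj_expV; [rewrite /P; ring|exact: P1]. Qed.

Let phiw y r : \bar R := phi rho Kt (c0 eta) y (cap rho eta r).

Let phiwE y r : 0 < r -> phiw y r = (fine (phiw y r))%:E.
Proof.
move=> r0; rewrite fineK// ge0_fin_numE.
  exact: (phi_lty hX m0 pK rd adm eta1 _ (cap_gt0 hX eta1 X2 r0) (cap_le_maxr hX eta1 X2 r)).
exact: (phi_ge0 hX m0 pK rd adm eta1 _ (cap_gt0 hX eta1 X2 r0) (cap_le_maxr hX eta1 X2 r)).
Qed.

Let phiw_ge0 y r : 0 < r -> 0 <= fine (phiw y r).
Proof.
move=> r0; rewrite fine_ge0//.
exact: (phi_ge0 hX m0 pK rd adm eta1 _ (cap_gt0 hX eta1 X2 r0) (cap_le_maxr hX eta1 X2 r)).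
Qed.

Let two_eta1 : 1 < 2 * eta. Proof. by move: eta1; lra. Qed.
Let eta'1 : 1 < eta'.
Proof. by have [_ /(_ _ two_eta1)[_ h _]] := dec; exact: lt_le_trans h. Qed.

Let amin0 : 0 < Num.min (c0 eta) (c0 eta').
Proof. by rewrite lt_min; have [-> _] := adm eta1; have [-> _] := adm eta'1. Qed.

Lemma compar_kernel_ge0 : 0 <= compar_kernel.
Proof. by apply: (kernel_const_ge0 hX m0 pK). Qed.

Lemma phid_le_phiw y r : 0 < r -> phid y r <= compar_kernel * fine (phiw y r).
Proof.
move=> r0; rewrite -lee_fin -(phi_valE hX eta1 X2 m0 pK rd adm dec)// EFinM -phiwE//.
apply: (phi_compar hX m0 pK rd adm eta1 (a := Num.min (c0 eta) (c0 eta'))) => //.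
- by rewrite ge_min lexx orbT.
- by rewrite ge_min lexx.
- exact: (cap_gt0 hX eta1 X2).
- exact: (cap_le_maxr hX eta1 X2).
Qed.

(** The weight condition holds at all radii, as capping does not change the
    ball. *)
Lemma weight_functional_le y r : 0 < r ->
  (phiw y r * mu (qball rho y r) `^ (q^-1 + \sum_(i < m) (conj_exp (p_ i))^-1) *
   average mu (fun x => (u x `^ s)%:E) (qball rho y r) `^ s^-1 *
   \prod_(i < m) average mu (fun x => ((v i x `^ P i)%:E)^-1) (qball rho y r) `^ (P i)^-1
   <= A%:E)%E.
Proof.
move=> r0; apply: le_trans wA; apply: ereal_sup_ubound.
exists (y, cap rho eta r) => /=.
  by split; [exact: (cap_gt0 hX eta1 X2)|exact: (cap_le_maxr hX eta1 X2)].
by rewrite /weight_functional /= (qball_cap hX eta1 X2).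
Qed.

Let V i (B : set X) : \bar R := average mu (fun x => ((v i x `^ P i)%:E)^-1)%E B.

Lemma average_ge0 (g : X -> \bar R) y r : 0 < r -> (forall x, 0 <= g x)%E ->
  (0 <= average mu g (qball rho y r))%E.
Proof.
move=> r0 g0; apply: mule_ge0; first exact: integral_ge0.
by rewrite inve_ge0.
Qed.

Lemma averageE (g : X -> \bar R) y r : 0 < r ->
  (\int[mu]_(x in qball rho y r) g x =
   (mball y r)%:E * average mu g (qball rho y r))%E.
Proof.
move=> r0; rewrite /average (mballE hX)// inver gt_eqF ?(mball_gt0 hX)//.
rewrite muleCA -EFinM divff ?mule1// gt_eqF// (mball_gt0 hX)//.
Qed.

(** Where the average of [v i ^ (- t p')] is finite, it controls the average of
    [f i] by that of [(f i * v i) ^ a], for an exponent [a < p]. *)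
Lemma average_hoelder i y r : 0 < r -> (V i (qball rho y r) < +oo)%E ->
  (\int[mu]_(x in qball rho y r) ((`|f i x| * v i x) `^ aexp i)%:E < +oo)%E ->
  (\int[mu]_(x in qball rho y r) (`|f i x|)%:E <=
   (mball y r * (fine (V i (qball rho y r)) `^ (P i)^-1 *
     (fine (\int[mu]_(x in qball rho y r) ((`|f i x| * v i x) `^ aexp i)%:E)%E / mball y r)
       `^ (aexp i)^-1))%:E)%E.
Proof.
move=> r0 Vy Gy; set B := qball rho y r in Vy Gy *.
have M0 := mball_gt0 hX y r0; set M := mball y r in M0 *.
have [mv v0] := wv i.
have V0 : (0 <= V i B)%E.
  by apply: average_ge0 => // x; rewrite inve_ge0 lee_fin powR_ge0.
have Vfin : V i B = (fine (V i B))%:E by rewrite fineK// ge0_fin_numE.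
have G0 : (0 <= \int[mu]_(x in B) ((`|f i x| * v i x) `^ aexp i)%:E)%E.
  by apply: integral_ge0 => x _; rewrite lee_fin powR_ge0.
set G := (\int[mu]_(x in B) ((`|f i x| * v i x) `^ aexp i)%:E)%E in Gy G0 *.
have Gfin : G = (fine G)%:E by rewrite fineK// ge0_fin_numE.
have VB : (\int[mu]_(x in B) ((v i x `^ P i)%:E)^-1 = M%:E * V i B)%E.
  exact: averageE.
have mB : measurable B by exact: (measurable_qball hX).
have := hoelder_weight (mu := mu) mB (mf i) mv v0 (P0 i) (aexp_gt0 i) (aexp_conj i).
rewrite VB Vfin -EFinM ltry => /(_ isT)/le_trans; apply.
rewrite -/G Gfin !poweR_EFin -EFinM lee_fin le_eqVlt; apply/orP; left; apply/eqP.
have fG0 : 0 <= fine G by rewrite fine_ge0.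
rewrite powRM ?fine_ge0 ?(ltW M0)//.
have e1 : fine G `^ (aexp i)^-1 = M `^ (aexp i)^-1 * (fine G / M) `^ (aexp i)^-1.
  rewrite -powRM ?divr_ge0 ?(ltW M0)//; congr powR.
  by rewrite mulrC divfK// gt_eqF.
have e2 : M `^ (P i)^-1 * M `^ (aexp i)^-1 = M.
  by rewrite -powRD ?aexp_conj ?powRr1 ?(ltW M0)// gt_eqF ?implybT.
by rewrite e1 -[X in _ = X * _]e2; ring.
Qed.

(** By [average_hoelder], [F i] is at most a power of the average of
    [v i ^ (- t p_i')], to be absorbed by the weight condition, times the
    average on the right.  The powers of the mass match because
    [1 / p_i + 1 / p_i' = 1].  If one factor of the weight condition vanishes,
    then so does the left-hand side; otherwise they are all finite. *)
Lemma ball_estimate y r (F : 'I_m -> R) : 0 < r -> (forall i, 0 <= F i) ->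
  (forall i, ((F i * mball y r)%:E <= \int[mu]_(x in qball rho y r) (`|f i x|)%:E)%E) ->
  (forall i, \int[mu]_(x in qball rho y r) ((`|f i x| * v i x) `^ aexp i)%:E < +oo)%E ->
  ((lam y r * \prod_(i < m) F i)%:E *
   average mu (fun x => (u x `^ s)%:E) (qball rho y r) `^ s^-1 *
   (mball y r `^ q^-1)%:E <=
   (compar_kernel * A * \prod_(i < m) (mball y r `^ (p_ i)^-1 *
     (fine (\int[mu]_(x in qball rho y r) ((`|f i x| * v i x) `^ aexp i)%:E)%E / mball y r)
       `^ (aexp i)^-1))%:E)%E.
Proof.
move=> r0 F0 FM Gy; set B := qball rho y r in FM Gy *.
have M0 := mball_gt0 hX y r0; set M := mball y r in M0 FM *.
pose g i := (fine (\int[mu]_(x in B) ((`|f i x| * v i x) `^ aexp i)%:E)%E / M) `^ (aexp i)^-1.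
have g0 i : 0 <= g i by rewrite powR_ge0.
have w := weight_functional_le y r0.
rewrite -/B (mballE hX y r0) -/M phiwE// in w.
set U := (average mu (fun x => (u x `^ s)%:E)%E B `^ s^-1)%E in w *.
have U0 : (0 <= U)%E by rewrite poweR_ge0.
set E := q^-1 + _ in w.
have V0 i : (0 <= V i B)%E.
  by apply: average_ge0 => // x; rewrite inve_ge0 lee_fin powR_ge0.
have A0 : 0 <= A.
  rewrite -lee_fin (le_trans _ w)// !mule_ge0//.
  - by rewrite lee_fin phiw_ge0.
  - by rewrite lee_fin powR_ge0.
  - by apply: prode_ge0 => i _; rewrite poweR_ge0.
have rhs0 : (0 <= (compar_kernel * A * \prod_(i < m) (M `^ (p_ i)^-1 * g i))%:E)%E.
  rewrite lee_fin; apply: mulr_ge0; first by rewrite mulr_ge0// compar_kernel_ge0.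
  by apply: prodr_ge0 => i _; rewrite mulr_ge0 ?powR_ge0.
have lamle : lam y r <= compar_kernel * fine (phiw y r) * M ^+ m.
  by rewrite /phi_mass ler_wpM2r ?exprn_ge0 ?(ltW M0)// phid_le_phiw.
have lam0 : 0 <= lam y r by apply: phi_mass_ge0; exact: pK.
have [phi00|phin0] := eqVneq (fine (phiw y r)) 0.
  have -> : lam y r = 0.
    by apply/eqP; rewrite eq_le lam0 andbT (le_trans lamle)// phi00 mulr0 mul0r.
  by rewrite mul0r !mul0e.
have phip : 0 < fine (phiw y r) by rewrite lt_neqAle eq_sym phin0 phiw_ge0.
have [[i Fi0]|Fn0] := pselect (exists i, F i = 0).
  by rewrite (bigD1 i)//= Fi0 mul0r mulr0 !mul0e.
have Fp i : 0 < F i.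
  by rewrite lt_neqAle F0 andbT eq_sym; apply/eqP => Fi; apply: Fn0; exists i.
have [U00|Un0] := eqVneq U 0%E; first by rewrite U00 mule0 mul0e.
have Up : (0 < U)%E by rewrite lt0e Un0 U0.
have Vle i : (V i B < +oo)%E -> F i <= fine (V i B) `^ (P i)^-1 * g i.
  move=> Vy; have := le_trans (FM i) (average_hoelder r0 Vy (Gy i)).
  by rewrite lee_fin mulrC ler_pM2l.
have Vp i : (0 < V i B `^ (P i)^-1)%E.
  apply: poweR_gt0; rewrite lt0e V0 andbT; apply/eqP => V00.
  have := Vle i; rewrite V00 => /(_ (ltry _)).
  by rewrite /= powR0 ?invr_neq0 ?gt_eqF// mul0r leNgt Fp.
have pV : (0 < \prod_(i < m) V i B `^ (P i)^-1)%E by apply: prode_gt0.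
have ME0 : (0 < (M `^ E)%:E)%E by rewrite lte_fin powR_gt0.
have phie : (0 < (fine (phiw y r))%:E)%E by rewrite lte_fin.
have Uy : (U < +oo)%E.
  rewrite ltNge leye_eq; apply/negP => /eqP Uy; move: w.
  by rewrite Uy gt0_muley ?mule_gt0// gt0_mulye// leye_eq.
have pVy : (\prod_(i < m) V i B `^ (P i)^-1 < +oo)%E.
  rewrite ltNge leye_eq; apply/negP => /eqP pVy; move: w; rewrite -/(V _ _).
  by rewrite pVy gt0_muley ?mule_gt0// leye_eq.
have Vy i : (V i B < +oo)%E.
  have := prode_lty_factor Vp pVy i; apply: lty_poweRy.
  by rewrite invr_neq0// gt_eqF.
have UE : U = (fine U)%:E by rewrite fineK// ge0_fin_numE.
have VE i : (V i B `^ (P i)^-1 = (fine (V i B) `^ (P i)^-1)%:E)%E.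
  by rewrite -poweR_EFin fineK// ge0_fin_numE.
move: w; rewrite UE [X in (_ * X <= _)%E](eq_bigr _ (fun i _ => VE i)) -EFin_prod.
rewrite -!EFinM !lee_fin => w.
have U'0 : 0 <= fine U by rewrite fine_ge0.
have ck0 := compar_kernel_ge0.
apply: (@le_trans _ _ (compar_kernel * fine (phiw y r) * M ^+ m *
   (\prod_(i < m) (fine (V i B) `^ (P i)^-1 * g i)) * fine U * M `^ q^-1)).
  rewrite ler_wpM2r ?powR_ge0// ler_wpM2r// ler_pM// ?prodr_ge0//.
  by apply: ler_prod => i _; rewrite F0 Vle.
rewrite big_split/= [in leRHS]big_split/=.
set pv := \prod_(i < m) _ `^ _ in w *; set pg := \prod_(i < m) g i.
have pg0 : 0 <= pg by apply: prodr_ge0.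
have -> : \prod_(i < m) M `^ (p_ i)^-1 = M `^ (\sum_(i < m) (p_ i)^-1).
  by rewrite powR_sum_exp.
have expE : M ^+ m * M `^ q^-1 = M `^ E * M `^ (\sum_(i < m) (p_ i)^-1).
  rewrite -powRD ?(gt_eqF M0) ?implybT// -powR_mulrn ?(ltW M0)//.
  rewrite -powRD ?(gt_eqF M0) ?implybT//; congr powR.
  rewrite /E -addrA -big_split/= addrC; congr (_ + _).
  rewrite (eq_bigr (fun=> 1)); first by rewrite sumr_const card_ord.
  by move=> i _; rewrite conj_expV// subrK.
have -> : compar_kernel * fine (phiw y r) * M ^+ m * (pv * pg) * fine U * M `^ q^-1 =
    compar_kernel * (fine (phiw y r) * (M ^+ m * M `^ q^-1) * fine U * pv) * pg by ring.
rewrite expE.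
have -> : compar_kernel * (fine (phiw y r) * (M `^ E * M `^ (\sum_(i < m) (p_ i)^-1)) * fine U * pv) * pg =
    compar_kernel * (fine (phiw y r) * M `^ E * fine U * pv) *
     (M `^ (\sum_(i < m) (p_ i)^-1) * pg) by ring.
rewrite ler_wpM2r ?mulr_ge0 ?powR_ge0//; exact: ler_wpM2l.
Qed.

End BallEstimate.

(** * The potential as a sum over scales *)

Section PotentialBound.
Context {R : realType} {d : measure_display} {X : measurableType d}.
Variables (rho : X -> X -> R) (mu : {measure set X -> \bar R}) (kappa L : R).
Hypothesis hX : homogeneous_type rho mu kappa L.
Variable eta : R.
Hypothesis eta1 : 1 < eta.
Hypothesis X2 : exists x y : X, x <> y.
Variables (m : nat) (Kt : m.-tuple X -> m.-tuple X -> R) (Cg : R -> R).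
Hypothesis m0 : (0 < m)%N.
Hypothesis pK : potential_kernel rho Kt Cg.
Variables (c delta c0 : R -> R) (eps : R) (C2 H : R -> R).
Hypothesis rd : reverse_doubling rho mu c delta.
Hypothesis adm : admissible c delta c0.
Hypothesis dec : decay rho mu Kt c0 eps C2 H.
Variable f : 'I_m -> X -> R.
Hypothesis mf : forall i, measurable_fun [set: X] (f i).

Local Notation eta' := (H (2 * eta)).
Local Notation phid := (phi_val rho eta Kt c0 H).

Lemma sigma_finite_mu : sigma_finite setT mu.
Proof.
have [x _] := X2; exists (fun n => qball rho x n.+1%:R).
  apply/esym/seteqP; split => // y _; exists (Num.bound (rho x y)) => //.
  rewrite /qball/= (lt_le_trans (archi_boundP _)) ?(rho_ge0 hX)//.
  by rewrite ler_nat.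
by move=> n; split; [exact: (measurable_qball hX)|apply: (mu_qball_lty hX)].
Qed.

(** Reverse doubling at a fixed centre excludes atoms. *)
Lemma mu_point x : mu [set x] = 0%E.
Proof.
apply/eqP/negPn/negP => mx0.
have [ce de h] := rd eta1.
set r := cap rho eta 1.
have r0 : 0 < r by exact: (cap_gt0 hX eta1 X2).
have rm : (r%:E <= eta%:E * diam rho)%E by exact: (cap_le_maxr hX eta1 X2).
have sub s : 0 < s -> [set x] `<=` qball rho x s.
  by move=> s0 _ ->; exact: (qball_center hX).
have mfin : mu [set x] = (fine (mu [set x]))%:E.
  rewrite fineK// ge0_fin_numE//; apply: le_lt_trans (mu_qball_lty hX x r0).
  by apply: le_measure; rewrite ?inE; [exact: (measurable_point hX)|
     exact: (measurable_qball hX)|exact: sub].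
set a := fine (mu [set x]) in mfin.
have a0 : 0 < a by rewrite -lte_fin -mfin lt0e mx0 measure_ge0.
have B0 := mball_gt0 hX x r0.
set B := ball_mass rho mu x r in B0.
set de' := delta eta in de h; set ce' := c eta in ce h.
(* with this ratio of the radii, the ball of radius [r] would have mass at least [B + ce' * a] *)
pose s := (B / (ce' * a) + 1) `^ de'^-1.
have s1 : 1 <= s.
  rewrite -(pow1R de'^-1) ge0_ler_powR ?nnegrE ?invr_ge0 ?(ltW de)//.
    by rewrite addr_ge0// divr_ge0 ?mulr_ge0 ?ltW.
  by rewrite lerDr divr_ge0 ?mulr_ge0 ?ltW.
have s0 : 0 < s by rewrite (lt_le_trans ltr01).
have rs0 : 0 < r / s by rewrite divr_gt0.
have rsr : r / s <= r by rewrite ler_pdivrMr// ler_peMr// ltW.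
have rsm : ((r / s)%:E <= eta%:E * diam rho)%E by rewrite (le_trans _ rm)// lee_fin.
have := h x x r (r / s) r0 rs0 rm rsm (subset_qball rsr).
have aB : a <= ball_mass rho mu x (r / s).
  rewrite -lee_fin -(mballE hX)// -mfin; apply: le_measure; rewrite ?inE;
    [exact: (measurable_point hX)|exact: (measurable_qball hX)|exact: sub].
have Bs0 := mball_gt0 hX x rs0.
rewrite !(mballE hX)// inver gt_eqF// -EFinM lee_fin -/B.
have -> : r / (r / s) = s by field; rewrite !gt_eqF.
rewrite /s -powRrM mulVf ?gt_eqF// powRr1; last first.
  by rewrite addr_ge0// divr_ge0 ?mulr_ge0 ?ltW.
rewrite ler_pdivlMr// => h2.
have : ce' * (B / (ce' * a) + 1) * a <= B.
  by apply: le_trans h2; rewrite ler_wpM2l// mulr_ge0 ?addr_ge0 ?divr_ge0 ?mulr_ge0 ?ltW.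
have -> : ce' * (B / (ce' * a) + 1) * a = B + ce' * a by field; rewrite !gt_eqF.
by rewrite gerDl leNgt mulr_gt0.
Qed.

Definition top_radius (n : nat) : R := cap rho eta (2 ^+ n).

(** With [n.*2.+1] scales from [top_radius n <= 2 ^+ n] down, the last radius is
    at most [2 ^- n], so that every scale is reached as [n] grows. *)
Definition potential_sum (n : nat) (x : X) : \bar R :=
  (\sum_(k < n.*2.+1) (phid x (dyadic_radius (top_radius n) k))%:E *
    \prod_(i < m) \int[mu]_(y in qball rho x (dyadic_radius (top_radius n) k))
      (`|f i y|)%:E)%E.

(** The constant [2^-1] is the ratio of consecutive radii: some [y_i] is at
    distance at least half the radius of the scale of [y]. *)
Definition scale_const : R := kernel_const m kappa Cg (Num.min (c0 eta') 2^-1).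

Lemma top_radius_gt0 n : 0 < top_radius n.
Proof. by apply: (cap_gt0 hX eta1 X2); exact: exprn_gt0. Qed.

Let two_eta1 : 1 < 2 * eta. Proof. by move: eta1; lra. Qed.
Let eta'_ge : 2 * eta <= eta'. Proof. by have [_ /(_ _ two_eta1)[]] := dec. Qed.
Let eta'1 : 1 < eta'. Proof. exact: lt_le_trans eta'_ge. Qed.
Let a0 : 0 < Num.min (c0 eta') 2^-1.
Proof. by rewrite lt_min; have [-> _] := adm eta'1; rewrite invr_gt0 ltr0n. Qed.

Lemma scale_const_ge0 : 0 <= scale_const.
Proof. exact: (kernel_const_ge0 hX m0 pK). Qed.

(** The scale [k] is the first one for which the distance from [x] to some [y_i]
    is at least half of the radius; all the [y_i] are then in the ball, and the pair is one
    of those in the definition of [phi]. *)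
Lemma kernel_scale x (y : m.-tuple X) : y <> nseq_tuple m x ->
  exists n0, forall n, (n0 <= n)%N -> exists2 k, (k < n.*2.+1)%N &
    in_ball rho x (dyadic_radius (top_radius n) k) y /\
    Kdiag Kt x y <= scale_const * phid x (dyadic_radius (top_radius n) k).
Proof.
move=> yx.
have [i0 yi0] : exists i, tnth y i <> x.
  apply/not_existsP => h; apply: yx; apply: eq_from_tnth => i.
  rewrite [RHS](tnth_nth x)/= nth_nseq ltn_ord.
  by have := h i => /contrapT.
have r0 : 0 < rho x (tnth y i0).
  rewrite lt_neqAle (rho_ge0 hX) andbT eq_sym; apply/eqP => /(rho_eq0 hX) e.
  exact/yi0/esym.
pose n1 := \max_(i < m) Num.bound (rho x (tnth y i)).
pose n2 := Num.bound (rho x (tnth y i0))^-1.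
exists (maxn n1 n2) => n; rewrite geq_max => /andP[n1n n2n].
set r := dyadic_radius (top_radius n).
have top i : rho x (tnth y i) < top_radius n.
  suff : qball rho x (2 ^+ n) (tnth y i) by rewrite -(qball_cap hX eta1 X2).
  rewrite /qball/= (lt_le_trans (archi_boundP _)) ?(rho_ge0 hX)//.
  rewrite -natrX ler_nat (leq_trans _ (ltnW (ltn_expl n (ltnSn 1))))//.
  by rewrite (leq_trans _ n1n)// (leq_bigmax i).
have ex2n : [exists i, r n.*2.+1 <= rho x (tnth y i)].
  apply/existsP; exists i0.
  apply: (@le_trans _ _ (2 ^- n)).
    rewrite /r /dyadic_radius ler_pdivrMr ?exprn_gt0//.
    apply: (le_trans (cap_le hX eta1 X2 _)).
    rewrite -addnn -addnS exprD mulrA mulVf ?expf_neq0// mul1r.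
    by rewrite ler_weXn2l ?ler1n.
  rewrite -[leRHS]invrK lef_pV2 ?posrE ?exprn_gt0 ?invr_gt0//.
  rewrite (le_trans (ltW (archi_boundP _))) ?invr_ge0 ?(ltW r0)//.
  by rewrite -natrX ler_nat (leq_trans n2n)// ltnW// ltn_expl.
have ex : exists k, [exists i, r k.+1 <= rho x (tnth y i)] by exists n.*2.
case: (ex_minnP ex) => k /existsP[i ki] kmin.
have kn : (k < n.*2.+1)%N by rewrite ltnS kmin.
have yk : in_ball rho x (r k) y.
  move=> j; rewrite /qball/=; case: k ki kmin kn => [|k] ki kmin kn.
    by rewrite /r /dyadic_radius expr0 divr1 top.
  rewrite ltNge; apply/negP => kj.
  have : (k.+1 <= k)%N by apply: kmin; apply/existsP; exists j.
  by rewrite ltnn.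
exists k => //; split => //.
have rk0 : 0 < r k by rewrite radius_gt0// top_radius_gt0.
have rkm : ((r k)%:E <= eta%:E * diam rho)%E.
  apply: (@le_trans _ _ (top_radius n)%:E); last exact: (cap_le_maxr hX eta1 X2).
  by rewrite lee_fin radius_le// top_radius_gt0.
have rkm' : ((r k)%:E <= eta'%:E * diam rho)%E.
  apply: (le_trans rkm); rewrite lee_wpmul2r ?(ltW (diam_gt0 hX X2))// lee_fin.
  by apply: le_trans eta'_ge; move: eta1; lra.
rewrite -lee_fin EFinM -(phi_valE hX eta1 X2 m0 pK rd adm dec)// cap_id//.
apply: (phi_ub hX m0 pK rd adm eta'1 a0) => //.
- by rewrite ge_min lexx.
- exact: (qball_center hX).
- apply: le_trans (le_rho_pt hX x y i); apply: le_trans ki.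
  have -> : r k.+1 = 2^-1 * r k by rewrite /r /dyadic_radius exprS; field; rewrite expf_neq0.
  by rewrite ler_wpM2r ?(ltW rk0)// ge_min lexx orbT.
Qed.

Let pv0 x r : 0 <= phid x r. Proof. by apply: phi_val_ge0; exact: pK. Qed.

(** At every [y] the integrand is eventually dominated by the terms of the sum,
    and Fatou's lemma applies.  The diagonal is negligible by [mu_point]. *)
Lemma potential_op_le x :
  (`|potential_op mu Kt f x| <=
   2%:E * limn_einf (fun n => scale_const%:E * potential_sum n x))%E.
Proof.
have [pm [pmE pmI]] := prod_measureP m sigma_finite_mu.
rewrite /potential_op -pmE.
pose r n k := dyadic_radius (top_radius n) k.
pose gk n k (i : 'I_m) y : \bar R := (`|f i y| * \1_(qball rho x (r n k)) y)%:E.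
pose Cx := `|\prod_(i < m) f i x * Kdiag Kt x (nseq_tuple m x)|.
pose dg (i : 'I_m) y : \bar R := (\1_[set x] y)%:E.
(* the last term takes care of the diagonal; its integral is zero *)
pose g n (y : m.-tuple X) : \bar R :=
  (scale_const%:E * (\sum_(k < n.*2.+1) (phid x (r n k))%:E * \prod_(i < m) gk n k i (tnth y i))
   + Cx%:E * \prod_(i < m) dg i (tnth y i))%E.
have mgk n k i : measurable_fun [set: X] (gk n k i).
  apply/measurable_EFinP; apply: measurable_funM.
    exact: measurableT_comp.
  by apply: measurable_indic; exact: (measurable_qball hX).
have gk0 n k i y : (0 <= gk n k i y)%E by rewrite lee_fin mulr_ge0.
have mdg i : measurable_fun [set: X] (dg i).
  apply/measurable_EFinP; apply: measurable_indic; exact: (measurable_point hX).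
have dg0 i y : (0 <= dg i y)%E by rewrite lee_fin.
have sc0 : (0 <= scale_const%:E)%E by rewrite lee_fin scale_const_ge0.
have ph0 n k : (0 <= (phid x (r n k))%:E)%E by rewrite lee_fin.
have Cx0 : (0 <= Cx%:E)%E by rewrite lee_fin normr_ge0.
have pdg (y : m.-tuple X) : (0 <= \prod_(i < m) dg i (tnth y i))%E by apply: prode_ge0.
have pg0 n k y : (0 <= \prod_(i < m) gk n k i (tnth y i))%E by apply: prode_ge0.
have mS n : measurable_fun [set: m.-tuple X] (fun y : m.-tuple X =>
    \sum_(k < n.*2.+1) (phid x (r n k))%:E * \prod_(i < m) gk n k i (tnth y i))%E.
  apply: emeasurable_sum => k; apply: measurable_funeM; exact: measurable_prod_tnth.
have S0 n (y : m.-tuple X) : (0 <= \sum_(k < n.*2.+1) (phid x (r n k))%:E *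
    \prod_(i < m) gk n k i (tnth y i))%E.
  by apply: sume_ge0 => k _; exact: mule_ge0.
have mg n : measurable_fun [set: m.-tuple X] (g n).
  by apply: emeasurable_funD; apply: measurable_funeM => //; exact: measurable_prod_tnth.
have g0 n y : (0 <= g n y)%E.
  by rewrite adde_ge0// mule_ge0.
have gI n : (\int[pm]_y g n y = scale_const%:E * potential_sum n x)%E.
  rewrite ge0_integralD//; last 4 first.
  - by move=> y _; rewrite mule_ge0.
  - exact: measurable_funeM.
  - by move=> y _; rewrite mule_ge0.
  - by apply: measurable_funeM; exact: (measurable_prod_tnth mdg).
  rewrite ge0_integralZl// [X in (_ + X)%E](_ : _ = 0%E) ?adde0; last first.
    rewrite ge0_integralZl//; last exact: (measurable_prod_tnth mdg).
    rewrite pmI// (bigD1 (Ordinal m0))//= integral_indic ?setIT//; last exact: (measurable_point hX).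
    by rewrite mu_point mul0e mule0.
  congr (_ * _)%E; rewrite ge0_integral_sum//; last 2 first.
  - by move=> k; apply: measurable_funeM; exact: (measurable_prod_tnth (mgk n k)).
  - by move=> k y _; rewrite mule_ge0.
  apply: eq_bigr => k _; rewrite ge0_integralZl//; last exact: (measurable_prod_tnth (mgk n k)).
  rewrite pmI//; congr (_ * _)%E; apply: eq_bigr => i _.
  by rewrite -(integral_indicM mu _ (fun y => `|f i y|)).
apply: (@le_trans _ _ (2%:E * \int[pm]_y limn_einf (g^~ y))%E); last first.
  rewrite lee_wpmul2l ?lee_fin//; apply: le_trans (fatou _ _ _ _) _ => //.
  by under eq_fun do rewrite gI.
apply: abse_integral_dominated => y.
have [->|yx] := eqVneq y (nseq_tuple m x).
  apply: (@le_limn_einf _ _ _ 0%N) => n _; apply: (@le_trans _ _ (Cx%:E *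
      \prod_(i < m) dg i (tnth (nseq_tuple m x) i))%E).
    have dg1 : (\prod_(i < m) dg i (tnth (nseq_tuple m x) i) = 1)%E.
      rewrite big1// => i _; rewrite /dg indicE mem_set//=.
      by rewrite (tnth_nth x)/= nth_nseq ltn_ord.
    rewrite dg1 mule1 /= lee_fin /Cx le_eqVlt; apply/orP; left; apply/eqP.
    congr (`| _ * _|); apply: eq_bigr => i _.
    by rewrite (tnth_nth x)/= nth_nseq ltn_ord.
  by rewrite leeDr// mule_ge0.
have [n0 h] := kernel_scale (elimN eqP yx).
apply: (le_limn_einf (n0 := n0)) => n /h[k kn [yk Kle]].
apply: (@le_trans _ _ (scale_const%:E * (\sum_(k < n.*2.+1) (phid x (r n k))%:E *
   \prod_(i < m) gk n k i (tnth y i)))%E); last first.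
  by rewrite leeDl// mule_ge0.
rewrite (bigD1 (Ordinal kn))//= ge0_muleDr//; last 2 first.
- exact: mule_ge0.
- by apply: sume_ge0 => j _; exact: mule_ge0.
rewrite -[leLHS]adde0 leeD//; last first.
  by rewrite mule_ge0//; apply: sume_ge0 => j _; exact: mule_ge0.
have -> : (\prod_(i < m) gk n k i (tnth y i) = (\prod_(i < m) `|f i (tnth y i)|)%:E)%E.
  rewrite EFin_prod; apply: eq_bigr => i _; rewrite /gk indicE mem_set ?mulr1//.
rewrite -!EFinM lee_fin normrM mulrA [leLHS]mulrC normr_prod.
apply: ler_wpM2r; first exact: prodr_ge0.
rewrite ger0_norm//; exact: (pk_ge0 pK).
Qed.

End PotentialBound.

(** * Norm bounds for finitely many scales, and their limit *)

(** The factor by which the norm of a sparse sum exceeds the constant of its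
    local estimate, for each of the two ranges of [q]. *)
Definition norm_const {R : realType} (m : nat) (kappa L q t : R) : R :=
  if q <= 1 then m%:R `^ q^-1
  else m.+1%:R * dual_const kappa L q t `^ (conj_exp q)^-1.

Section ScaleBound.
Context {R : realType} {d : measure_display} {X : measurableType d}.
Variables (rho : X -> X -> R) (mu : {measure set X -> \bar R}) (kappa L : R).
Hypothesis hX : homogeneous_type rho mu kappa L.
Variable eta : R.
Hypothesis eta1 : 1 < eta.
Hypothesis X2 : exists x y : X, x <> y.
Variables (m : nat) (Kt : m.-tuple X -> m.-tuple X -> R) (Cg : R -> R).
Hypothesis m0 : (0 < m)%N.
Hypothesis pK : potential_kernel rho Kt Cg.
Variables (c delta c0 : R -> R) (eps : R) (C2 H : R -> R).
Hypothesis rd : reverse_doubling rho mu c delta.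
Hypothesis adm : admissible c delta c0.
Hypothesis dec : decay rho mu Kt c0 eps C2 H.
Variables (p_ : 'I_m -> R) (q t s A : R) (u : X -> R) (v f : 'I_m -> X -> R).
Hypothesis p1 : forall i, 1 < p_ i.
Hypothesis q0 : 0 < q.
Hypothesis t1 : 1 < t.
Hypothesis wu : weight u.
Hypothesis wv : forall i, weight (v i).
Hypothesis mf : forall i, measurable_fun [set: X] (f i).
Hypothesis wA : (weight_sup rho mu Kt eta (c0 eta) q t s p_ u v <= A%:E)%E.

Hypothesis A0 : 0 <= A.
Hypothesis sE : s = if q <= 1 then q else q * t.
Hypothesis sum_p : q^-1 <= \sum_(i < m) (p_ i)^-1.

Let g i x := `|f i x| * v i x.
Hypothesis gy : forall i, (\int[mu]_x (g i x `^ p_ i)%:E < +oo)%E.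

Local Notation eta' := (H (2 * eta)).
Local Notation mball := (ball_mass rho mu).
Local Notation lam := (phi_mass rho mu eta Kt c0 H).
Local Notation phid := (phi_val rho eta Kt c0 H).
Local Notation top_radius := (top_radius rho eta).
Local Notation psum := (potential_sum rho mu eta Kt c0 H f).
Local Notation D := (dil kappa).
Local Notation a_ := (aexp p_ t).
Local Notation Kw := (compar_kernel kappa eta m Cg c0 H).
Local Notation Cd := (C2 (2 * eta)).
Local Notation Cs := (domination_const m kappa L Cd (2 `^ (- eps))).

Definition lp_mass i : R := fine (\int[mu]_x (g i x `^ p_ i)%:E)%E.
Definition exp_ratio i : R := p_ i / a_ i.

Definition scale_bound : R := Cs * (Kw * A * norm_const m kappa L q t *
  \prod_(i < m) (carleson_const kappa L (exp_ratio i) * lp_mass i) `^ (p_ i)^-1).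

Let mu_ : measurable_fun [set: X] u. Proof. by case: wu. Qed.
Let u0 x : 0 <= u x. Proof. by case: wu. Qed.
Let g0 i x : 0 <= g i x. Proof. by have [_ v0] := wv i; rewrite mulr_ge0. Qed.
Let mg i : measurable_fun [set: X] (g i).
Proof. by have [mv _] := wv i; apply: measurable_funM => //; exact: measurableT_comp. Qed.
Let p0 i : 0 < p_ i. Proof. exact: lt_trans (p1 i). Qed.
Let a0 i : 0 < a_ i. Proof. exact: aexp_gt0. Qed.

Lemma exp_ratio_gt1 i : 1 < exp_ratio i.
Proof.
rewrite /exp_ratio; have c1 := conj_exp_gt1 (p1 i).
have tc1 : 1 < t * conj_exp (p_ i) by rewrite (lt_trans c1)// ltr_pMl// (lt_trans ltr01).
rewrite -[a_ i]invrK ltr_pdivlMr ?invr_gt0// mul1r.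
rewrite /aexp conj_expV// -[p_ i in ltRHS]invrK ltf_pV2 ?posrE ?invr_gt0//; last first.
  by rewrite subr_gt0 invf_lt1// (lt_trans ltr01).
rewrite ltrBrDl -ltrBrDr -conj_expV// ltf_pV2 ?posrE ?(lt_trans ltr01 tc1) ?(lt_trans ltr01 c1)//.
by rewrite ltr_pMl// (lt_trans ltr01).
Qed.

Let mga i : measurable_fun [set: X] (fun x => g i x `^ a_ i).
Proof. exact: measurable_powR_fun. Qed.

Let gaE i x : (g i x `^ a_ i) `^ exp_ratio i = g i x `^ p_ i.
Proof. by rewrite -powRrM mulrC divfK// gt_eqF. Qed.

Lemma lp_massE i : (\int[mu]_x (g i x `^ p_ i)%:E = (lp_mass i)%:E)%E.
Proof.
rewrite fineK// ge0_fin_numE//; apply: integral_ge0 => x _.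
by rewrite lee_fin powR_ge0.
Qed.

Lemma lp_mass_ge0 i : 0 <= lp_mass i.
Proof. by rewrite fine_ge0// integral_ge0// => x _; rewrite lee_fin powR_ge0. Qed.

Let L_ge0 : 0 <= L.
Proof. by have [x _] := X2; rewrite (le_trans ler01)// (doubling_ge1 hX x). Qed.

Let theta_lt1 : 2 `^ (- eps) < 1 :> R.
Proof.
have eps0 : 0 < eps by have [] := dec.
by rewrite powRN invf_lt1 ?powR_gt0// -[ltLHS](pow1R eps) gt0_ltr_powR ?nnegrE// ltr1n.
Qed.

Let Cd0 : 0 <= Cd. Proof. exact/ltW/(C2_gt0 eta1 dec). Qed.

Let Cs0 : 0 <= Cs.
Proof.
rewrite /domination_const /level_ratio /weak_factor /compar_const.
by rewrite !mulr_ge0 ?exprn_ge0 ?mulr_ge0 ?exprn_ge0 ?invr_ge0 ?subr_ge0 ?(ltW theta_lt1).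
Qed.

Let KA0 : 0 <= Kw * A.
Proof. by rewrite mulr_ge0// (compar_kernel_ge0 hX eta1 m0 pK adm dec). Qed.

Let cM0 i : 0 <= carleson_const kappa L (exp_ratio i) * lp_mass i.
Proof. by rewrite mulr_ge0 ?lp_mass_ge0 ?carleson_const_ge0 ?exp_ratio_gt1. Qed.

Let nc0 : 0 <= norm_const m kappa L q t.
Proof. by rewrite /norm_const; case: ifP => _; rewrite ?mulr_ge0 ?powR_ge0. Qed.

Lemma scale_bound_ge0 : 0 <= scale_bound.
Proof.
apply: mulr_ge0 => //; apply: mulr_ge0; first exact: mulr_ge0.
by apply: prodr_ge0 => i _; exact: powR_ge0.
Qed.

(** Since [a < p], the [a]-th powers are integrable on balls. *)
Lemma integral_aexp_lty i y r : 0 < r ->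
  (\int[mu]_(x in qball rho y r) (g i x `^ a_ i)%:E < +oo)%E.
Proof.
move=> r0; have mB : measurable (qball rho y r) by exact: (measurable_qball hX).
apply: (@le_lt_trans _ _ (\int[mu]_(x in qball rho y r) (1 + (g i x `^ p_ i)%:E))%E).
  apply: le_integral_dominated_in => x _; first by rewrite lee_fin powR_ge0.
  rewrite -EFinD lee_fin -gaE.
  have [hx|hx] := leP (g i x `^ a_ i) 1; first by rewrite (le_trans hx)// lerDl powR_ge0.
  by rewrite (le_trans (le1r_powR (ltW hx) (ltW (exp_ratio_gt1 i))))// lerDr.
have mgp : measurable_fun [set: X] (fun x => (g i x `^ p_ i)%:E).
  by apply/measurable_EFinP; exact: measurable_powR_fun.
rewrite ge0_integralD//; last 2 first.
- by move=> x _; rewrite lee_fin powR_ge0.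
- exact: measurable_funTS.
rewrite integral_cst// mul1e lte_add_pinfty ?(mu_qball_lty hX)//.
apply: le_lt_trans (gy i); apply: ge0_subset_integral => // x _.
by rewrite lee_fin powR_ge0.
Qed.

Section OneScale.
Variables (x0 : X) (n : nat).
Local Notation Rt := (top_radius n).
Local Notation radius := (dyadic_radius Rt).
Local Notation dball := (scaled_ball rho Rt).
Local Notation window := (qball rho x0 (D * (D * Rt))).
Local Notation W0 := (scaled_ball rho Rt D (x0, 0%N)).

Let Rt0 : 0 < Rt. Proof. exact: (top_radius_gt0 hX eta1 X2). Qed.
Let D0 : 0 < D. Proof. exact: dil_gt0. Qed.
Let W0E : W0 = qball rho x0 (D * Rt).
Proof. by rewrite /scaled_ball /dyadic_radius /= expr0 divr1. Qed.
Let mW0 : measurable W0. Proof. exact: (measurable_scaled_ball hX). Qed.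

Let radius_sub x k : qball rho x0 Rt x -> qball rho x (radius k) `<=` W0.
Proof.
move=> xx; rewrite W0E; apply: (engulf hX (radius_le Rt0 k) xx).
by apply: (qball_center hX); exact: radius_gt0.
Qed.

Let radius_good k : ((radius k)%:E <= eta%:E * diam rho)%E.
Proof.
apply: (@le_trans _ _ Rt%:E); first by rewrite lee_fin radius_le.
exact: (cap_le_maxr hX eta1 X2).
Qed.

Let lam0 x r : 0 <= lam x r. Proof. by apply: phi_mass_ge0; exact: pK. Qed.
Let lam_mono x' r' x r : 0 < r' -> r' <= r ->
  qball rho x' r' `<=` qball rho x r -> lam x' r' <= Cd * lam x r.
Proof. exact: (phi_mass_monotone hX eta1 X2 m0 pK rd adm dec). Qed.

Let lam_dec x k j : lam x (radius (k + j)) <= Cd * (2 `^ (- eps)) ^+ j * lam x (radius k).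
Proof.
have -> : radius (k + j) = radius k / 2 ^+ j.
  by rewrite -(radiusD Rt k j); field; rewrite expf_neq0.
apply: (phi_mass_geometric hX eta1 X2 m0 pK rd adm dec) => //.
exact: radius_gt0.
Qed.

Section FiniteMasses.
Hypothesis fW : forall i, (\int[mu]_(x in W0) (`|f i x|)%:E < +oo)%E.

Let nu i : set X -> R := mass mu (fun x => (`|f i x|)%:E) W0.
Let mnf i : measurable_fun [set: X] (fun x => (`|f i x|)%:E).
Proof. by apply/measurable_EFinP; exact: measurableT_comp. Qed.

Let snu i : superadditive (nu i).
Proof. by apply: superadditive_mass => // x; rewrite lee_fin. Qed.

Let nu_top i B : measurable B -> nu i B <= nu i W0.
Proof.
move=> mB; rewrite -lee_fin -!mass_fin//.
rewrite setIid; apply: ge0_subset_integral => //; first exact: measurableI; exact: measurable_funTS.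
Qed.

Let nuE i B : measurable B -> ((nu i B)%:E <= \int[mu]_(x in B) (`|f i x|)%:E)%E.
Proof.
move=> mB; rewrite -mass_fin//.
apply: ge0_subset_integral => //; [exact: measurableI|exact: measurable_funTS].
Qed.

Lemma potential_sum_finite x : qball rho x0 Rt x ->
  psum n x = (\sum_(k < n.*2.+1) lam x (radius k) *
     avg_prod rho mu Rt nu 1 (x, k : nat))%:E.
Proof.
move=> xx; rewrite -sumEFin; apply: eq_bigr => k _.
have rk0 : 0 < radius k by exact: radius_gt0.
have M0 := mball_gt0 hX x rk0.
have nuk i : (\int[mu]_(y in qball rho x (radius k)) (`|f i y|)%:E)%E =
    (nu i (qball rho x (radius k)))%:E.
  rewrite -mass_fin//; last exact: (measurable_qball hX).
  by rewrite setIidl//; exact: radius_sub.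
rewrite (eq_bigr _ (fun i _ => nuk i)) -EFin_prod -EFinM; congr EFin.
rewrite /avg_prod /scaled_ball /= !mul1r prodf_div prodr_const card_ord /phi_mass.
by field; rewrite expf_neq0// gt_eqF.
Qed.

Local Notation cc := (fun b : X * nat => lam b.1 (D * radius b.2) * avg_prod rho mu Rt nu D b).
Let Xi i b := dmass rho mu kappa Rt b `^ (p_ i)^-1 *
  davg rho mu kappa Rt (fun x => g i x `^ a_ i) b `^ (a_ i)^-1.

Let cc_estimate b :
  ((cc b)%:E * (\int[mu]_(x in dball D b) (u x `^ s)%:E) `^ s^-1 <=
   (Kw * A * \prod_(i < m) Xi i b * dmass rho mu kappa Rt b `^ (s^-1 - q^-1))%:E)%E.
Proof.
have r0 : 0 < D * radius b.2 by rewrite mulr_gt0// radius_gt0.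
have M0 := mball_gt0 hX b.1 r0.
have nu0 i : 0 <= nu i (dball D b) by have [] := snu i.
have FM i : ((nu i (dball D b) / mball b.1 (D * radius b.2) * mball b.1 (D * radius b.2))%:E
    <= \int[mu]_(x in qball rho b.1 (D * radius b.2)) (`|f i x|)%:E)%E.
  by rewrite divfK ?gt_eqF//; apply: nuE; exact: (measurable_qball hX).
have F0 i : 0 <= nu i (dball D b) / mball b.1 (D * radius b.2).
  by rewrite divr_ge0// ltW.
have h := ball_estimate hX eta1 X2 m0 pK rd adm dec p1 t1 wv mf wA r0 F0 FM
  (fun i => integral_aexp_lty i b.1 r0).
set U := (\int[mu]_(x in dball D b) (u x `^ s)%:E)%E.
have U0 x : (0 <= (u x `^ s)%:E)%E by rewrite lee_fin powR_ge0.
have UE : U = ((dmass rho mu kappa Rt b)%:E * average mu (fun x => (u x `^ s)%:E) (dball D b))%E.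
  exact: (averageE hX).
have av0 : (0 <= average mu (fun x => (u x `^ s)%:E) (dball D b))%E.
  exact: (average_ge0 _ _ _ r0 U0).
rewrite UE poweRM//; last by rewrite lee_fin ltW.
rewrite poweR_EFin.
have {}M0 : 0 < dmass rho mu kappa Rt b by exact: M0.
have Ms0 : (0 <= (dmass rho mu kappa Rt b `^ (s^-1 - q^-1))%:E)%E by rewrite lee_fin powR_ge0.
rewrite EFinM; apply: le_trans (lee_wpmul2r Ms0 h).
rewrite -[X in (X <= _)%E]/((lam b.1 (D * radius b.2) * avg_prod rho mu Rt nu D b)%:E * _)%E.
rewrite le_eqVlt; apply/orP; left; apply/eqP; rewrite -muleA -EFinM -powRD.
  by rewrite addrC subrK -muleA [X in (_ * X)%E]muleC.
by rewrite (gt_eqF M0) implybT.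
Qed.

(** The sum over scales is dominated by a sparse sum.  Its coefficients satisfy
    the local estimate [cc_estimate], whose factors [Xi i] are summable by the
    Carleson embedding for [g i ^ a_i], since [p_i / a_i > 1]. *)
Lemma sparse_bound : exists Hn : X -> \bar R,
  [/\ measurable_fun [set: X] Hn, forall x, (0 <= Hn x)%E,
      forall x, qball rho x0 Rt x -> (psum n x <= Hn x)%E &
      (\int[mu]_x ((Hn x * (u x)%:E) `^ q) <= (scale_bound `^ q)%:E)%E].
Proof.
have [ss [sp ssN dom]] := sparse_domination hX Rt0 m0 snu nu_top lam0 Cd0
  (powR_ge0 _ _) theta_lt1 lam_mono lam_dec n.*2.
have Wy : (mu window < +oo)%E by rewrite (mu_qball_lty hX)// !mulr_gt0.
have cc0 b : 0 <= cc b by rewrite mulr_ge0// (avg_prod_ge0 hX).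
pose S := sparse_sum rho kappa Rt ss cc.
have S0 x : 0 <= S x by exact: sparse_sum_ge0.
have mS : measurable_fun [set: X] S by exact: (measurable_sparse_sum hX).
pose M i := (carleson_const kappa L (exp_ratio i) * lp_mass i) `^ (p_ i)^-1.
have M0 i : 0 <= M i by exact: powR_ge0.
have Xi0 i b : 0 <= Xi i b by rewrite mulr_ge0 ?powR_ge0.
have dav0 i b : 0 <= davg rho mu kappa Rt (fun x => g i x `^ a_ i) b.
  rewrite divr_ge0 ?(ltW (dmass_gt0 hX Rt0 b))// fine_ge0//.
  by rewrite integral_ge0// => x _; rewrite lee_fin powR_ge0.
have XM i : \sum_(b <- flatten ss) Xi i b `^ p_ i <= M i `^ p_ i.
  rewrite -powRrM mulVf ?gt_eqF// powRr1//.
  have := carleson hX Rt0 (measurable_qball hX _ _) Wy ssN sp (mga i)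
    (fun x => powR_ge0 _ _) (exp_ratio_gt1 i).
  under eq_integral do rewrite gaE.
  rewrite lp_massE -EFinM lee_fin. apply: le_trans.
  rewrite le_eqVlt; apply/orP; left; apply/eqP; apply: eq_bigr => b _.
  rewrite /Xi powRM ?powR_ge0// -!powRrM mulVf ?gt_eqF// powRr1 ?(ltW (dmass_gt0 hX Rt0 b))//.
  by rewrite [_^-1 * _]mulrC.
have prM : 0 <= \prod_(i < m) M i by rewrite prodr_ge0.
have Sle : (\int[mu]_x ((S x * u x) `^ q)%:E <=
    ((Kw * A * norm_const m kappa L q t * \prod_(i < m) M i) `^ q)%:E)%E.
  rewrite /norm_const; move: sE; have [q1 sq|q1 sq] := leP q 1.
    apply: (le_trans (sparse_norm_le1 hX p0 q0 sum_p mu_ u0 cc0 Xi0 M0 KA0 XM q1 _)).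
      move=> b _; have := cc_estimate b.
      rewrite sq subrr powRr0 mulr1 => h.
      have U0 : (0 <= \int[mu]_(x in dball D b) (u x `^ q)%:E)%E.
        by apply: integral_ge0 => x _; rewrite lee_fin powR_ge0.
      set U := (\int[mu]_(x in dball D b) _)%E in U0 h *.
      have -> : U = ((U `^ q^-1) `^ q)%E.
        by rewrite -poweRrM mulVf ?gt_eqF// poweRe1.
      rewrite -!poweR_EFin -poweRM ?lee_fin// ?poweR_ge0//.
      apply: gt0_ler_poweR h; rewrite ?ltW//.
      - by rewrite in_itv/= leey andbT mule_ge0 ?lee_fin// poweR_ge0.
      - by rewrite in_itv/= leey andbT lee_fin mulr_ge0 ?prodr_ge0.
    rewrite lee_fin [leRHS]powRM//; last by rewrite mulr_ge0// powR_ge0.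
    rewrite [X in _ <= X * _]powRM ?powR_ge0// -[in leRHS]powRrM mulVf ?gt_eqF//.
    by rewrite powRr1// mulrA.
  apply: (le_trans (sparse_norm_gt1 hX Rt0 (measurable_qball hX _ _) Wy
     ssN sp p0 q0 sum_p mu_ u0 cc0 Xi0 M0 KA0 XM q1 t1 _)).
    by move=> b _; have := cc_estimate b; rewrite sq.
  by rewrite !mulrA.
exists (fun x => (Cs * S x)%:E); split.
- by apply/measurable_EFinP; exact: measurable_funM.
- by move=> x; rewrite lee_fin mulr_ge0.
- move=> x xx; rewrite potential_sum_finite// lee_fin; exact: dom.
- apply: (@le_trans _ _ (\int[mu]_x ((Cs `^ q)%:E * ((S x * u x) `^ q)%:E))%E).
    apply: le_integral_dominated => x; first exact: poweR_ge0.
    rewrite -EFinM poweR_EFin -EFinM lee_fin -mulrA [leLHS]powRM//; exact: mulr_ge0.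
  rewrite ge0_integralZl ?lee_fin ?powR_ge0//; last 2 first.
  - by apply/measurable_EFinP; apply: measurable_powR_fun; exact: measurable_funM.
  - by move=> x _; rewrite lee_fin powR_ge0.
  apply: (le_trans (lee_wpmul2l _ Sle)); first by rewrite lee_fin powR_ge0.
  rewrite -EFinM lee_fin -powRM//; apply: mulr_ge0 => //; exact: mulr_ge0.
Qed.

End FiniteMasses.

Let psum_eq0 x : (forall k : nat, phid x (radius k) = 0) \/
  (exists j, forall k : nat, \int[mu]_(y in qball rho x (radius k)) (`|f j y|)%:E = 0)%E ->
  psum n x = 0%E.
Proof.
move=> h; rewrite /potential_sum big1// => k _; case: h => [->|[j fj]].
  by rewrite mul0e.
by rewrite (bigD1 j)//= fj mul0e mule0.
Qed.

(** The average of [v i ^ (- t p_i')] over the window is infinite, by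
    [average_hoelder].  So another factor of the weight condition vanishes: [phi]
    at the window, hence at all the smaller balls; or the average for some other
    [j], and then [f j = 0] almost everywhere; or the average of [u ^ s], and
    then the infinite bound [Hn] has norm zero, as [u = 0] almost everywhere on
    the window. *)
Lemma degenerate_bound i : (\int[mu]_(x in W0) (`|f i x|)%:E = +oo)%E ->
  exists Hn : X -> \bar R,
  [/\ measurable_fun [set: X] Hn, forall x, (0 <= Hn x)%E,
      forall x, qball rho x0 Rt x -> (psum n x <= Hn x)%E &
      (\int[mu]_x ((Hn x * (u x)%:E) `^ q) <= (scale_bound `^ q)%:E)%E].
Proof.
move=> fi; have r0 : 0 < D * Rt by exact: mulr_gt0.
have M0 := mball_gt0 hX x0 r0.
have zero : (forall x, qball rho x0 Rt x -> psum n x = 0%E) -> exists Hn : X -> \bar R,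
  [/\ measurable_fun [set: X] Hn, forall x, (0 <= Hn x)%E,
      forall x, qball rho x0 Rt x -> (psum n x <= Hn x)%E &
      (\int[mu]_x ((Hn x * (u x)%:E) `^ q) <= (scale_bound `^ q)%:E)%E].
  move=> h; exists (cst 0%E); split => //; first by move=> x /h ->.
  under eq_integral do rewrite mul0e poweR0r ?gt_eqF//.
  by rewrite integral0 lee_fin powR_ge0.
pose P i := t * conj_exp (p_ i).
have P0 j : 0 < P j.
  by rewrite /P mulr_gt0// (lt_trans ltr01)// conj_exp_gt1.
pose V j := average mu (fun x => ((v j x `^ P j)%:E)^-1)%E W0.
have V0 j : (0 <= V j)%E.
  by rewrite /V W0E; apply: average_ge0 => // x; rewrite inve_ge0 lee_fin powR_ge0.
have VH j : (V j < +oo)%E -> (\int[mu]_(x in W0) (`|f j x|)%:E <=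
    (mball x0 (D * Rt) * (fine (V j) `^ (P j)^-1 *
     (fine (\int[mu]_(x in W0) ((`|f j x| * v j x) `^ a_ j)%:E)%E / mball x0 (D * Rt)) `^ (a_ j)^-1))%:E)%E.
  move=> Vj; rewrite /V W0E in Vj *.
  by apply: (average_hoelder hX p1 t1 wv mf r0 Vj); exact: integral_aexp_lty.
have Vi : V i = +oo%E.
  by apply/eqP; rewrite -leye_eq leNgt; apply/negP => /VH; rewrite fi leye_eq.
have [phi0|phin0] := eqVneq (phi rho Kt (c0 eta) x0 (cap rho eta (D * Rt))) 0%E.
  apply: zero => x xx; apply: psum_eq0; left => k.
  have rk0 : 0 < radius k by exact: radius_gt0.
  have Mk0 := mball_gt0 hX x rk0.
  have top0 : lam x0 (D * Rt) = 0.
    apply/eqP; rewrite eq_le lam0 andbT /phi_mass.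
    rewrite mulr_le0_ge0 ?exprn_ge0 ?(ltW M0)//.
    apply: (le_trans (phid_le_phiw hX eta1 X2 m0 pK rd adm dec x0 r0)).
    by rewrite phi0 mulr0.
  have rkD : radius k <= D * Rt.
    by rewrite (le_trans (radius_le Rt0 k))// ler_peMl ?dil_ge1// ltW.
  have sub : qball rho x (radius k) `<=` qball rho x0 (D * Rt).
    by rewrite -W0E; exact: radius_sub.
  have := lam_mono rk0 rkD sub; rewrite top0 mulr0 => lam_le0.
  have /eqP : lam x (radius k) = 0 by apply/eqP; rewrite eq_le lam_le0 lam0.
  by rewrite /phi_mass mulf_eq0 expf_eq0 [mball _ _ == 0]gt_eqF// andbF orbF => /eqP.
have [[j Vj]|Vn0] := pselect (exists j, V j = 0%E).
  apply: zero => x xx; apply: psum_eq0; right; exists j => k.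
  have := VH j; rewrite Vj /= powR0 ?invr_neq0 ?gt_eqF// mul0r mulr0 => /(_ (ltry _)) fj.
  apply/eqP; rewrite eq_le integral_ge0// andbT (le_trans _ fj)//.
  apply: ge0_subset_integral => //; last exact: radius_sub.
  - exact: (measurable_qball hX).
  - by apply/measurable_EFinP/measurable_funTS; exact: measurableT_comp.
pose U := average mu (fun x => (u x `^ s)%:E) W0.
have us0 x : (0 <= (u x `^ s)%:E)%E by rewrite lee_fin powR_ge0.
have U_ge0 : (0 <= U)%E by rewrite /U W0E; exact: (average_ge0 _ _ _ r0).
have U0 : U = 0%E.
  apply/eqP/negPn/negP => Un0.
  have Vp j : (0 < V j `^ (P j)^-1)%E.
    by apply: poweR_gt0; rewrite lt0e V0 andbT; apply/eqP => Vj; apply: Vn0; exists j.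
  have : (phi rho Kt (c0 eta) x0 (cap rho eta (D * Rt)) *
      mu W0 `^ (q^-1 + \sum_(i < m) (conj_exp (p_ i))^-1) * U `^ s^-1 *
      \prod_(j < m) V j `^ (P j)^-1 <= A%:E)%E.
    by have := weight_functional_le hX eta1 X2 wA x0 r0; rewrite -W0E.
  rewrite [X in (_ * X <= _)%E](bigD1 i)//= Vi poweRyr ?invr_neq0 ?gt_eqF//.
  rewrite gt0_mulye; last by apply: prode_gt0 => j; exact: Vp.
  rewrite gt0_muley ?leye_eq//; apply: mule_gt0; last first.
    by apply: poweR_gt0; rewrite lt0e Un0 U_ge0.
  apply: mule_gt0.
    rewrite lt0e phin0/=.
    exact: (phi_ge0 hX m0 pK rd adm eta1 _ (cap_gt0 hX eta1 X2 r0) (cap_le_maxr hX eta1 X2 _)).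
  by apply: poweR_gt0; rewrite W0E; exact: (mu_qball_gt0 hX).
have us : (\int[mu]_(x in W0) `|(u x `^ s)%:E| = 0)%E.
  under eq_integral do rewrite gee0_abs//.
  by rewrite {1}W0E (averageE hX)// -W0E -/U U0 mule0.
have mus : measurable_fun W0 (fun x => (u x `^ s)%:E).
  by apply/measurable_EFinP/measurable_funTS; exact: measurable_powR_fun.
have /(ae_eq_integral_abs mu mW0 mus) u_ae := us.
exists (fun x => +oo * (\1_W0 x)%:E)%E; split.
- by apply: measurable_funeM; apply/measurable_EFinP; exact: measurable_indic.
- by move=> x; rewrite mule_ge0// lee_fin.
- move=> x xx; rewrite indicE mem_set ?mule1 ?leey//.
  have -> : W0 = qball rho x0 (D * Rt) := W0E.
  by apply: subset_qball xx; rewrite ler_peMl ?dil_ge1// ltW.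
- have mou : measurable_fun W0 (fun x => (+oo * (u x)%:E) `^ q)%E.
    apply: (measurableT_comp (measurable_poweR q)); apply: measurable_funTS.
    by apply: measurable_funeM; exact/measurable_EFinP.
  have ou0 : (\int[mu]_(x in W0) ((+oo * (u x)%:E) `^ q) = 0)%E.
    rewrite (ge0_ae_eq_integral mW0 mou (measurable_cst 0%E)) ?integral0//.
      by move=> x _; exact: poweR_ge0.
    apply: filterS u_ae => x /= h xW; have /eqP := h xW.
    rewrite eqe powR_eq0 => /andP[/eqP -> _].
    by rewrite mule0 poweR0r// gt_eqF.
  apply: (@le_trans _ _ 0%E); last by rewrite lee_fin powR_ge0.
  rewrite -ou0 [leRHS]integral_mkcond; apply: le_integral_dominated => x.
    exact: poweR_ge0.
  rewrite patchE indicE; case: (x \in W0); first by rewrite mule1.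
  by rewrite mule0 mul0e poweR0r// gt_eqF.
Qed.

Lemma scale_estimate : exists Hn : X -> \bar R,
  [/\ measurable_fun [set: X] Hn, forall x, (0 <= Hn x)%E,
      forall x, qball rho x0 Rt x -> (psum n x <= Hn x)%E &
      (\int[mu]_x ((Hn x * (u x)%:E) `^ q) <= (scale_bound `^ q)%:E)%E].
Proof.
have [fW|/existsNP[i fi]] := pselect (forall i, \int[mu]_(x in W0) (`|f i x|)%:E < +oo)%E.
  exact: sparse_bound.
by apply: (@degenerate_bound i); apply/eqP; rewrite -leye_eq leNgt; apply/negP.
Qed.

End OneScale.

Local Notation sc := (scale_const kappa eta m Cg c0 H).

(** The bounds of [scale_estimate] do not depend on [n], and every point lies in
    the balls of radius [top_radius n] for large [n]. *)
Lemma potential_bound :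
  (\int[mu]_x ((`|potential_op mu Kt f x| * (u x)%:E) `^ q) <=
   ((2 * sc * scale_bound) `^ q)%:E)%E.
Proof.
have [x0 _] := X2.
have /choice[Hn HnP] := scale_estimate x0.
have sc0 : 0 <= sc by exact: (scale_const_ge0 hX eta1 m0 pK adm dec).
have sb0 := scale_bound_ge0.
have c2_ge0 : (0 <= (2 * sc)%:E)%E by rewrite lee_fin mulr_ge0.
have mHn n : measurable_fun [set: X] (Hn n) by have [] := HnP n.
have Hn0 n x : (0 <= Hn n x * (u x)%:E)%E.
  by have [_ /(_ x) h _ _] := HnP n; rewrite mule_ge0 ?lee_fin.
have mHu n : measurable_fun [set: X] (fun x => Hn n x * (u x)%:E)%E.
  by apply: emeasurable_funM => //; exact/measurable_EFinP.
apply: (integral_le_of_eventually (g := fun n x => ((2 * sc)%:E * (Hn n x * (u x)%:E)) `^ q)%E).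
- by move=> x; exact: poweR_ge0.
- move=> n; apply: (measurableT_comp (measurable_poweR q)); exact: measurable_funeM.
- by move=> n x; exact: poweR_ge0.
- move=> x M M0 Mlt; set a := M `^ q^-1.
  have a_ge0 : 0 <= a by exact: powR_ge0.
  have aE : (a%:E `^ q)%E = M%:E.
    by rewrite poweR_EFin /a -powRrM mulVf ?powRr1// gt_eqF.
  have Tu0 : (0 <= `|potential_op mu Kt f x| * (u x)%:E)%E by rewrite mule_ge0 ?lee_fin.
  have up : 0 < u x.
    rewrite lt_neqAle u0 andbT eq_sym; apply/eqP => ux; move: Mlt.
    by rewrite ux mule0 poweR0r ?gt_eqF// lte_fin ltNge M0.
  have alt : (a%:E < `|potential_op mu Kt f x| * (u x)%:E)%E.
    rewrite ltNge; apply/negP => le; move: Mlt; rewrite ltNge -aE => /negP; apply.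
    by apply: gt0_ler_poweR; rewrite ?(ltW q0)// in_itv/= leey andbT ?lee_fin.
  set l := limn_einf (fun n => sc%:E * psum n x)%E.
  have Tl : (`|potential_op mu Kt f x| <= 2%:E * l)%E.
    exact: (potential_op_le hX eta1 X2 m0 pK rd adm dec mf x).
  have ll : ((a / (2 * u x))%:E < l)%E.
    rewrite ltNge; apply/negP => le; move: alt; rewrite ltNge => /negP; apply.
    have u0' : (0 <= (u x)%:E)%E by rewrite lee_fin ltW.
    apply: (le_trans (lee_wpmul2r u0' Tl)).
    have two0 : (0 <= 2%:E :> \bar R)%E by rewrite lee_fin.
    apply: (le_trans (lee_wpmul2r u0' (lee_wpmul2l two0 le))).
    rewrite -!EFinM lee_fin le_eqVlt; apply/orP; left; apply/eqP; field.
    by rewrite gt_eqF.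
  have [n0 n0P] := lt_limn_einf ll.
  exists (maxn n0 (Num.bound (rho x0 x))) => n; rewrite geq_max => /andP[/n0P nl nb].
  rewrite -aE; apply: gt0_ler_poweR; rewrite ?(ltW q0)//.
  + by rewrite in_itv/= leey andbT lee_fin.
  + by rewrite in_itv/= leey andbT mule_ge0.
  have xn : qball rho x0 (top_radius n) x.
    rewrite (qball_cap hX eta1 X2) /qball/=.
    rewrite (lt_le_trans (archi_boundP _)) ?(rho_ge0 hX)//.
    by rewrite -natrX ler_nat (leq_trans nb)// ltnW// ltn_expl.
  have [_ _ /(_ x xn) pH _] := HnP n.
  have sce : (0 <= sc%:E)%E by rewrite lee_fin.
  have h := le_trans (ltW nl) (lee_wpmul2l sce pH).
  have u0' : (0 <= (2 * u x)%:E)%E by rewrite lee_fin mulr_ge0.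
  have := lee_wpmul2r u0' h; rewrite -EFinM divfK; last by rewrite gt_eqF// mulr_gt0.
  move=> /le_trans; apply; rewrite !EFinM le_eqVlt; apply/orP; left; apply/eqP.
  by rewrite muleACA [X in (X * _)%E]muleC.
- move=> n; have [_ _ _ h] := HnP n.
  under eq_integral do rewrite poweRM//.
  rewrite ge0_integralZl ?poweR_ge0//; last 2 first.
  + exact: (measurableT_comp (measurable_poweR q)).
  + by move=> x _; exact: poweR_ge0.
  apply: (le_trans (lee_wpmul2l (poweR_ge0 _ _) h)).
  by rewrite poweR_EFin -EFinM lee_fin [leRHS]powRM// -lee_fin.
Qed.

End ScaleBound.

(** * The two-weight inequality *)

Theorem theorem2 (R : realType)
  (* exponents *)
  (m : nat) (p_ : 'I_m -> R) (p q t : R)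
  (m_gt0 : (0 < m)%N)
  (p_gt1 : forall i, 1 < p_ i)
  (pE : p^-1 = \sum_(i < m) (p_ i)^-1)
  (p_lb : m%:R^-1 < p) (p_le_q : p <= q) (t_gt1 : 1 < t)
  (* structural constants: quasi-triangle, doubling, reverse doubling, growth,
     definition of phi, decay, weight condition *)
  (kappa L : R) (c delta : R -> R) (Cg : R -> R)
  (eta : R) (c0 : R -> R) (eps : R) (C2 H : R -> R) (A : R)
  (eta_gt1 : 1 < eta) (c0_adm : admissible c delta c0) :
  exists C : R,
  forall (d : measure_display) (X : measurableType d)
    (rho : X -> X -> R) (mu : {measure set X -> \bar R})
    (Kt : m.-tuple X -> m.-tuple X -> R)
    (u : X -> R) (v : 'I_m -> X -> R),
  (* diam rho > 0: on a one-point space no radius satisfies r <= eta * diam rho,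
     so phi and the weight condition would be void *)
  (exists x y : X, x <> y) ->
  homogeneous_type rho mu kappa L ->
  reverse_doubling rho mu c delta ->
  potential_kernel rho Kt Cg ->
  decay rho mu Kt c0 eps C2 H ->
  weight u -> (forall i, weight (v i)) ->
  (1 < q -> (weight_sup rho mu Kt eta (c0 eta) q t (q * t) p_ u v <= A%:E)%E) ->
  (q <= 1 -> (weight_sup rho mu Kt eta (c0 eta) q t q p_ u v <= A%:E)%E) ->
  forall f : 'I_m -> X -> R,
  (forall i, weighted_Lp mu (p_ i) (v i) (f i)) ->
  (weighted_norm mu q u (potential_op mu Kt f) <=
   C%:E * \prod_(k < m) weighted_norm mu (p_ k) (v k) (EFin \o f k))%E.
Proof.
have p0 : 0 < p by rewrite (le_lt_trans _ p_lb).
have q0 : 0 < q := lt_le_trans p0 p_le_q.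
have sum_p : q^-1 <= \sum_(i < m) (p_ i)^-1 by rewrite -pE lef_pV2.
(* [A] may be negative only if the weight condition is contradictory *)
pose A' := Num.max A 0.
have A'0 : 0 <= A' by rewrite le_max lexx orbT.
(* the exponent on [u] in the weight condition *)
pose s := if q <= 1 then q else q * t.
pose cc i := carleson_const kappa L (exp_ratio p_ t i).
exists (2 * scale_const kappa eta m Cg c0 H *
  (domination_const m kappa L (C2 (2 * eta)) (2 `^ (- eps)) *
   (compar_kernel kappa eta m Cg c0 H * A' * norm_const m kappa L q t *
    \prod_(i < m) cc i `^ (p_ i)^-1))).
move=> d X rho mu Kt u v X2 hX rd pK dec wu wv w1 w2 f fL.
have wA : (weight_sup rho mu Kt eta (c0 eta) q t s p_ u v <= A'%:E)%E.
  apply: (@le_trans _ _ A%:E); last by rewrite lee_fin le_max lexx.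
  by rewrite /s; have [/w2|/w1] := leP q 1.
have mf i : measurable_fun [set: X] (f i) by have [] := fL i.
have gy i : (\int[mu]_x ((`|f i x| * v i x) `^ p_ i)%:E < +oo)%E.
  have [_ v0] := wv i; have [_] := fL i; congr (_ < _)%E.
  by apply: eq_integral => x _; rewrite powRM.
have := potential_bound hX eta_gt1 X2 m_gt0 pK rd c0_adm dec p_gt1 q0 t_gt1 wu wv mf wA
  A'0 erefl sum_p gy.
have sc0 : 0 <= scale_const kappa eta m Cg c0 H.
  exact: (scale_const_ge0 hX eta_gt1 m_gt0 pK c0_adm dec).
have sb0 := scale_bound_ge0 hX eta_gt1 X2 m_gt0 pK c0_adm dec p_ q t v f A'0.
have L0 : 0 <= L by have [x _] := X2; rewrite (le_trans ler01)// (doubling_ge1 hX x).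
have normE i : weighted_norm mu (p_ i) (v i) (EFin \o f i) =
    ((lp_mass mu p_ v f i) `^ (p_ i)^-1)%:E.
  rewrite /weighted_norm -poweR_EFin -lp_massE//; congr (_ `^ _)%E.
have prodE : (\prod_(i < m) weighted_norm mu (p_ i) (v i) (EFin \o f i))%E =
    (\prod_(i < m) lp_mass mu p_ v f i `^ (p_ i)^-1)%:E.
  by rewrite EFin_prod; apply: eq_bigr => i _; exact: normE.
rewrite prodE -EFinM => h.
apply: (@le_trans _ _ (2 * scale_const kappa eta m Cg c0 H *
    scale_bound mu kappa L eta Cg c0 eps C2 H p_ q t A' v f)%:E); last first.
  rewrite lee_fin le_eqVlt; apply/orP; left; apply/eqP.
  rewrite /scale_bound (eq_bigr (fun i => cc i `^ (p_ i)^-1 * lp_mass mu p_ v f i `^ (p_ i)^-1)).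
    by rewrite big_split/=; ring.
  move=> i _; rewrite powRM ?lp_mass_ge0//.
  by apply: carleson_const_ge0 => //; exact: exp_ratio_gt1.
have b0 : 0 <= 2 * scale_const kappa eta m Cg c0 H *
    scale_bound mu kappa L eta Cg c0 eps C2 H p_ q t A' v f.
  by rewrite mulr_ge0// mulr_ge0.
have powK (r : R) : 0 <= r -> r%:E = (((r `^ q)%:E) `^ q^-1)%E.
  by move=> r0; rewrite poweR_EFin -powRrM divff ?gt_eqF// powRr1.
rewrite (powK _ b0); apply: gt0_ler_poweR h; rewrite ?invr_ge0 ?(ltW q0)//.
- by rewrite in_itv/= leey andbT integral_ge0// => x _; exact: poweR_ge0.
- by rewrite in_itv/= leey andbT lee_fin powR_ge0.
Qed.
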